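(* Let $\Gamma$ be a four block operator such that $\|\Gamma\|_{\rm e}<\|\Gamma\|$ and let $\Phi$ be a superoptimal symbol of $\Gamma$ (so $\Gamma=\Gamma_\Phi$). Let $\Phi^{(1)}$ be the block matrix function and $u_0$ the unimodular function associated with $\Phi$ by the factorization $$\Phi=W^*\begin{pmatrix}t_0u_0&0\\ 0&\Phi^{(1)}\end{pmatrix}V^*$$ described in the context, where $t_0=\|\Gamma\|$, and let $k_0=\dim\operatorname{Ker}T_{u_0}$. Then $$s_j(\Gamma_{\Phi^{(1)}})\le s_{j+k_0}(\Gamma_\Phi),\qquad j\in\mathbb Z_+.$$
   Context: $\mathbb T$ is the unit circle, $z$ the identity function on $\mathbb T$; $H^2_-=L^2\ominus H^2$; $M_{k,l}$ is the space of $k\times l$ matrices; $\|F\|_\infty=\operatorname{ess\,sup}_{\zeta\in\mathbb T}\|F(\zeta)\|$; $\|T\|_{\rm e}$ is the essential norm; $s_j(T)$ ($j\in\mathbb Z_+=\{0,1,2,\dots\}$) is the distance from $T$ to the operators (matrices) of rank at most $j$. For $\varphi\in L^\infty$, $T_\varphi:H^2\to H^2$, $T_\varphi f=\mathbb P_+\varphi f$. Blocks with zero rows or columns are treated as empty. Four block operator: $m=m_1+m_2$, $n=n_1+n_2$, $d=\min\{m_1,n_1\}$. For $\Phi=\begin{pmatrix}\Phi_{11}&\Phi_{12}\\ \Phi_{21}&\Phi_{22}\end{pmatrix}\in L^\infty(M_{m,n})$ with $\Phi_{11}$ of size $m_1\times n_1$ and $\Phi_{22}$ of size $m_2\times n_2$,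 $\Gamma_\Phi:H^2(\mathbb C^{n_1})\oplus L^2(\mathbb C^{n_2})\to H^2_-(\mathbb C^{m_1})\oplus L^2(\mathbb C^{m_2})$ is $\Gamma_\Phi f=\mathbb P^-\Phi f$, $\mathbb P^-$ the orthogonal projection onto $H^2_-(\mathbb C^{m_1})\oplus L^2(\mathbb C^{m_2})$. $\Gamma_{\Phi^{(1)}}$ is defined likewise, with $m_1,n_1$ replaced by $m_1-1,n_1-1$. Superoptimality: for $Q\in H^\infty(M_{m_1,n_1})$ put $\Phi_Q=\begin{pmatrix}\Phi_{11}-Q&\Phi_{12}\\ \Phi_{21}&\Phi_{22}\end{pmatrix}$. $\Omega_0$ is the set of $Q$ minimizing $\|\Phi_Q\|_\infty$, $\Omega_j$ the set of $Q\in\Omega_{j-1}$ minimizing $\operatorname{ess\,sup}_\zeta s_j(\Phi_Q(\zeta))$ over $\Omega_{j-1}$; superoptimal solutions are the elements of $\Omega_{d-1}$. $\Phi$ is a superoptimal symbol of $\Gamma$ if $\Gamma=\Gamma_\Phi$ and $Q=0$ is a superoptimal solution for $\Phi$; then $\|\Phi\|_\infty=\|\Gamma_\Phi\|=t_0$. Inner/outer: $\Theta\in H^\infty$ is inner if $\Theta(\zeta)$ is isometric a.e.; $F\in H^\infty(M_{k,l})$ is outer if $FH^2(\mathbb C^l)$ is dense in $H^2(\mathbb C^k)$, co-outer if $F^t$ is outer. Factorization: fix a maximizing vector $f=f_1\oplus f_2$ of $\Gamma_\Phi$ ($f\ne0$, $\|\Gamma_\Phi f\|=\|\Gamma_\Phi\|\,\|f\|$;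 it exists), and put $g=g_1\oplus g_2=t_0^{-1}\Gamma_\Phi f$. Then $f_1\neq0$, $g_1\ne0$ and $\|g(\zeta)\|=\|f(\zeta)\|$ a.e. Let $h\in H^2$ be scalar outer with $|h(\zeta)|=\|f(\zeta)\|$ a.e.; let $\vartheta$ be a greatest common inner divisor of the entries of $f_1$ and $\tau$ one of the entries of $\bar z\bar g_1$. Put $v=v_1\oplus v_2=\bar\vartheta f/h$, $w=w_1\oplus w_2=\bar z\bar\tau\bar g/h$, $u_0=\bar z\bar\vartheta\bar\tau\bar h/h$ ($T_{u_0}$ is then Fredholm). Write $v_1=v_{(o)}v_{(i)}$, $w_1=w_{(o)}w_{(i)}$ with $v_{(o)},w_{(o)}$ scalar outer and $v_{(i)},w_{(i)}$ inner columns. Choose inner co-outer $V_c\in H^\infty(M_{n_1,n_1-1})$, $W_c\in H^\infty(M_{m_1,m_1-1})$ such that $(v_{(i)}\ \ \overline{V_c})$ and $(w_{(i)}\ \ \overline{W_c})$ are unitary-valued, and unitary-valued measurable $V$ ($n\times n$), $W$ ($m\times m$) of the form $$V=\begin{pmatrix}v_1&\overline{V_c}&\star\\ v_2&0&\star\end{pmatrix},\qquad W^t=\begin{pmatrix}w_1&\overline{W_c}&\star\\ w_2&0&\star\end{pmatrix}.$$ Then $W\Phi V=\begin{pmatrix}t_0u_0&0\\0&\Phi^{(1)}\end{pmatrix}$, which defines $\Phi^{(1)}=\begin{pmatrix}\Phi^{(1)}_{11}&\Phi^{(1)}_{12}\\ \Phi^{(1)}_{21}&\Phi^{(1)}_{22}\end{pmatrix}$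 with $\Phi^{(1)}_{11}$ of size $(m_1-1)\times(n_1-1)$. *)

(* Defs.v *)
From mathcomp Require Import all_boot all_order all_algebra.
From mathcomp Require Import complex.
From mathcomp Require Import all_classical all_reals all_analysis.
From mathcomp Require Import ess_sup_inf.

Set Implicit Arguments.
Unset Strict Implicit.
Unset Printing Implicit Defensive.

Import Order.TTheory GRing.Theory Num.Theory.
Import numFieldNormedType.Exports.

Local Open Scope classical_set_scope.
Local Open Scope ring_scope.
Local Open Scope complex_scope.

(* The circle is parametrized by the angle: a function on T is a function of
   t : R, and T carries the normalized Lebesgue measure on [0, 2 pi], seen as a
   measure on R, so that values outside of [0, 2 pi] are irrelevant.  Functions
   are representatives: equality in L^2 and L^infty is a.e. equality. *)

Section circle.
Context {R : realType}.

Lemma twopi_gt0 : 0 < pi *+ 2 :> R.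
Proof. by rewrite mulrn_wgt0// pi_gt0. Qed.

Definition circ : {measure set (measurableTypeR R) -> \bar R} :=
  uniform_prob twopi_gt0.

Definition z (t : R) : R[i] := cos t +i* sin t.

Definition cintegral (f : R -> R[i]) : R[i] :=
  (\int[circ]_t complex.Re (f t)) +i* (\int[circ]_t complex.Im (f t)).

Definition fourier (f : R -> R[i]) (k : int) : R[i] :=
  cintegral (fun t => f t * (z t) ^ (- k)).

End circle.

Section matrices.
Context {R : realType}.

Definition mxbar m n (A : 'M[R[i]]_(m, n)) : 'M[R[i]]_(m, n) :=
  map_mx (fun c => c^*) A.

Definition vnorm n (x : 'cV[R[i]]_n) : R :=
  Num.sqrt (\sum_i complex.Re `|x i 0| ^+ 2).

Definition mxopnorm m n (A : 'M[R[i]]_(m, n)) : R :=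
  sup [set vnorm (A *m x) | x in [set x | vnorm x <= 1]].

Definition mxsnum m n (j : nat) (A : 'M[R[i]]_(m, n)) : R :=
  inf [set mxopnorm (A - B) | B in [set B : 'M[R[i]]_(m, n) | (\rank B <= j)%N]].

End matrices.

Section function_spaces.
Context {R : realType}.

(* Scalar functions are identified with C^1-valued ones. *)
Definition scal (f : R -> R[i]) : R -> 'cV[R[i]]_1 := fun t => (f t)%:M.

Definition mxmeasurable m n (F : R -> 'M[R[i]]_(m, n)) : Prop :=
  forall i j,
    measurable_fun [set: measurableTypeR R] (fun t => complex.Re (F t i j)) /\
    measurable_fun [set: measurableTypeR R] (fun t => complex.Im (F t i j)).

Definition l2norm n (f : R -> 'cV[R[i]]_n) : \bar R :=
  Lnorm circ 2%:E (fun t => (vnorm (f t))%:E).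

Definition ip n (f g : R -> 'cV[R[i]]_n) : R[i] :=
  cintegral (fun t => \sum_i f t i 0 * (g t i 0)^*).

Definition L2 n : set (R -> 'cV[R[i]]_n) :=
  [set f | mxmeasurable f /\ (l2norm f < +oo)%E].

Definition H2 n : set (R -> 'cV[R[i]]_n) :=
  [set f | L2 f /\
    forall i (k : int), k < 0 -> fourier (fun t => f t i 0) k = 0].

Definition H2minus n : set (R -> 'cV[R[i]]_n) :=
  [set f | L2 f /\ forall g, H2 g -> ip f g = 0].

Definition linfnorm m n (F : R -> 'M[R[i]]_(m, n)) : \bar R :=
  ess_sup circ (fun t => (mxopnorm (F t))%:E).

Definition Linf m n : set (R -> 'M[R[i]]_(m, n)) :=
  [set F | mxmeasurable F /\ (linfnorm F < +oo)%E].

Definition Hinf m n : set (R -> 'M[R[i]]_(m, n)) :=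
  [set F | Linf F /\
    forall i j (k : int), k < 0 -> fourier (fun t => F t i j) k = 0].

(* The value is arbitrary when no projection exists, which does not happen for
   f in L^2 and E one of the closed subspaces used below. *)
Definition oproj n (E : set (R -> 'cV[R[i]]_n)) (f : R -> 'cV[R[i]]_n) :
    R -> 'cV[R[i]]_n :=
  xget 0 [set g | E g /\ forall e, E e -> ip (f - g) e = 0].

Definition inner m n (F : R -> 'M[R[i]]_(m, n)) : Prop :=
  Hinf F /\ \forall t \ae circ, forall x, vnorm (F t *m x) = vnorm x.

Definition outer m n (F : R -> 'M[R[i]]_(m, n)) : Prop :=
  Hinf F /\
  forall g, H2 g -> forall e : R, 0 < e ->
    exists2 f, H2 f & (l2norm (fun t => (g t - F t *m f t)%R) < e%:E)%E.

Definition co_outer m n (F : R -> 'M[R[i]]_(m, n)) : Prop :=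
  outer (fun t => (F t)^T).

(* For a possibly unbounded h in H^2, the operator of multiplication by h is
   only densely defined; h is outer if its polynomial multiples are dense. *)
Definition outer_H2 (h : R -> R[i]) : Prop :=
  H2 (scal h) /\
  forall g, H2 (scal g) -> forall e : R, 0 < e ->
    exists a : {poly R[i]},
      (l2norm (scal (fun t => (g t - a.[z t] * h t)%R)) < e%:E)%E.

Definition inner_dvd (omega f : R -> R[i]) : Prop :=
  exists2 g, H2 (scal g) & \forall t \ae circ, f t = omega t * g t.

Definition is_gcid n (theta : R -> R[i]) (f : R -> 'cV[R[i]]_n) : Prop :=
  [/\ inner (scal theta),
      forall i, inner_dvd theta (fun t => f t i 0) &
      forall omega, inner (scal omega) ->
        (forall i, inner_dvd omega (fun t => f t i 0)) ->
        inner_dvd omega theta].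

End function_spaces.

(* Operators from a subspace D of L^2(C^n) to a subspace E of L^2(C^m). *)
Section operators.
Context {R : realType} {n m : nat}.
Implicit Types (D : set (R -> 'cV[R[i]]_n)) (E : set (R -> 'cV[R[i]]_m)).
Implicit Types T K : (R -> 'cV[R[i]]_n) -> (R -> 'cV[R[i]]_m).

Definition op_norm D T : \bar R :=
  ereal_sup [set l2norm (T f) | f in [set f | D f /\ (l2norm f <= 1)%E]].

Definition bounded_linear D E T : Prop :=
  [/\ forall f, D f -> E (T f),
      forall (a : R[i]) f g, D f -> D g ->
        \forall t \ae circ, T (a *: f + g) t = a *: T f t + T g t &
      (op_norm D T < +oo)%E].

Definition rank_le D (j : nat) T : Prop :=
  exists b : 'I_j -> (R -> 'cV[R[i]]_m), forall f, D f ->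
    exists c : 'I_j -> R[i], \forall t \ae circ, T f t = \sum_i c i *: b i t.

Definition compact_op D E T : Prop :=
  forall f : nat -> (R -> 'cV[R[i]]_n),
    (forall k, D (f k) /\ (l2norm (f k) <= 1)%E) ->
    exists (phi : nat -> nat) (g : R -> 'cV[R[i]]_m),
      [/\ {homo phi : k l / (k < l)%N}, E g &
          l2norm (T (f (phi k)) - g) @[k --> \oo] --> (0 : \bar R)].

Definition ess_norm D E T : \bar R :=
  ereal_inf [set op_norm D (T \- K) |
    K in [set K | bounded_linear D E K /\ compact_op D E K]].

Definition snum D E (j : nat) T : \bar R :=
  ereal_inf [set op_norm D (T \- K) |
    K in [set K | bounded_linear D E K /\ rank_le D j K]].

End operators.

Section dimension.
Context {R : realType} {n : nat}.

Definition has_dim (S : set (R -> 'cV[R[i]]_n)) (k : nat) : Prop :=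
  exists b : 'I_k -> (R -> 'cV[R[i]]_n),
    [/\ forall i, S (b i),
        forall c : 'I_k -> R[i],
          (\forall t \ae circ, \sum_i c i *: b i t = 0) -> forall i, c i = 0 &
        forall f, S f -> exists c : 'I_k -> R[i],
          \forall t \ae circ, f t = \sum_i c i *: b i t].

(* Dimension modulo a.e. equality; 0 by convention for infinite dimension. *)
Definition hdim (S : set (R -> 'cV[R[i]]_n)) : nat := xget 0%N (has_dim S).

End dimension.

Section toeplitz.
Context {R : realType}.

Definition Toeplitz (phi : R -> R[i]) (f : R -> 'cV[R[i]]_1) :
    R -> 'cV[R[i]]_1 :=
  oproj (@H2 R 1) (fun t => phi t *: f t).

Definition KerT (phi : R -> R[i]) : set (R -> 'cV[R[i]]_1) :=
  [set f | H2 f /\ \forall t \ae circ, Toeplitz phi f t = 0].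

End toeplitz.

Section four_block.
Context {R : realType}.

Definition fb_dom n1 n2 : set (R -> 'cV[R[i]]_(n1 + n2)) :=
  [set f | H2 (fun t => usubmx (f t)) /\ L2 (fun t => dsubmx (f t))].

Definition fb_cod m1 m2 : set (R -> 'cV[R[i]]_(m1 + m2)) :=
  [set f | H2minus (fun t => usubmx (f t)) /\ L2 (fun t => dsubmx (f t))].

Definition Gamma m1 m2 n1 n2 (Phi : R -> 'M[R[i]]_(m1 + m2, n1 + n2))
    (f : R -> 'cV[R[i]]_(n1 + n2)) : R -> 'cV[R[i]]_(m1 + m2) :=
  oproj (@fb_cod m1 m2) (fun t => Phi t *m f t).

Definition fb_op_norm m1 m2 n1 n2
    (T : (R -> 'cV[R[i]]_(n1 + n2)) -> (R -> 'cV[R[i]]_(m1 + m2))) : \bar R :=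
  op_norm (@fb_dom n1 n2) T.

Definition fb_ess_norm m1 m2 n1 n2
    (T : (R -> 'cV[R[i]]_(n1 + n2)) -> (R -> 'cV[R[i]]_(m1 + m2))) : \bar R :=
  ess_norm (@fb_dom n1 n2) (@fb_cod m1 m2) T.

Definition fb_snum m1 m2 n1 n2 (j : nat)
    (T : (R -> 'cV[R[i]]_(n1 + n2)) -> (R -> 'cV[R[i]]_(m1 + m2))) : \bar R :=
  snum (@fb_dom n1 n2) (@fb_cod m1 m2) j T.

Definition is_Gamma m1 m2 n1 n2
    (T : (R -> 'cV[R[i]]_(n1 + n2)) -> (R -> 'cV[R[i]]_(m1 + m2)))
    (Phi : R -> 'M[R[i]]_(m1 + m2, n1 + n2)) : Prop :=
  Linf Phi /\
  forall f, fb_dom f -> \forall t \ae circ, T f t = Gamma Phi f t.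

Definition four_block_operator m1 m2 n1 n2
    (T : (R -> 'cV[R[i]]_(n1 + n2)) -> (R -> 'cV[R[i]]_(m1 + m2))) : Prop :=
  exists Phi, is_Gamma T Phi.

Section superoptimal.
Context {m1 m2 n1 n2 : nat}.
Implicit Types (Phi : R -> 'M[R[i]]_(m1 + m2, n1 + n2)).
Implicit Types (Q : R -> 'M[R[i]]_(m1, n1)).

Definition perturb Phi Q : R -> 'M[R[i]]_(m1 + m2, n1 + n2) :=
  fun t => Phi t - block_mx (Q t) 0 0 0.

Definition sinf (j : nat) (F : R -> 'M[R[i]]_(m1 + m2, n1 + n2)) : \bar R :=
  ess_sup circ (fun t => (mxsnum j (F t))%:E).

Fixpoint Omega Phi (j : nat) : set (R -> 'M[R[i]]_(m1, n1)) :=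
  match j with
  | 0 => [set Q | Hinf Q /\ forall Q', Hinf Q' ->
            (linfnorm (perturb Phi Q) <= linfnorm (perturb Phi Q'))%E]
  | j'.+1 => [set Q | Omega Phi j' Q /\ forall Q', Omega Phi j' Q' ->
            (sinf j (perturb Phi Q) <= sinf j (perturb Phi Q'))%E]
  end.

Definition superoptimal_solution Phi : set (R -> 'M[R[i]]_(m1, n1)) :=
  Omega Phi (minn m1 n1).-1.

Definition superoptimal_symbol Phi
    (T : (R -> 'cV[R[i]]_(n1 + n2)) -> (R -> 'cV[R[i]]_(m1 + m2))) : Prop :=
  is_Gamma T Phi /\ superoptimal_solution Phi (fun=> 0).

Definition maximizing Phi (f : R -> 'cV[R[i]]_(n1 + n2)) : Prop :=
  [/\ fb_dom f, ~ (\forall t \ae circ, f t = 0) &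
      l2norm (Gamma Phi f) = (fb_op_norm (Gamma Phi) * l2norm f)%E].

End superoptimal.

(* Here m_1 = p.+1 and n_1 = q.+1.  The type (1 + (p + m2)) is convertible to
   (p.+1 + m2), which gives the splitting of W Phi V. *)
Record factorization p q m2 n2
    (Phi : R -> 'M[R[i]]_(p.+1 + m2, q.+1 + n2)) := Factorization {
  fac_t0 : R := fine (fb_op_norm (Gamma Phi));

  fac_f : R -> 'cV[R[i]]_(q.+1 + n2);
  fac_fP : maximizing Phi fac_f;
  fac_g : R -> 'cV[R[i]]_(p.+1 + m2) :=
    fun t => (fac_t0^-1)%:C *: Gamma Phi fac_f t;

  fac_h : R -> R[i];
  fac_h_outer : outer_H2 fac_h;
  fac_h_mod : \forall t \ae circ, `|fac_h t| = (vnorm (fac_f t))%:C;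

  fac_theta : R -> R[i];
  fac_thetaP : is_gcid fac_theta (fun t => usubmx (fac_f t));
  fac_tau : R -> R[i];
  fac_tauP : is_gcid fac_tau (fun t => (z t)^* *: mxbar (usubmx (fac_g t)));

  fac_v : R -> 'cV[R[i]]_(q.+1 + n2) :=
    fun t => ((fac_theta t)^* / fac_h t) *: fac_f t;
  fac_w : R -> 'cV[R[i]]_(p.+1 + m2) :=
    fun t => ((z t)^* * (fac_tau t)^* / fac_h t) *: mxbar (fac_g t);
  fac_u0 : R -> R[i] :=
    fun t => (z t)^* * (fac_theta t)^* * (fac_tau t)^* * (fac_h t)^* / fac_h t;

  fac_vo : R -> R[i];
  fac_vi : R -> 'cV[R[i]]_q.+1;
  fac_vo_outer : outer (scal fac_vo);
  fac_vi_inner : inner fac_vi;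
  fac_v1E : \forall t \ae circ, usubmx (fac_v t) = fac_vo t *: fac_vi t;

  fac_wo : R -> R[i];
  fac_wi : R -> 'cV[R[i]]_p.+1;
  fac_wo_outer : outer (scal fac_wo);
  fac_wi_inner : inner fac_wi;
  fac_w1E : \forall t \ae circ, usubmx (fac_w t) = fac_wo t *: fac_wi t;

  fac_Vc : R -> 'M[R[i]]_(q.+1, q);
  fac_Vc_inner : inner fac_Vc;
  fac_Vc_co_outer : co_outer fac_Vc;
  fac_Vc_unitary : \forall t \ae circ,
    (row_mx (fac_vi t) (mxbar (fac_Vc t)) : 'M[R[i]]_q.+1) \is unitarymx;

  fac_Wc : R -> 'M[R[i]]_(p.+1, p);
  fac_Wc_inner : inner fac_Wc;
  fac_Wc_co_outer : co_outer fac_Wc;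
  fac_Wc_unitary : \forall t \ae circ,
    (row_mx (fac_wi t) (mxbar (fac_Wc t)) : 'M[R[i]]_p.+1) \is unitarymx;

  fac_Vstar : R -> 'M[R[i]]_(q.+1 + n2, n2);
  fac_V : R -> 'M[R[i]]_(q.+1 + n2);
  fac_V_measurable : mxmeasurable fac_V;
  fac_V_unitary : \forall t \ae circ, fac_V t \is unitarymx;
  fac_VE : \forall t \ae circ, fac_V t =
    row_mx (fac_v t) (row_mx (col_mx (mxbar (fac_Vc t)) 0) (fac_Vstar t))
      :> 'M[R[i]]_(q.+1 + n2, 1 + (q + n2));

  fac_Wstar : R -> 'M[R[i]]_(p.+1 + m2, m2);
  fac_W : R -> 'M[R[i]]_(p.+1 + m2);
  fac_W_measurable : mxmeasurable fac_W;
  fac_W_unitary : \forall t \ae circ, fac_W t \is unitarymx;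
  fac_WE : \forall t \ae circ, (fac_W t)^T =
    row_mx (fac_w t) (row_mx (col_mx (mxbar (fac_Wc t)) 0) (fac_Wstar t))
      :> 'M[R[i]]_(p.+1 + m2, 1 + (p + m2));

  fac_Phi1 : R -> 'M[R[i]]_(p + m2, q + n2);
  fac_Phi1_measurable : mxmeasurable fac_Phi1;
  fac_Phi1E : \forall t \ae circ, fac_W t *m Phi t *m fac_V t =
    block_mx (fac_t0%:C * fac_u0 t)%:M 0 0 (fac_Phi1 t)
      :> 'M[R[i]]_(1 + (p + m2), 1 + (q + n2))
}.

End four_block.

(* Main.v *)
(** If [s_j(Gamma_{Phi1}) > s], some [j+1]-dimensional space [P] of the domain of
    [Gamma_{Phi1}] carries a positive form [|Gamma_{Phi1} g|^2 - s^2 |g|^2]; after a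
    perturbation, [P] lies in the dense range of [f |-> b f], the last [q + n2]
    coordinates of [V^* f].  As [V] and [W] are unitary,
    [|Phi f|^2 = t0^2 |v^* f|^2 + |Phi1 b f|^2].  If [r] is orthogonal to [H^2_- + L^2]
    and to all [Phi f] with [b f = 0], then the first coordinate of [W r] is a function
    of [H^2] orthogonal to [u0 H^2]; it vanishes, because its product with the conjugate
    of [u0 h] has no nonzero Fourier coefficient.  So [W r] is orthogonal to the codomain of
    [Gamma_{Phi1}].  Hence each vector of [P] lifts to an [f] for which the part of
    [Phi f] lost by the projection is, up to an arbitrarily small error, at most the part
    of [Phi1 b f] lost by [Gamma_{Phi1}], and the lifted space is still positive for
    [|Gamma_Phi f|^2 - s^2 |f|^2].  On [v Ker T_{u0}] the operator [Gamma_Phi] is [t0]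
    times an isometry with [t0 > s], which adds [k0] dimensions.  A positive space of
    dimension [j + 1 + k0] meets the kernel of every operator of rank [j + k0], so
    [s_{j + k0}(Gamma_Phi) >= s]. *)

Require Import Defs.
From HB Require Import structures.
From mathcomp Require Import all_boot all_order all_algebra.
From mathcomp Require Import complex.
From mathcomp Require Import all_classical all_reals all_analysis.
From mathcomp Require Import ess_sup_inf measurable_realfun.
From mathcomp Require Import ring lra.

Set Implicit Arguments.
Unset Strict Implicit.
Unset Printing Implicit Defensive.

Import Order.TTheory GRing.Theory Num.Theory.
Import numFieldNormedType.Exports.

Local Open Scope classical_set_scope.
Local Open Scope ring_scope.
Local Open Scope complex_scope.

(* Inside ring expressions [x ^*] would otherwise denote the convertible [Num.conj x]. *)
Local Notation "x ^*" := (conjc x) : ring_scope.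

(** * Hilbert spaces with a semidefinite form *)

Section complex_facts.
Context {R : realType}.
Local Notation C := R[i].

(** The form [|G f|^2 - s^2 |f|^2] bounds singular numbers from both sides: an operator of rank [j]
    within [s] of [G] forbids a positive space of dimension [j + 1], and a maximal positive family
    yields an approximation of finite rank. So [s] can be the norm of [Gamma_Phi - K] for an
    arbitrary competitor [K], whether or not the infimum is attained. The obstacle is that the
    projection does not commute with [V] and [W]: an arbitrary lift of [g] gives no control on what
    the projection removes. The remaining freedom is to add vectors [n] with [b n = 0]. The parts
    removed from the [Phi n] form a subspace that need not be closed, so they can be used only up to
    an error. Moreover the combination to be tested is known only after the lifts have been fixed.
    The error must therefore be relative to its coefficients: for a basis orthonormal with respect
    to the form, the gain is exactly the sum of the [|c_i|^2], and the error is made a smaller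
    multiple of the same sum. Since functions are representatives, inner products are semidefinite,
    and projections are determined only up to null vectors. *)

Definition csq (c : C) : R := complex.Re c ^+ 2 + complex.Im c ^+ 2.

Lemma csq_ge0 c : 0 <= csq c.
Proof. by rewrite addr_ge0 ?sqr_ge0. Qed.

Lemma csq_eq0 c : csq c = 0 -> c = 0.
Proof.
case: c => a b /eqP; rewrite /csq /= paddr_eq0 ?sqr_ge0// !sqrf_eq0.
by move=> /andP[/eqP -> /eqP ->].
Qed.

Lemma csqE c : (csq c)%:C = c * c^*.
Proof. by case: c => a b; apply/eqP; rewrite eq_complex /csq /=; apply/andP; split; apply/eqP; ring. Qed.

Lemma csq_norm c : csq c = complex.Re `|c| ^+ 2.
Proof. by rewrite normc_def /= sqr_sqrtr ?addr_ge0 ?sqr_ge0. Qed.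

Lemma csqM c d : csq (c * d) = csq c * csq d.
Proof. by case: c => a b; case: d => x y; rewrite /csq /=; ring. Qed.

Lemma csqJ c : csq c^* = csq c.
Proof. by case: c => a b; rewrite /csq /=; ring. Qed.

Lemma csqD c d : csq (c + d) <= 2 * (csq c + csq d).
Proof.
case: c => a b; case: d => x y; rewrite /csq /=.
have := sqr_ge0 (a - x); have := sqr_ge0 (b - y); lra.
Qed.

Lemma csqC (r : R) : csq r%:C = r ^+ 2.
Proof. by rewrite /csq /=; ring. Qed.

Lemma csq0 : csq 0 = 0 :> R.
Proof. by rewrite /csq /=; ring. Qed.

Lemma csq1 : csq 1 = 1 :> R.
Proof. by rewrite /csq /=; ring. Qed.

Lemma ReD (c d : C) : complex.Re (c + d) = complex.Re c + complex.Re d.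
Proof. by case: c; case: d. Qed.

Lemma ImD (c d : C) : complex.Im (c + d) = complex.Im c + complex.Im d.
Proof. by case: c; case: d. Qed.

Lemma ReM (c d : C) : complex.Re (c * d) =
  complex.Re c * complex.Re d - complex.Im c * complex.Im d.
Proof. by case: c; case: d. Qed.

Lemma ImM (c d : C) : complex.Im (c * d) =
  complex.Re c * complex.Im d + complex.Im c * complex.Re d.
Proof. by case: c => a b; case: d => e f. Qed.

Lemma ReJ (c : C) : complex.Re c^* = complex.Re c.
Proof. by case: c. Qed.

Lemma ImJ (c : C) : complex.Im c^* = - complex.Im c.
Proof. by case: c. Qed.

Lemma complex_ext (c d : C) :
  complex.Re c = complex.Re d -> complex.Im c = complex.Im d -> c = d.
Proof. by case: c => a b; case: d => e f /= -> ->. Qed.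

Lemma conjMc (c d : C) : (c * d)^* = c^* * d^*.
Proof. exact: rmorphM. Qed.

Lemma conjDc (c d : C) : (c + d)^* = c^* + d^*.
Proof. exact: rmorphD. Qed.

Lemma conjNc (c : C) : (- c)^* = - c^*.
Proof. exact: rmorphN. Qed.

Lemma conj_sumc I (r : seq I) (P : pred I) (F : I -> C) :
  (\sum_(i <- r | P i) F i)^* = \sum_(i <- r | P i) (F i)^*.
Proof. exact: rmorph_sum. Qed.

Lemma ReN (c : C) : complex.Re (- c) = - complex.Re c.
Proof. by case: c. Qed.

Lemma ImN (c : C) : complex.Im (- c) = - complex.Im c.
Proof. by case: c. Qed.

Lemma ReRM (t : R) (c : C) : complex.Re (t%:C * c) = t * complex.Re c.
Proof. by case: c => a b /=; rewrite mul0r subr0. Qed.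

Lemma csq_quad (t : R) (c : C) : complex.Re ((t%:C * c)^* * c) = t * csq c.
Proof. by rewrite conjMc conjc_real -mulrA [c^* * c]mulrC -csqE ReRM. Qed.

End complex_facts.

(* The form may be degenerate: functions equal almost everywhere are not identified. *)
Record hilbert (R : realType) := Hilbert {
  hcarrier :> lmodType R[i];
  hip : hcarrier -> hcarrier -> R[i];
  hip_linearl : forall a x y w, hip (a *: x + y) w = a * hip x w + hip y w;
  hip_sym : forall x y, hip x y = (hip y x)^*;
  hip_ge0 : forall x, 0 <= complex.Re (hip x x);
  hip_complete : forall u : nat -> hcarrier,
    (forall e : R, 0 < e -> exists N, forall m n, (N <= m)%N -> (N <= n)%N ->
       complex.Re (hip (u m - u n) (u m - u n)) < e) ->
    exists x, forall e : R, 0 < e -> exists N, forall n, (N <= n)%N ->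
       complex.Re (hip (u n - x) (u n - x)) < e }.

Section hilbert_theory.
Context {R : realType} {H : hilbert R}.
Local Notation C := R[i].
Local Notation ip := (@hip R H).
Implicit Types x y w : H.

Definition nsq x : R := complex.Re (ip x x).

Lemma ipDl x y w : ip (x + y) w = ip x w + ip y w.
Proof. by rewrite -{1}[x]scale1r hip_linearl mul1r. Qed.

Lemma ip0l w : ip 0 w = 0.
Proof. by apply: (addrI (ip 0 w)); rewrite addr0 -ipDl addr0. Qed.

Lemma ipZl a x w : ip (a *: x) w = a * ip x w.
Proof. by rewrite -[a *: x]addr0 hip_linearl ip0l addr0. Qed.

Lemma ipNl x w : ip (- x) w = - ip x w.
Proof. by rewrite -scaleN1r ipZl mulN1r. Qed.

Lemma ipBl x y w : ip (x - y) w = ip x w - ip y w.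
Proof. by rewrite ipDl ipNl. Qed.

Lemma ipDr x y w : ip w (x + y) = ip w x + ip w y.
Proof. by rewrite hip_sym ipDl conjDc -!hip_sym. Qed.

Lemma ipZr a x w : ip w (a *: x) = a^* * ip w x.
Proof. by rewrite hip_sym ipZl conjMc -!hip_sym. Qed.

Lemma ipNr x w : ip w (- x) = - ip w x.
Proof. by rewrite hip_sym ipNl conjNc -!hip_sym. Qed.

Lemma ipBr x y w : ip w (x - y) = ip w x - ip w y.
Proof. by rewrite ipDr ipNr. Qed.

Lemma ip_suml k (c : 'I_k -> C) (u : 'I_k -> H) w :
  ip (\sum_i c i *: u i) w = \sum_i c i * ip (u i) w.
Proof.
elim: k c u => [|k IH] c u; first by rewrite !big_ord0 ip0l.
by rewrite !big_ord_recl ipDl ipZl IH.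
Qed.

Lemma ip_eq0C x y : ip x y = 0 -> ip y x = 0.
Proof. by move=> h; rewrite hip_sym h conjc0. Qed.

Lemma nsq_ge0 x : 0 <= nsq x.
Proof. exact: hip_ge0. Qed.

Lemma ipE x : ip x x = (nsq x)%:C.
Proof.
apply: complex_ext => //=.
have := hip_sym x x => /(congr1 (@complex.Im R)); rewrite ImJ; lra.
Qed.

Lemma nsqD x y : nsq (x + y) = nsq x + nsq y + 2 * complex.Re (ip x y).
Proof. by rewrite /nsq !ipDl !ipDr !ReD (hip_sym y x) ReJ; lra. Qed.

Lemma nsqZ a x : nsq (a *: x) = csq a * nsq x.
Proof.
by rewrite /nsq ipZl ipZr mulrA -csqE ipE ReM/= mul0r subr0.
Qed.

Lemma nsqN x : nsq (- x) = nsq x.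
Proof. by rewrite -scaleN1r nsqZ /csq /=; lra. Qed.

Lemma nsqB x y : nsq (x - y) = nsq x + nsq y - 2 * complex.Re (ip x y).
Proof. by rewrite nsqD nsqN ipNr ReN; lra. Qed.

Lemma nsq0 : nsq 0 = 0.
Proof. by rewrite /nsq ip0l. Qed.

Lemma nsqBC x y : nsq (x - y) = nsq (y - x).
Proof. by rewrite -nsqN opprB. Qed.

Lemma cauchy_schwarz x y : csq (ip x y) <= nsq x * nsq y.
Proof.
have h (t : R) : 0 <= nsq x + t ^+ 2 * csq (ip x y) * nsq y - 2 * t * csq (ip x y).
  have := nsq_ge0 (x - (t%:C * ip x y) *: y).
  by rewrite nsqB nsqZ ipZr csqM csqC csq_quad; lra.
have := nsq_ge0 y; rewrite le_eqVlt => /orP[/eqP y0|y0].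
  (* For a null [y] the bound [h] is affine in [t], and [t = (nsq x + 1) / csq (ip x y)] makes it
     negative. *)
  move: h; rewrite -y0 mulr0 => h.
  rewrite leNgt; apply/negP => c0.
  have := h (nsq x / csq (ip x y)).
  have := h ((nsq x + 1) / csq (ip x y)).
  rewrite -[2 * _ * _]mulrA divfK ?gt_eqF//.
  have := nsq_ge0 x; lra.
have := h (nsq y)^-1.
rewrite -(ler_pM2r y0) mul0r => h'.
have : nsq y * (nsq y)^-1 = 1 by rewrite divff ?gt_eqF.
move: h'; set i := _^-1; set c := csq _; set b := nsq y; set a := nsq x => h' bi.
have : (a + i ^+ 2 * c * b - 2 * i * c) * b = a * b + c * (b * i) ^+ 2 - 2 * c * (b * i) by ring.
rewrite bi; lra.
Qed.

(** Cauchy-Schwarz puts null vectors in the radical of the form, so that computations can be made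
    modulo them. *)
Lemma ip_null x y : nsq y = 0 -> ip x y = 0.
Proof.
move=> y0; apply: csq_eq0; apply/eqP; rewrite eq_le csq_ge0 andbT.
by rewrite (le_trans (cauchy_schwarz _ _))// y0 mulr0.
Qed.

Definition nrm x : R := Num.sqrt (nsq x).

Lemma nrm_ge0 x : 0 <= nrm x. Proof. exact: sqrtr_ge0. Qed.

Lemma nrm_sq x : nrm x ^+ 2 = nsq x.
Proof. by rewrite sqr_sqrtr ?nsq_ge0. Qed.

Lemma Re_le_sqrt_csq (c : C) (a : R) : 0 <= a -> csq c <= a ^+ 2 -> complex.Re c <= a.
Proof.
move=> a0 h; rewrite leNgt; apply/negP => ha.
have : a ^+ 2 < complex.Re c ^+ 2 by rewrite ltr_pXn2r// ?nnegrE// (le_trans a0)// ltW.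
by move: h; rewrite /csq; have := sqr_ge0 (complex.Im c); lra.
Qed.

Lemma Re_ip_le x y : complex.Re (ip x y) <= nrm x * nrm y.
Proof.
apply: Re_le_sqrt_csq; first by rewrite mulr_ge0 ?nrm_ge0.
by rewrite exprMn !nrm_sq cauchy_schwarz.
Qed.

Lemma nrmD x y : nrm (x + y) <= nrm x + nrm y.
Proof.
rewrite -(@ler_pXn2r _ 2)// ?nnegrE ?addr_ge0 ?nrm_ge0//.
by rewrite sqrrD !nrm_sq nsqD; have := Re_ip_le x y; lra.
Qed.

Lemma nrmB x y : nrm (x - y) = nrm (y - x).
Proof. by rewrite /nrm nsqBC. Qed.

Lemma nrm_lt x e : 0 < e -> (nrm x < e) = (nsq x < e ^+ 2).
Proof.
by move=> e0; rewrite -nrm_sq ltr_pXn2r ?nnegrE ?nrm_ge0 ?ltW.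
Qed.

Lemma nrm_le x e : 0 <= e -> (nrm x <= e) = (nsq x <= e ^+ 2).
Proof.
by move=> e0; rewrite -nrm_sq ler_pXn2r ?nnegrE ?nrm_ge0.
Qed.

Lemma nrm0_nsq x : nrm x = 0 -> nsq x = 0.
Proof. by rewrite -nrm_sq => ->; rewrite expr0n. Qed.

Lemma nsq_add_null x y : nsq y = 0 -> nsq (x + y) = nsq x.
Proof. by move=> y0; rewrite nsqD y0 ip_null//=; lra. Qed.

Definition subsp (E : set H) := E 0 /\ forall (a : C) x y, E x -> E y -> E (a *: x + y).

Definition closure_sp (E : set H) : set H :=
  [set x | forall e : R, 0 < e -> exists2 y, E y & nrm (x - y) < e].

Definition closed_sp (E : set H) := subsp E /\ closure_sp E `<=` E.

Lemma subspD E x y : subsp E -> E x -> E y -> E (x + y).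
Proof. by move=> [_ h] ? ?; rewrite -[x]scale1r; apply: h. Qed.

Lemma subspZ E (a : C) x : subsp E -> E x -> E (a *: x).
Proof. by move=> [h0 h] ?; rewrite -[_ *: _]addr0; apply: h. Qed.

Lemma subspN E x : subsp E -> E x -> E (- x).
Proof. by move=> h ?; rewrite -scaleN1r; apply: subspZ. Qed.

Lemma subspB E x y : subsp E -> E x -> E y -> E (x - y).
Proof. by move=> h ? ?; apply: subspD => //; apply: subspN. Qed.

Lemma subsp_sum E k (c : 'I_k -> C) (u : 'I_k -> H) : subsp E ->
  (forall i, E (u i)) -> E (\sum_i c i *: u i).
Proof.
move=> hE hu; apply: (big_ind E) => //; first by case: hE.
  by move=> ? ?; apply: subspD.
by move=> i _; apply: subspZ.
Qed.

Lemma closure_closed E : subsp E -> closed_sp (closure_sp E).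
Proof.
move=> hE; split; first split.
- by move=> e e0; exists 0; [case: hE|rewrite subr0 /nrm nsq0 sqrtr0].
- move=> a x y hx hy e e0.
  have a0 : 0 < Num.sqrt (csq a) + 1 by rewrite ltr_wpDl ?sqrtr_ge0.
  have [|x' Ex' hx'] := hx (e / 2 / (Num.sqrt (csq a) + 1)).
    by rewrite !divr_gt0.
  have [|y' Ey' hy'] := hy (e / 2); first by rewrite divr_gt0.
  exists (a *: x' + y'); first by case: hE => _; apply.
  rewrite opprD addrACA -scalerBr.
  apply: (le_lt_trans (nrmD _ _)).
  have -> : nrm (a *: (x - x')) = Num.sqrt (csq a) * nrm (x - x').
    by rewrite /nrm nsqZ sqrtrM ?csq_ge0.
  have : Num.sqrt (csq a) * nrm (x - x') <= e / 2.
    move: hx'; rewrite ltr_pdivlMr// => /ltW; apply: le_trans.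
    by rewrite mulrC ler_wpM2l ?nrm_ge0// lerDl.
  lra.
move=> x hx e e0.
have [|y hy h1] := hx (e / 2); first by rewrite divr_gt0.
have [|w hw h2] := hy (e / 2); first by rewrite divr_gt0.
exists w => //; rewrite -(subrKA y).
by apply: (le_lt_trans (nrmD _ _)); lra.
Qed.

(** First variation along [ip x e *: e]. The step [1 / (nsq e + 1)], instead of the optimal
    [1 / nsq e], also serves a null [e]. *)
Lemma subr_eq0_perp x E : subsp E ->
  (forall e, E e -> nsq x <= nsq (x - e)) -> forall e, E e -> ip x e = 0.
Proof.
move=> hE h e Ee; apply: csq_eq0.
have key (t : R) : 0 <= t ^+ 2 * csq (ip x e) * nsq e - 2 * t * csq (ip x e).
  have := h _ (subspZ (t%:C * ip x e) hE Ee).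
  by rewrite nsqB nsqZ ipZr csqM csqC csq_quad; lra.
apply/eqP; rewrite eq_le csq_ge0 andbT leNgt; apply/negP => c0.
have n0 : 0 < nsq e + 1 by rewrite ltr_wpDl ?nsq_ge0.
have := key (nsq e + 1)^-1.
have : (nsq e + 1) * (nsq e + 1)^-1 = 1 by rewrite divff ?gt_eqF.
have : 0 < (nsq e + 1)^-1 by rewrite invr_gt0.
set t := _^-1; set c := csq _ => t0 ht.
have -> : t ^+ 2 * c * nsq e - 2 * t * c = c * t * (t * (nsq e + 1) - t - 2) by ring.
rewrite [t * (_ + _)]mulrC ht pmulr_rge0 ?mulr_gt0 //; lra.
Qed.

(** Midpoints stay in [E], so the parallelogram identity makes a minimizing sequence Cauchy. *)
Lemma projection_exists E x : closed_sp E ->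
  exists2 y, E y & forall e, E e -> ip (x - y) e = 0.
Proof.
move=> [hE cE].
pose S := [set nsq (x - e) | e in E].
have S0 : S !=set0 by exists (nsq (x - 0)); exists 0 => //; case: hE.
have lS : has_lbound S by exists 0 => _ [e _ <-]; apply: nsq_ge0.
have hinf : has_inf S by split.
pose d := inf S.
have hd e : E e -> d <= nsq (x - e) by move=> Ee; apply: ge_inf => //; exists e.
have ex n : exists e, E e /\ nsq (x - e) < d + n.+1%:R^-1.
  have [|_ [e Ee <-] he] := @inf_adherent _ S n.+1%:R^-1 _ hinf; last by exists e.
  by rewrite invr_gt0.
have [u hu] := choice ex.
have cau m n : nsq (u m - u n) <= 2 * (m.+1%:R^-1 + n.+1%:R^-1).
  have [Em hm] := hu m; have [En hn] := hu n.
  have hmid : d <= nsq (x - 2^-1 *: (u m + u n)).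
    by apply: hd; apply: subspZ => //; apply: subspD.
  have e1 : nsq (x - u m + (x - u n)) = 4 * nsq (x - 2^-1 *: (u m + u n)).
    have -> : x - u m + (x - u n) = (2%:R)%:C *: (x - 2^-1 *: (u m + u n)).
      rewrite scalerBr scalerA -[(2%:R)%:C]/(real_complex R 2%:R) rmorph_nat divff ?pnatr_eq0//.
      by rewrite scale1r scaler_nat mulr2n addrACA opprD.
    by rewrite nsqZ csqC; lra.
  have e2 : nsq (x - u m + (x - u n)) + nsq (u m - u n) = 2 * (nsq (x - u m) + nsq (x - u n)).
    have -> : u m - u n = (x - u n) - (x - u m) by rewrite opprB [RHS]addrC subrKA.
    by rewrite nsqB nsqD (hip_sym (x - u n)) ReJ; lra.
  by move: hm hn e1 e2 hmid; move: (m.+1%:R^-1) (n.+1%:R^-1) => a b; lra.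
have small (e : R) : 0 < e -> exists N, forall n, (N <= n)%N -> n.+1%:R^-1 < e.
  move=> e0; have [N _ hN] := near_infty_natSinv_lt (PosNum e0).
  by exists N => n Nn; apply: hN.
have [|y hy] := @hip_complete _ H u.
  move=> e e0; have [|N hN] := small (e / 4); first by rewrite divr_gt0.
  exists N => m n /hN Nm /hN Nn; apply: (le_lt_trans (cau m n)).
  by move: Nm Nn; move: (m.+1%:R^-1) (n.+1%:R^-1) => a b; lra.
have Ey : E y.
  apply: cE => e e0; have [|N hN] := hy (e ^+ 2); first by rewrite exprn_gt0.
  exists (u N); first by have [] := hu N.
  by rewrite nrmB nrm_lt//; apply: hN.
exists y => //; apply: subr_eq0_perp => // e Ee.
have le_d : nrm (x - y) <= Num.sqrt d.
  apply/ler_addgt0Pr => e' e0.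
  have [|N1 hN1] := hy ((e' / 2) ^+ 2); first by rewrite exprn_gt0// divr_gt0.
  have [|N2 hN2] := small ((e' / 2) ^+ 2); first by rewrite exprn_gt0// divr_gt0.
  pose n := maxn N1 N2.
  have h1 : nrm (u n - y) < e' / 2 by rewrite nrm_lt ?divr_gt0//; apply: hN1; rewrite leq_maxl.
  have h2 : nrm (x - u n) <= Num.sqrt d + e' / 2.
    have d0 : 0 <= d by apply: lb_le_inf => // _ [? _ <-]; apply: nsq_ge0.
    have e2 : 0 <= e' / 2 by lra.
    rewrite nrm_le ?addr_ge0 ?sqrtr_ge0// sqrrD sqr_sqrtr//.
    have [_ /ltW h] := hu n; apply: (le_trans h).
    have /ltW := hN2 n (leq_maxr _ _).
    have : 0 <= Num.sqrt d * (e' / 2) by rewrite mulr_ge0 ?sqrtr_ge0 ?divr_ge0 ?ltW.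
    by move: (n.+1%:R^-1) => a; lra.
  rewrite -(subrKA (u n)); apply: (le_trans (nrmD _ _)); lra.
have d0 : 0 <= d by apply: lb_le_inf => // _ [? _ <-]; apply: nsq_ge0.
have : nsq (x - y) <= d by rewrite -nrm_sq -(sqr_sqrtr d0) ler_pXn2r ?nnegrE ?nrm_ge0 ?sqrtr_ge0.
move/le_trans; apply; rewrite -addrA -opprD; apply: hd; exact: subspD.
Qed.

(** [E] need not be closed. The orthogonal remainder is exact, and only the component along [E] is
    approximated. *)
Lemma perp_decomp E x : subsp E ->
  exists2 r, forall e, E e -> ip r e = 0 &
    forall e : R, 0 < e -> exists2 y, E y & nrm (x - y - r) < e.
Proof.
move=> hE; have [y hy hp] := projection_exists x (closure_closed hE).
exists (x - y).
  move=> e Ee; apply: hp => e' e0; exists e => //.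
  by rewrite subrr /nrm nsq0 sqrtr0.
move=> e e0; have [w Ew hw] := hy e e0; exists w => //.
by rewrite opprB [X in nrm X]addrC subrKA.
Qed.

Lemma dense_of_perp E F : closed_sp F -> subsp E -> E `<=` F ->
  (forall x, F x -> (forall e, E e -> ip e x = 0) -> nsq x = 0) ->
  F `<=` closure_sp E.
Proof.
move=> [sF cF] hE EF h x Fx.
have [r hr ap] := perp_decomp x hE.
have Fr : F r.
  have : F (x - r).
    apply: cF => e e0; have [y Ey hy] := ap e e0.
    by exists y; [exact: EF|rewrite addrAC].
  move=> hxr; rewrite -[r](subKr x); exact: subspB.
have r0 : nsq r = 0 by apply: h => // e Ee; apply: ip_eq0C; apply: hr.
move=> e e0; have [y Ey hy] := ap e e0; exists y => //.
by move: hy; rewrite /nrm nsq_add_null// nsqN.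
Qed.

(** A choice among nearest points that differ by null vectors, so [proj E] need not be linear;
    uniqueness up to null vectors and distance estimates replace linearity below. *)
Definition proj E x : H := xget 0 [set y | E y /\ forall e, E e -> ip (x - y) e = 0].

Lemma projP E x : closed_sp E -> E (proj E x) /\ forall e, E e -> ip (x - proj E x) e = 0.
Proof.
move=> cE; have [y Ey hy] := projection_exists x cE.
by apply: (@xgetPex _ 0 [set y | E y /\ forall e, E e -> ip (x - y) e = 0]); exists y.
Qed.

Lemma nsq_pythagoras E x y : E y -> (forall e, E e -> ip (x - y) e = 0) ->
  nsq (x - y) = nsq x - nsq y.
Proof.
move=> Ey h; have := h _ Ey; rewrite ipBl => /eqP; rewrite subr_eq0 => /eqP hxy.
by rewrite nsqB hxy ipE/=; lra.
Qed.

Lemma proj_unique E x y y' : subsp E -> E y -> (forall e, E e -> ip (x - y) e = 0) ->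
  E y' -> (forall e, E e -> ip (x - y') e = 0) -> nsq (y - y') = 0.
Proof.
move=> sE Ey hy Ey' hy'.
have Ed : E (y - y') by exact: subspB.
have e1 : y - y' = (x - y') - (x - y) by rewrite opprB [RHS]addrC subrKA.
by rewrite /nsq {1}e1 ipBl hy// hy'// subr0.
Qed.

Lemma closed_perp (E : set H) : closed_sp [set x | forall e, E e -> ip x e = 0].
Proof.
split; first split.
- by move=> e _; rewrite ip0l.
- by move=> a x y hx hy e Ee; rewrite hip_linearl hx// hy// mulr0 addr0.
move=> x hx e Ee.
have h (t : R) : 0 < t -> csq (ip x e) <= t ^+ 2 * nsq e.
  move=> t0; have [y hy hxy] := hx t t0.
  rewrite -[x](subrK y) ipDl hy// addr0 (le_trans (cauchy_schwarz _ _))//.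
  by rewrite ler_wpM2r ?nsq_ge0// -nrm_le ltW.
apply: csq_eq0; apply/eqP; rewrite eq_le csq_ge0 andbT leNgt; apply/negP => c0.
have n0 : 0 < nsq e + 1 by rewrite ltr_wpDl ?nsq_ge0.
have := h (Num.sqrt (csq (ip x e) / (nsq e + 1))).
have d0 : 0 < csq (ip x e) / (nsq e + 1) by rewrite divr_gt0.
rewrite sqrtr_gt0 d0 => /(_ isT); rewrite sqr_sqrtr ?(ltW d0)//.
rewrite mulrAC ler_pdivlMr//; nra.
Qed.

(** The [d i] may be dependent; a direction that brings nothing new gets a zero vector. The point is
    the map subtracting [\sum_l ip x (e l) *: e l], a contraction with values orthogonal to all
    [d i]. *)
Lemma gram_schmidt (D : set H) k (d : 'I_k -> H) : subsp D -> (forall i, D (d i)) ->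
  exists e : 'I_k -> H, [/\ forall i, D (e i),
    forall x i, ip (x - \sum_l ip x (e l) *: e l) (d i) = 0 /\
                ip (x - \sum_l ip x (e l) *: e l) (e i) = 0 &
    forall x, nsq (x - \sum_l ip x (e l) *: e l) <= nsq x].
Proof.
move=> sD; elim: k d => [|k IH] d hd.
  exists (fun=> 0); split => [[]//|x [] //|x].
  by rewrite big_ord0 subr0.
have [|e [De he hn]] := IH (fun i => d (lift ord0 i)); first by move=> i; exact: hd.
pose P x := x - \sum_l ip x (e l) *: e l.
have Pe x l : ip (P x) (e l) = 0 by have [] := he x l.
have Pd x l : ip (P x) (d (lift ord0 l)) = 0 by have [] := he x l.
have Psym x y : ip (P x) y = ip x (P y).
  rewrite ipBl ipBr ip_suml; congr (_ - _).
  rewrite [RHS]hip_sym ip_suml conj_sumc; apply: eq_bigr => l _.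
  by rewrite conjMc -!hip_sym mulrC.
have Pee x : ip (P x) (\sum_l ip (d ord0) (e l) *: e l) = 0.
  by apply: ip_eq0C; rewrite ip_suml big1// => l _; rewrite (ip_eq0C (Pe _ _)) mulr0.
pose w := P (d ord0).
have Dw : D w by apply: subspB => //; apply: subsp_sum.
have Pw x : ip (P x) w = ip (P x) (d ord0) by rewrite ipBr Pee subr0.
have xw x : ip x w = ip (P x) w by rewrite Pw Psym.
(* The factor normalizing [w]; it is [0] for a null vector. *)
pose c : R := if nsq w == 0 then 0 else (Num.sqrt (nsq w))^-1.
have hc x : (c ^+ 2 * nsq w)%:C * ip x w = ip x w.
  rewrite /c; case: ifPn => [/eqP w0|w0].
    by rewrite (ip_null x w0) mulr0.
  by rewrite exprVn sqr_sqrtr ?nsq_ge0// mulVf// mul1r.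
have c2 : c ^+ 2 * nsq w <= 1.
  rewrite /c; case: ifPn => [/eqP ->|w0]; first by rewrite mulr0.
  by rewrite exprVn sqr_sqrtr ?nsq_ge0// mulVf.
pose f i := if unlift ord0 i is Some l then e l else c%:C *: w.
have fS (l : 'I_k) : f (lift ord0 l) = e l by rewrite /f liftK.
have f0 : f ord0 = c%:C *: w by rewrite /f unlift_none.
have Qf x : x - \sum_l ip x (f l) *: f l = P x - ((c ^+ 2)%:C * ip x w) *: w.
  rewrite big_ord_recl f0 ipZr scalerA conjc_real mulrAC -rmorphM -expr2.
  rewrite opprD addrCA addrC; congr (_ - _ - _).
  by apply: eq_bigr => i _; rewrite fS.
have ww : ip w w = (nsq w)%:C by exact: ipE.
exists f; split.
- move=> i; rewrite /f; case: unlift => [l|]; [exact: De|exact: subspZ].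
- move=> x i; rewrite Qf; case: (unliftP ord0 i) => [l ->|->].
    have h y : ip (P x) y = 0 -> ip w y = 0 -> ip (P x - ((c ^+ 2)%:C * ip x w) *: w) y = 0.
      by move=> h1 h2; rewrite ipDl ipNl ipZl h1 h2 mulr0 subr0.
    by rewrite fS; split; apply: h; rewrite ?Pe ?Pd.
  have z0 : ip (P x - ((c ^+ 2)%:C * ip x w) *: w) w = 0.
    by rewrite ipDl ipNl ipZl -xw ww mulrAC -rmorphM hc subrr.
  split; last by rewrite f0 ipZr z0 mulr0.
  rewrite -z0 !(ipDl (P x)) !ipNl !ipZl Pw.
  by rewrite [ip w w]Pw.
move=> x; rewrite Qf; apply: le_trans (hn x).
rewrite -/(P x) nsqB nsqZ ipZr -xw csqM csqC csq_quad.
rewrite -[leRHS]addr0 -addrA lerD2l.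
have -> : (c ^+ 2) ^+ 2 * csq (ip x w) * nsq w - 2 * (c ^+ 2 * csq (ip x w)) =
  c ^+ 2 * csq (ip x w) * (c ^+ 2 * nsq w - 2) by ring.
have h1 : 0 <= c ^+ 2 * csq (ip x w) by rewrite mulr_ge0 ?sqr_ge0 ?csq_ge0.
have h2 : c ^+ 2 * nsq w - 2 <= 0 by move: c2; generalize (c ^+ 2 * nsq w) => r; lra.
exact: mulr_ge0_le0.
Qed.

End hilbert_theory.

(** * Transfer of a bound between two compressed operators *)

Definition lin {R : realType} {H K : hilbert R} (f : H -> K) :=
  forall a x y, f (a *: x + y) = a *: f x + f y.

Section linear_maps.
Context {R : realType} {H K : hilbert R} (f : H -> K) (lf : lin f).

Lemma lin0 : f 0 = 0.
Proof. by apply: (addrI (f 0)); rewrite -{1}[f 0]scale1r -lf scaler0 addr0 addr0. Qed.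

Lemma linZ a x : f (a *: x) = a *: f x.
Proof. by rewrite -[a *: x]addr0 lf lin0 addr0. Qed.

Lemma linD x y : f (x + y) = f x + f y.
Proof. by rewrite -{1}[x]scale1r lf scale1r. Qed.

Lemma linB x y : f (x - y) = f x - f y.
Proof. by rewrite linD -scaleN1r linZ scaleN1r. Qed.

Lemma lin_sum k (c : 'I_k -> R[i]) (u : 'I_k -> H) :
  f (\sum_i c i *: u i) = \sum_i c i *: f (u i).
Proof.
elim: k c u => [|k IH] c u; first by rewrite !big_ord0 lin0.
by rewrite !big_ord_recl lf IH.
Qed.

End linear_maps.

(** The coefficients enter only through their Euclidean norm: the vectors will be chosen before the
    coefficients are known. *)
Lemma nrm_sum {R : realType} {H : hilbert R} k (c : 'I_k -> R[i]) (u : 'I_k -> H) :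
  nrm (\sum_i c i *: u i) <= Num.sqrt (\sum_i csq (c i)) * \sum_i nrm (u i).
Proof.
have hi i : Num.sqrt (csq (c i)) <= Num.sqrt (\sum_i csq (c i)).
  by rewrite ler_sqrt ?sumr_ge0// => [|l _]; rewrite ?csq_ge0// (bigD1 i)//= lerDl sumr_ge0// => l _; exact: csq_ge0.
rewrite mulr_sumr; apply: (@le_trans _ _ (\sum_i nrm (c i *: u i))).
  apply: (big_ind2 (fun x y => nrm x <= y)) => //.
    by rewrite /nrm nsq0 sqrtr0.
  by move=> x y x' y' h h'; apply: le_trans (nrmD _ _) _; rewrite lerD.
apply: ler_sum => i _.
by rewrite /nrm nsqZ sqrtrM ?csq_ge0// ler_wpM2r ?sqrtr_ge0.
Qed.

(** By Pythagoras [proj E v] approximates [u] no better than [proj E u] does. *)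
Lemma nrm_res_le {R : realType} {H : hilbert R} (E : set H) (cE : closed_sp E) (u v : H) :
  nrm (u - proj E u) <= nrm (u - v) + nrm (v - proj E v).
Proof.
have [Eu hu] := projP u cE; have [Ev hv] := projP v cE.
apply: (@le_trans _ _ (nrm (u - proj E v))); last first.
  by rewrite -(subrKA v); exact: nrmD.
have -> : u - proj E v = (u - proj E u) + (proj E u - proj E v) by rewrite subrKA.
rewrite nrm_le ?nrm_ge0// nrm_sq [leRHS]nsqD hu; last by apply: subspB => //; case: cE.
by have := nsq_ge0 (proj E u - proj E v); rewrite /=; lra.
Qed.

(** * Positive index of a compressed operator *)

Section index.
Context {R : realType} {H1 H1' : hilbert R}.
Local Notation C := R[i].
Variables (D1 M : set H1) (Hq1 : set H1') (A1 : H1 -> H1') (A1s : H1' -> H1).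
Variables (s L : R).
Hypotheses (cD1 : closed_sp D1) (sM : subsp M) (MD : M `<=` D1).
Hypotheses (dM : D1 `<=` closure_sp M) (cHq1 : closed_sp Hq1).
Hypotheses (lA1 : lin A1) (adjA1 : forall f y, hip (A1 f) y = hip f (A1s y)).
Hypotheses (L0 : 0 <= L) (bA1 : forall f, nrm (A1 f) <= L * nrm f).
Hypothesis s0 : 0 <= s.

(** The component of [A1 f] orthogonal to [Hq1]. When [A1] is multiplication by a symbol and [Hq1]
    is [H^2] plus zero, this is the four block operator up to a.e. equality. *)
Definition compr1 f := A1 f - proj Hq1 (A1 f).
Local Notation G1 := compr1.

(** The projection enters in one slot only, which keeps the form literally linear in [f] although
    [G1] depends on choices; [form1E] gives the symmetric expression. *)
Definition form1 f g : C := hip (A1 f) (G1 g) - (s ^+ 2)%:C * hip f g.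
Local Notation B := form1.

Lemma compr1_perp f e : Hq1 e -> hip (G1 f) e = 0.
Proof. by case: (projP (A1 f) cHq1) => _; apply. Qed.

Lemma form1E f g : B f g = hip (G1 f) (G1 g) - (s ^+ 2)%:C * hip f g.
Proof.
rewrite /form1 /compr1 ipBl -/(G1 g).
have [Ef _] := projP (A1 f) cHq1.
by rewrite (ip_eq0C (compr1_perp g Ef)) subr0.
Qed.

Lemma form1_sym f g : B f g = (B g f)^*.
Proof.
by rewrite !form1E conjDc conjNc conjMc conjc_real -!hip_sym.
Qed.

Lemma form1_diag f : B f f = (nsq (G1 f) - s ^+ 2 * nsq f)%:C.
Proof. by rewrite form1E !ipE; apply: complex_ext; rewrite /=; ring. Qed.

Lemma form1_lin a f f' g : B (a *: f + f') g = a * B f g + B f' g.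
Proof. by rewrite /form1 lA1 !hip_linearl; ring. Qed.

Lemma form1_suml k (c : 'I_k -> C) (u : 'I_k -> H1) g :
  B (\sum_i c i *: u i) g = \sum_i c i * B (u i) g.
Proof.
rewrite /form1 lin_sum// !ip_suml mulr_sumr -sumrB.
by apply: eq_bigr => i _; ring.
Qed.

(** Orthonormality is with respect to [B]. The vectors lie in [M], later the range of [b], rather
    than in its closure, so each of them has an exact preimage. *)
Definition orthon k (p : 'I_k -> H1) :=
  (forall i, M (p i)) /\ forall i l, B (p i) (p l) = (i == l)%:R.

Lemma form1_orthon k (p : 'I_k -> H1) (c : 'I_k -> C) i : orthon p ->
  B (\sum_l c l *: p l) (p i) = c i.
Proof.
move=> [_ op]; rewrite form1_suml (bigD1 i)//= op eqxx mulr1 big1 ?addr0//.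
by move=> l li; rewrite op (negbTE li) mulr0.
Qed.

Lemma form1_orthon_diag k (p : 'I_k -> H1) (c : 'I_k -> C) : orthon p ->
  nsq (G1 (\sum_l c l *: p l)) - s ^+ 2 * nsq (\sum_l c l *: p l) = \sum_i csq (c i).
Proof.
move=> op; set g := \sum_l _; apply: complexI; rewrite -form1_diag.
rewrite {1}/g form1_suml rmorph_sum; apply: eq_bigr => i _.
by rewrite form1_sym form1_orthon//; apply/esym; exact: csqE.
Qed.

Lemma compr1_le f g : nrm (G1 f) <= L * nrm (f - g) + nrm (G1 g).
Proof.
apply: (le_trans (nrm_res_le cHq1 _ (A1 g))).
by rewrite lerD2r -linB.
Qed.

(* A maximal orthonormal family for the form cuts out the subspace on which it is
   nonpositive. *)
Lemma index_bound j : (forall p : 'I_j.+1 -> H1, ~ orthon p) ->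
  exists e : 'I_j -> H1, (forall i, D1 (e i)) /\
    forall f, D1 f -> nrm (f - \sum_l hip f (e l) *: e l) <= nrm f /\
      nrm (G1 (f - \sum_l hip f (e l) *: e l)) <= s * nrm f.
Proof.
move=> hj.
have [k [kj [p op] hmax]] : exists k, [/\ (k <= j)%N, exists p : 'I_k -> H1, orthon p &
    ~ exists p : 'I_k.+1 -> H1, orthon p].
  elim: j hj => [|j IH] hj.
    exists 0%N; split => //; last by case.
    by exists (fun=> 0); split => [[]|[]].
  have [hp|hp] := pselect (exists p : 'I_j.+1 -> H1, orthon p).
    by exists j.+1; split => //; case.
  have [|k [kj h1 h2]] := IH; last by exists k; split => //; exact: leqW.
  by move=> p op; apply: hp; exists p.
(* Otherwise [f], divided by the square root of its positive form value, could be adjoined to [p],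
   against [hmax]. *)
have neg f : M f -> (forall i, B f (p i) = 0) -> nrm (G1 f) <= s * nrm f.
  move=> Mf hf; rewrite nrm_le ?mulr_ge0 ?nrm_ge0// exprMn nrm_sq -subr_le0.
  rewrite leNgt; apply/negP; set q := _ - _ => q0; apply: hmax.
  pose f0 := ((Num.sqrt q)^-1)%:C *: f.
  have Bl g : B f0 g = ((Num.sqrt q)^-1)%:C * B f g.
    by rewrite -[f0]addr0 form1_lin {2}/form1 lin0// !ip0l mulr0 subr0 addr0.
  exists (fun i => if unlift ord0 i is Some l then p l else f0); split.
    by move=> i; case: unlift => [l|]; [case: op|exact: subspZ].
  move=> i l; case: (unliftP ord0 i) => [i' ->|->]; case: (unliftP ord0 l) => [l' ->|->].
  - by case: op => _ ->; rewrite (inj_eq lift_inj).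
  - by rewrite form1_sym Bl hf mulr0 conjc0.
  - by rewrite Bl hf mulr0.
  - rewrite Bl form1_sym Bl form1_diag -/q conjMc !conjc_real -!rmorphM eqxx.
    rewrite mulrA -invfM -expr2 sqr_sqrtr ?ltW// mulVf ?gt_eqF//.
(* The Riesz vector in [D1] of the functional sending [f] to [B f (p i)]; this is where the adjoint
   [A1s] enters. *)
pose d' i := proj D1 (A1s (G1 (p i)) - (s ^+ 2)%:C *: p i).
have hd f i : D1 f -> hip f (d' i) = B f (p i).
  move=> Df; have [_ h] := projP (A1s (G1 (p i)) - (s ^+ 2)%:C *: p i) cD1.
  rewrite /form1 adjA1; have := ip_eq0C (h _ Df); rewrite !ipBr ipZr conjc_real.
  by move=> /eqP; rewrite subr_eq0 => /eqP.
have sD1 : subsp D1 by case: cD1.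
have Dd' i : D1 (d' i) by have [] := projP (A1s (G1 (p i)) - (s ^+ 2)%:C *: p i) cD1.
(* The maximal family has [k <= j] members; zero vectors pad it to length [j]. *)
pose d (i : 'I_j) := if insub (val i) is Some l then d' l else 0.
have dE i : d (widen_ord kj i) = d' i by rewrite /d /= valK.
have Dd i : D1 (d i) by rewrite /d; case: insub => [l|]//; case: sD1.
have [e [De he hn]] := gram_schmidt sD1 Dd.
(* [neg] extends from [M] to [D1] by density. An approximation [m] of [f] is corrected to [m'],
   which is [B]-orthogonal to the [p i]. The correction is controlled by [f - m], because
   [B f (p i) = 0] gives [B m (p i) = - hip (f - m) (d' i)]. *)
have clo f : D1 f -> (forall i, B f (p i) = 0) -> nrm (G1 f) <= s * nrm f.
  move=> Df hf; apply/ler_addgt0Pr => t t0.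
  pose K := \sum_i nrm (d' i) * nrm (p i).
  have K0 : 0 <= K by apply: sumr_ge0 => i _; rewrite mulr_ge0 ?nrm_ge0.
  have den : 0 < (L + s) * (1 + K) + 1 by rewrite ltr_wpDl// mulr_ge0 ?addr_ge0.
  have [|m Mm hm] := dM Df (e := t / ((L + s) * (1 + K) + 1)); first by rewrite divr_gt0.
  pose m' := m - \sum_i B m (p i) *: p i.
  have Mm' : M m' by apply: subspB => //; apply: subsp_sum => // i; case: op.
  have hm' i : B m' (p i) = 0.
    rewrite /m' addrC -scaleN1r form1_lin form1_orthon//; ring.
  have hdist : nrm (f - m') <= (1 + K) * nrm (f - m).
    rewrite /m' opprB addrCA addrC; apply: le_trans (nrmD _ _) _.
    rewrite mulrDl mul1r lerD2l.
    apply: (@le_trans _ _ (\sum_i nrm (B m (p i) *: p i))).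
      apply: (big_ind2 (fun x y => nrm x <= y)) => //.
        by rewrite /nrm nsq0 sqrtr0.
      by move=> x y x' y' h h'; apply: le_trans (nrmD _ _) _; rewrite lerD.
    rewrite mulr_suml; apply: ler_sum => i _.
    rewrite {1}/nrm nsqZ sqrtrM ?csq_ge0// -/(nrm (p i)) mulrAC ler_wpM2r ?nrm_ge0//.
    have -> : B m (p i) = - hip (f - m) (d' i).
      by rewrite ipBl !hd ?hf ?sub0r ?opprK//; exact: MD.
    rewrite -[leRHS]ger0_norm ?mulr_ge0 ?nrm_ge0// -sqrtr_sqr ler_sqrt ?sqr_ge0//.
    rewrite -[csq _]mul1r -csq1 -(csqM 1) mul1r.
    have -> : csq (- hip (f - m) (d' i)) = csq (hip (f - m) (d' i)).
      by rewrite -mulN1r csqM /csq /=; ring.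
    by rewrite exprMn !nrm_sq mulrC cauchy_schwarz.
  have h1 := compr1_le f m'.
  have h2 := neg _ Mm' hm'.
  have h3 : nrm m' <= nrm f + nrm (f - m').
    by rewrite (nrmB f); apply: le_trans (nrmD _ _); rewrite [_ + (_ - _)]addrC subrK.
  apply: (le_trans h1).
  have h4 : s * nrm m' <= s * nrm f + s * nrm (f - m') by rewrite -mulrDr ler_wpM2l.
  have h5 : (L + s) * nrm (f - m') <= t.
    apply: (@le_trans _ _ ((L + s) * ((1 + K) * nrm (f - m)))).
      by rewrite ler_wpM2l ?addr_ge0.
    move: hm; rewrite ltr_pdivlMr// => /ltW hm; apply: le_trans hm.
    rewrite mulrA mulrC ler_wpM2l ?nrm_ge0//; lra.
  lra.
exists e; split=> // f Df; split.
  by rewrite nrm_le ?nrm_ge0// nrm_sq.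
apply: (@le_trans _ _ (s * nrm (f - \sum_l hip f (e l) *: e l))); last first.
  by rewrite ler_wpM2l// nrm_le ?nrm_ge0// nrm_sq.
have DP : D1 (f - \sum_l hip f (e l) *: e l) by apply: subspB => //; apply: subsp_sum.
apply: clo => // i; rewrite -hd// -dE.
by have [] := he f (widen_ord kj i).
Qed.

End index.

(** * Lifting positive subspaces *)

Section transfer.
Context {R : realType} {H H' H1 H1' : hilbert R}.
Local Notation C := R[i].
Variables (D : set H) (Hq : set H') (D1 : set H1) (Hq1 : set H1').
Variables (A : H -> H') (A1 : H1 -> H1') (A1s : H1' -> H1) (b : H -> H1).
Variables (xsq : H -> R) (s t0 L : R) (j k0 : nat) (kappa : 'I_k0 -> H).
Hypotheses (sD : subsp D) (cHq : closed_sp Hq) (cD1 : closed_sp D1) (cHq1 : closed_sp Hq1).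
Hypotheses (lA : lin A) (lA1 : lin A1) (lb : lin b).
Hypothesis adjA1 : forall f y, hip (A1 f) y = hip f (A1s y).
Hypotheses (L0 : 0 <= L) (bA1 : forall f, nrm (A1 f) <= L * nrm f).
Hypotheses (s0 : 0 <= s) (st0 : s <= t0) (st0' : k0 = 0%N \/ s < t0).
Hypothesis nsqA : forall f, nsq (A f) = t0 ^+ 2 * xsq f + nsq (A1 (b f)).
Hypothesis nsqb : forall f, nsq f = xsq f + nsq (b f).
Hypothesis xsq_ge0 : forall f, 0 <= xsq f.
Hypothesis bD : forall f, D f -> D1 (b f).
Hypothesis b_dense :
  forall g, D1 g -> (forall f, D f -> hip (b f) g = 0) -> nsq g = 0.
Hypothesis key : forall r, Hq r ->
  (forall f, D f -> nsq (b f) = 0 -> hip (A f) r = 0) ->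
  exists z, [/\ Hq1 z, nsq z <= nsq r &
    forall f, D f -> hip (A f) r = hip (A1 (b f)) z].
Hypotheses (Dkappa : forall i, D (kappa i)) (bkappa : forall i, nsq (b (kappa i)) = 0).
Hypothesis Akappa : forall i r, Hq r -> hip (A (kappa i)) r = 0.
Hypothesis kappa_free :
  forall c : 'I_k0 -> C, nsq (\sum_i c i *: kappa i) = 0 -> forall i, c i = 0.
(** The form in which an operator of rank [j + k0] within [s] of the compression of [A] is used: by
    a dimension count it kills a nontrivial combination of the [u i]. *)
Hypothesis few : forall u : 'I_(j.+1 + k0) -> H, (forall i, D (u i)) ->
  exists c : 'I_(j.+1 + k0) -> C, (exists i, c i != 0) /\
    let f := \sum_i c i *: u i in
    nrm (A f - proj Hq (A f)) <= s * nrm f.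

Local Notation G1 := (compr1 Hq1 A1).

Lemma null_b_sum k (c : 'I_k -> C) (n : 'I_k -> H) :
  (forall i, nsq (b (n i)) = 0) -> nsq (b (\sum_i c i *: n i)) = 0.
Proof.
move=> hn; apply: nrm0_nsq; apply/eqP; rewrite eq_le nrm_ge0 andbT lin_sum//.
apply: le_trans (nrm_sum _ _) _; rewrite [X in _ * X]big1 ?mulr0// => i _.
by rewrite /nrm hn sqrtr0.
Qed.

Lemma no_positive_subspace (p : 'I_j.+1 -> H1) :
  ~ orthon [set b f | f in D] Hq1 A1 s p.
Proof.
move=> op; have [op1 _] := op.
have /choice [f hf] : forall i, exists f, D f /\ b f = p i.
  by move=> i; have [f ? ?] := op1 i; exists f.
(* The components in [Hq] of the [A n] with [b n = 0], that is, all changes of the removed part that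
   leave [b f] unaffected in norm. They are described by orthogonality, not by [proj], so that [E]
   is literally a subspace. *)
pose E := [set y | Hq y /\ exists n, [/\ D n, nsq (b n) = 0 &
  forall e, Hq e -> hip (A n - y) e = 0]].
have [sHq clHq] := cHq.
have sE : subsp E.
  split.
    split; first by case: sHq.
    exists 0; split; first by case: sD.
      by rewrite lin0// nsq0.
    by move=> e _; rewrite lin0// subrr ip0l.
  move=> a x y [Hx [n [Dn bn hn]]] [Hy [n' [Dn' bn' hn']]]; split.
    by case: sHq => _; apply.
  exists (a *: n + n'); split; first by case: sD => _; apply.
    rewrite lb nsq_add_null// nsqZ bn mulr0//.
  move=> e He; rewrite lA opprD addrACA -scalerBr hip_linearl hn// hn'//.
  by rewrite mulr0 addr0.
pose x i := proj Hq (A (f i)).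
have Hx i : Hq (x i) by have [] := projP (A (f i)) cHq.
have hx i e : Hq e -> hip (A (f i)) e = hip (x i) e.
  move=> He; have [_ h] := projP (A (f i)) cHq.
  by move: (h _ He); rewrite ipBl => /eqP; rewrite subr_eq0 => /eqP.
(* [r i] is the part of [x i] that no correction by such an [n] can reduce. *)
have /choice [r hr] : forall i, exists r, (forall e, E e -> hip r e = 0) /\
    forall e : R, 0 < e -> exists2 y, E y & nrm (x i - y - r) < e.
  by move=> i; have [r ? ?] := perp_decomp (x i) sE; exists r.
have Hr i : Hq (r i).
  have h : Hq (x i - r i).
    apply: clHq => e e0; have [y [Hy _] hy] := (hr i).2 e e0.
    by exists y => //; rewrite addrAC.
  by rewrite -[r i](subKr (x i)); apply: subspB.
pose K := \sum_i nrm (r i).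
have K0 : 0 <= K by apply: sumr_ge0 => i _; exact: nrm_ge0.
(* With this value [2 * K * eta + eta ^+ 2 = (1 - eta) ^+ 2 < 1], the factor of [W] in the error
   estimate. The tolerance is then shared among the [j.+1] vectors. *)
pose eta := (2 * K + 2)^-1.
have eta0 : 0 < eta by rewrite invr_gt0; lra.
have etaK : eta * (2 * K + 2) = 1 by rewrite mulVf// gt_eqF//; lra.
have eta1 : eta <= 1 by rewrite invf_le1; lra.
have ep0 : 0 < eta / j.+1%:R by rewrite divr_gt0.
have /choice [y hy] : forall i, exists y, E y /\ nrm (x i - y - r i) < eta / j.+1%:R.
  by move=> i; have [y ? ?] := (hr i).2 _ ep0; exists y.
have /choice [n hn] : forall i, exists n, [/\ D n, nsq (b n) = 0 &
    forall e, Hq e -> hip (A n - y i) e = 0] by move=> i; have [[_ ?] _] := hy i.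
have Hy i : Hq (y i) by have [[]] := hy i.
pose u (i : 'I_(j.+1 + k0)) := match fintype.split i with
  | inl l => f l - n l | inr l => kappa l end.
have [|c [[i0 ci0] hc]] := few (u := u).
  move=> i; rewrite /u; case: fintype.split => l //.
  by apply: subspB => //; [have [] := hf l|have [] := hn l].
pose c1 l := c (lshift k0 l); pose c2 l := c (rshift j.+1 l).
pose g1 := \sum_i c1 i *: p i.
pose ff := \sum_i c1 i *: f i.
pose nn := \sum_i c1 i *: n i.
pose kk := \sum_i c2 i *: kappa i.
have fE : \sum_i c i *: u i = ff - nn + kk.
  rewrite big_split_ord/= /ff /nn -sumrB; congr (_ + _).
    by apply: eq_bigr => i _; rewrite /u (unsplitK (inl i)) scalerBr.
  by apply: eq_bigr => i _; rewrite /u (unsplitK (inr i)).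
move: hc; rewrite /= fE; set F := ff - nn + kk => hc.
have bff : b ff = g1 by rewrite lin_sum//; apply: eq_bigr => i _; have [_ ->] := hf i.
have bnn : nsq (b nn) = 0 by apply: null_b_sum => i; have [] := hn i.
have bkk : nsq (b kk) = 0 by apply: null_b_sum.
have bF w : nsq (b w) = 0 -> nsq (A1 (b w)) = 0.
  move=> w0; apply: nrm0_nsq; apply/eqP; rewrite eq_le nrm_ge0 andbT.
  by apply: le_trans (bA1 _) _; rewrite /nrm w0 sqrtr0 mulr0.
have nsqbF : nsq (b F) = nsq g1.
  rewrite (linD lb) nsq_add_null// (linB lb) bff nsqB bnn ip_null//; rewrite /=; lra.
have nsqAbF : nsq (A1 (b F)) = nsq (A1 g1).
  have Akk := bF _ bkk; have Ann := bF _ bnn.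
  rewrite (linD lb) (linD lA1) nsq_add_null// (linB lb) bff (linB lA1) nsqB Ann ip_null//; rewrite /=; lra.
(* the residual [rr] is dominated by the projection of [A1 g1] *)
pose rr := \sum_i c1 i *: r i.
have Hrr : Hq rr by apply: subsp_sum.
have Err e : E e -> hip rr e = 0.
  by move=> Ee; rewrite ip_suml big1// => i _; rewrite (hr i).1 ?mulr0.
(* [x i - r i] is a limit of elements of [E], and the vectors orthogonal to [rr] form a closed space
   containing [E]. *)
have xr i : hip (x i) rr = hip (r i) rr.
  apply/eqP; rewrite -subr_eq0 -ipBl; apply/eqP.
  have [_ cl] := closed_perp [set rr].
  apply: (cl (x i - r i)) => // e e0; have [y' Ey' hy'] := (hr i).2 e e0.
  exists y'; last by rewrite addrAC.
  by move=> _ ->; apply: ip_eq0C; apply: Err.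
(* Orthogonality to [E] is the hypothesis of [key]. Then [hip rr rr = hip (A ff) rr = hip (A1 g1)
   z], where [A1 g1] may be replaced by its projection since [z] is in [Hq1]; Cauchy-Schwarz and
   [nsq z <= nsq rr] conclude. *)
have rr_le : nrm rr <= nrm (proj Hq1 (A1 g1)).
  have [|z [Hz zr hz]] := key Hrr.
    move=> m Dm bm; have [Hm hm] := projP (A m) cHq.
    have : E (proj Hq (A m)) by split=> //; exists m; split.
    move=> /Err /ip_eq0C h0; have := hm _ Hrr; rewrite ipBl h0 subr0; exact.
  have h1 : hip rr rr = hip (A1 g1) z.
    rewrite -bff -hz; last by apply: subsp_sum => // i; have [] := hf i.
    rewrite lin_sum// {1}/rr !ip_suml; apply: eq_bigr => i _.
    by rewrite hx// xr.
  have [_ hP] := projP (A1 g1) cHq1.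
  have h2 : hip (A1 g1) z = hip (proj Hq1 (A1 g1)) z.
    by move: (hP _ Hz); rewrite ipBl => /eqP; rewrite subr_eq0 => /eqP.
  have h3 : nsq rr <= nrm (proj Hq1 (A1 g1)) * nrm rr.
    rewrite /nsq h1 h2; apply: le_trans (Re_ip_le _ _) _.
    by rewrite ler_wpM2l ?nrm_ge0// nrm_le ?nrm_ge0// nrm_sq.
  move: h3; rewrite -nrm_sq expr2; have := nrm_ge0 rr; rewrite le_eqVlt.
  move=> /orP[/eqP <-|r0]; first by rewrite nrm_ge0.
  by rewrite ler_pM2r.
pose W := \sum_i csq (c1 i).
have W0 : 0 <= W by apply: sumr_ge0 => i _; exact: csq_ge0.
have rrK : nrm rr <= Num.sqrt W * K by exact: nrm_sum.
have qE : nsq (G1 g1) - s ^+ 2 * nsq g1 = W.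
  by apply: form1_orthon_diag op.
have nG1 : nsq (G1 g1) = nsq (A1 g1) - nsq (proj Hq1 (A1 g1)).
  by have [h1 h2] := projP (A1 g1) cHq1; rewrite /compr1 (nsq_pythagoras h1 h2).
(* the projection of [A F] is within [sqrt W * eta] of [rr] *)
pose pF := \sum_i c1 i *: (x i - y i).
have HpF : Hq pF by apply: subsp_sum => // i; exact: subspB.
have projF e : Hq e -> hip (A F - pF) e = 0.
  move=> He; rewrite /F (linD lA) (linB lA) !(lin_sum lA) !(ipDl, ipNl) !ip_suml.
  rewrite [X in _ + X - _]big1 ?addr0 => [|i _]; last by rewrite Akappa ?mulr0.
  rewrite -!sumrB big1// => i _.
  have [_ _ /(_ e He)] := hn i; rewrite !ipBl hx// => /eqP.
  by rewrite subr_eq0 => /eqP ->; ring.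
have pF_le : nrm pF <= nrm rr + Num.sqrt W * eta.
  have -> : pF = rr + \sum_i c1 i *: (x i - y i - r i).
    by rewrite /rr -big_split /=; apply: eq_bigr => i _; rewrite -scalerDr [r i + _]addrC subrK.
  apply: le_trans (nrmD _ _) _; rewrite lerD2l.
  apply: le_trans (nrm_sum _ _) _; rewrite ler_wpM2l ?sqrtr_ge0//.
  apply: (@le_trans _ _ (\sum_(i < j.+1) eta / j.+1%:R)).
    by apply: ler_sum => i _; have [_ /ltW] := hy i.
  by rewrite sumr_const card_ord -[X in X <= _]mulr_natr divfK// pnatr_eq0.
have [Hpr hpr] := projP (A F) cHq.
have nG : nsq (A F - proj Hq (A F)) = nsq (A F) - nsq pF.
  rewrite (nsq_pythagoras Hpr hpr); congr (_ - _).
  have := proj_unique sHq Hpr hpr HpF projF => h.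
  by rewrite -[proj _ _](subrK pF) addrC nsq_add_null.
have pFsq : nsq pF <= nsq rr + W * (2 * K * eta + eta ^+ 2).
  rewrite -!nrm_sq.
  apply: (@le_trans _ _ ((nrm rr + Num.sqrt W * eta) ^+ 2)).
    by rewrite ler_pXn2r ?nnegrE ?nrm_ge0 ?addr_ge0 ?mulr_ge0 ?sqrtr_ge0 ?nrm_ge0// ltW.
  rewrite sqrrD exprMn (sqr_sqrtr W0) -addrA lerD2l mulrDr lerD2r.
  have h := ler_wpM2r (ltW eta0) (ler_wpM2l (sqrtr_ge0 W) rrK).
  have e1 : Num.sqrt W * (Num.sqrt W * K) * eta = W * K * eta.
    by rewrite [Num.sqrt W * (_ * _)]mulrA -expr2 (sqr_sqrtr W0).
  move: h; rewrite e1; lra.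
have rrsq : nsq rr <= nsq (proj Hq1 (A1 g1)).
  by rewrite -!nrm_sq ler_pXn2r ?nnegrE ?nrm_ge0.
have etas : 2 * K * eta + eta ^+ 2 < 1 by nra.
have hcs : nsq (A F - proj Hq (A F)) <= s ^+ 2 * nsq F.
  by rewrite -!nrm_sq -exprMn ler_pXn2r ?nnegrE ?mulr_ge0 ?nrm_ge0.
have ts : 0 <= t0 ^+ 2 - s ^+ 2 by rewrite subr_ge0 ler_pXn2r ?nnegrE ?(le_trans s0).
(* Both terms are nonnegative, so both vanish: the second forces [c1 = 0], and then the first, when
   [s < t0], forces the combination [kk] of the [kappa i] to be null. *)
have main : (t0 ^+ 2 - s ^+ 2) * xsq F + W * (1 - (2 * K * eta + eta ^+ 2)) <= 0.
  move: hcs; rewrite nG nsqA nsqb nsqbF nsqAbF; move: pFsq rrsq qE; rewrite nG1.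
  set q := _ + eta ^+ 2; lra.
have tx : 0 <= (t0 ^+ 2 - s ^+ 2) * xsq F by rewrite mulr_ge0.
have W00 : W = 0.
  apply/eqP; rewrite eq_le W0 andbT leNgt; apply/negP => Wp.
  have : 0 < W * (1 - (2 * K * eta + eta ^+ 2)) by rewrite mulr_gt0// subr_gt0.
  lra.
have c10 i : c1 i = 0.
  apply: csq_eq0; apply/eqP; move: W00 => /eqP; rewrite psumr_eq0; last by move=> ? _; exact: csq_ge0.
  by move=> /allP /(_ i); rewrite mem_index_enum => /(_ isT).
have k0n : exists l : 'I_k0, c2 l != 0.
  move: ci0; rewrite -(splitK i0); case: (fintype.split i0) => l /=.
    by rewrite -/(c1 l) c10 eqxx.
  by exists l.
(* All of [c1] vanishes, so the nonzero coefficient belongs to some [kappa l], and [k0] is not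
   [0]. *)
have slt : s < t0.
  by case: st0' => // k00; case: k0n => l; have := ltn_ord l; rewrite {2}k00.
have xF : xsq F = 0.
  apply/eqP; rewrite eq_le xsq_ge0 andbT leNgt; apply/negP => Xp.
  move: main; rewrite W00 mul0r addr0; apply/negP; rewrite -ltNge mulr_gt0//.
  by rewrite subr_gt0 ltr_pXn2r ?nnegrE ?(le_trans s0).
have Fk : F = kk.
  by rewrite /F /ff /nn !big1 ?subr0 ?add0r// => i _; rewrite c10 scale0r.
have F0 : nsq kk = 0 by rewrite -Fk nsqb xF nsqbF /g1 big1 ?nsq0 ?addr0// => i _; rewrite c10 scale0r.
by case: k0n => l; rewrite (kappa_free F0) eqxx.
Qed.

Lemma transfer : exists e : 'I_j -> H1, (forall i, D1 (e i)) /\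
  forall f, D1 f -> nrm (f - \sum_l hip f (e l) *: e l) <= nrm f /\
    nrm (G1 (f - \sum_l hip f (e l) *: e l)) <= s * nrm f.
Proof.
have sM : subsp [set b f | f in D].
  split; first by exists 0; [case: sD|rewrite lin0].
  move=> a _ _ [f Df <-] [g Dg <-]; exists (a *: f + g); last exact: lb.
  by case: sD => _; apply.
have MD : [set b f | f in D] `<=` D1 by move=> _ [f Df <-]; exact: bD.
apply: (@index_bound _ _ _ D1 [set b f | f in D] Hq1 A1 A1s s L) => //.
  apply: dense_of_perp => // g Dg hg; apply: b_dense => // f Df.
  by apply: hg; exists f.
exact: no_positive_subspace.
Qed.

End transfer.

(** * Square integrable functions on the circle *)

Section almost_everywhere_circle.
Context {R : realType}.
Implicit Types P Q : R -> Prop.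

Lemma circ_filter : Filter (almost_everywhere (@circ R)).
Proof. exact: ae_filter_ringOfSetsType. Qed.

Lemma aeT P : (forall t, P t) -> \forall t \ae (@circ R), P t.
Proof. by move=> h; apply: (@filterE _ _ circ_filter). Qed.

Lemma aeS P Q : (forall t, P t -> Q t) ->
  (\forall t \ae (@circ R), P t) -> \forall t \ae (@circ R), Q t.
Proof. by move=> h; apply: (@filterS _ _ circ_filter). Qed.

Lemma aeI P Q : (\forall t \ae (@circ R), P t) -> (\forall t \ae (@circ R), Q t) ->
  \forall t \ae (@circ R), P t /\ Q t.
Proof. exact: (@filterI _ _ circ_filter). Qed.

Lemma ae_fin (I : finType) (P : I -> R -> Prop) :
  (forall i, \forall t \ae (@circ R), P i t) -> \forall t \ae (@circ R), forall i, P i t.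
Proof.
move=> h; suff: \forall t \ae (@circ R), forall i, i \in enum I -> P i t.
  by apply: aeS => t ht i; apply: ht; rewrite mem_enum.
elim: (enum I) => [|a s IH]; first exact: aeT.
apply: aeS (aeI (h a) IH) => t [h1 h2] i; rewrite inE => /orP[/eqP -> //|].
exact: h2.
Qed.

End almost_everywhere_circle.

Section integrable_functions.
Context {R : realType}.
Local Notation C := R[i].
Local Notation mu := (@circ R).
Implicit Types (g : R -> R) (f : R -> C).

Definition rmeas g := measurable_fun [set: measurableTypeR R] (g : measurableTypeR R -> R).
Definition rint g := mu.-integrable [set: measurableTypeR R] (EFin \o g).
Definition cmeas f := rmeas (fun t => complex.Re (f t)) /\ rmeas (fun t => complex.Im (f t)).
Definition cintg f := rint (fun t => complex.Re (f t)) /\ rint (fun t => complex.Im (f t)).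
Definition L2s f := cmeas f /\ rint (fun t => csq (f t)).

Lemma circT : mu [set: measurableTypeR R] = 1%:E.
Proof. exact: probability_setT. Qed.

Lemma rint_meas g : rint g -> rmeas g.
Proof. by move=> /measurable_int/measurable_EFinP. Qed.

Lemma rint_cst (k : R) : rint (fun=> k).
Proof. exact: finite_measure_integrable_cst. Qed.

Lemma rintD g1 g2 : rint g1 -> rint g2 -> rint (fun t => g1 t + g2 t).
Proof. by move=> h1 h2; exact: (integrableD measurableT h1 h2). Qed.

Lemma rintZ (k : R) g : rint g -> rint (fun t => k * g t).
Proof. by move=> h; exact: (integrableZl measurableT k h). Qed.

Lemma rint_sum I (r : seq I) (g : I -> R -> R) : (forall i, rint (g i)) ->
  rint (fun t => \sum_(i <- r) g i t).
Proof.
move=> h; elim: r => [|i r IH].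
  by under eq_fun do rewrite big_nil; exact: rint_cst.
by under eq_fun do rewrite big_cons; exact: rintD.
Qed.

Lemma rint_le g h : rmeas g -> rint h -> (\forall t \ae mu, `|g t| <= h t) -> rint g.
Proof.
move=> mg ih gh; apply/integrableP; split; first exact/measurable_EFinP.
move: (ih) => /integrableP[mh]; apply: le_lt_trans.
apply: ae_ge0_le_integral => //.
- by apply/measurable_EFinP; exact: measurableT_comp.
- by apply: measurableT_comp.
- by apply: aeS gh => t ht _ /=; rewrite lee_fin (le_trans ht)// ler_norm.
Qed.

Lemma rint_ae g h : rmeas g -> rint h -> (\forall t \ae mu, g t = h t) -> rint g.
Proof.
move=> mg ih gh; apply: (rint_le mg (h := fun t => `|h t|)).
  exact: (integrable_norm ih).
by apply: aeS gh => t ->.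
Qed.

Lemma Rint_ae g h : rmeas g -> rmeas h -> (\forall t \ae mu, g t = h t) ->
  \int[mu]_t g t = \int[mu]_t h t.
Proof.
move=> mg mh gh; congr fine; apply: ae_eq_integral => //; try exact/measurable_EFinP.
by apply: aeS gh => t -> _.
Qed.

Lemma Rint_eq0_ae g : rint g -> (forall t, 0 <= g t) -> \int[mu]_t g t = 0 ->
  \forall t \ae mu, g t = 0.
Proof.
move=> ig g0 h; have mg := rint_meas ig.
have : (\int[mu]_t `|(g t)%:E|)%E = 0%E.
  under eq_integral do rewrite gee0_abs ?lee_fin//.
  by rewrite -[LHS]fineK ?(integrable_fin_num _ ig)// [fine _]h.
have /= mg' : measurable_fun setT (EFin \o (g : measurableTypeR R -> R)) by exact/measurable_EFinP.
move=> /(ae_eq_integral_abs mu measurableT mg').1.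
by apply: aeS => t /(_ I) [].
Qed.

Lemma cmeasD f1 f2 : cmeas f1 -> cmeas f2 -> cmeas (fun t => f1 t + f2 t).
Proof.
move=> [a1 b1] [a2 b2]; split.
  by under eq_fun do rewrite ReD; exact: measurable_funD.
by under eq_fun do rewrite ImD; exact: measurable_funD.
Qed.

Lemma cmeasM f1 f2 : cmeas f1 -> cmeas f2 -> cmeas (fun t => f1 t * f2 t).
Proof.
move=> [a1 b1] [a2 b2]; split.
  by under eq_fun do rewrite ReM; apply: measurable_funB; exact: measurable_funM.
by under eq_fun do rewrite ImM; apply: measurable_funD; exact: measurable_funM.
Qed.

Lemma cmeas_cst (c : C) : cmeas (fun=> c).
Proof. by split; exact: measurable_cst. Qed.

Lemma cmeasJ f : cmeas f -> cmeas (fun t => (f t)^*).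
Proof.
move=> [a b]; split; first by under eq_fun do rewrite ReJ.
by under eq_fun do rewrite ImJ; exact: measurableT_comp.
Qed.

Lemma cmeas_sum I (r : seq I) (f : I -> R -> C) : (forall i, cmeas (f i)) ->
  cmeas (fun t => \sum_(i <- r) f i t).
Proof.
move=> h; elim: r => [|i r IH].
  by under eq_fun do rewrite big_nil; exact: cmeas_cst.
by under eq_fun do rewrite big_cons; exact: cmeasD.
Qed.

Lemma rmeas_csq f : cmeas f -> rmeas (fun t => csq (f t)).
Proof. by move=> [a b]; apply: measurable_funD; exact: measurable_funX. Qed.

Lemma cintg_meas f : cintg f -> cmeas f.
Proof. by move=> [a b]; split; exact: rint_meas. Qed.

Lemma cintgD f1 f2 : cintg f1 -> cintg f2 -> cintg (fun t => f1 t + f2 t).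
Proof.
move=> [a1 b1] [a2 b2]; split.
  by under eq_fun do rewrite ReD; exact: rintD.
by under eq_fun do rewrite ImD; exact: rintD.
Qed.

Lemma cintgZ (c : C) f : cintg f -> cintg (fun t => c * f t).
Proof.
move=> [a b]; split.
  under eq_fun do rewrite ReM -mulNr; apply: rintD; exact: rintZ.
under eq_fun do rewrite ImM; apply: rintD; exact: rintZ.
Qed.

Lemma cintg_cst (c : C) : cintg (fun=> c).
Proof. by split; exact: rint_cst. Qed.

Lemma cintg_sum I (r : seq I) (f : I -> R -> C) : (forall i, cintg (f i)) ->
  cintg (fun t => \sum_(i <- r) f i t).
Proof.
move=> h; elim: r => [|i r IH].
  by under eq_fun do rewrite big_nil; exact: cintg_cst.
by under eq_fun do rewrite big_cons; exact: cintgD.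
Qed.

Lemma normr_Re_le (c : C) (a : R) : 0 <= a -> csq c <= a ^+ 2 ->
  `|complex.Re c| <= a /\ `|complex.Im c| <= a.
Proof.
by move=> a0 h; split; rewrite -(@ler_pXn2r _ 2)// ?nnegrE// real_normK ?num_real//;
  apply: le_trans h; rewrite ?lerDl ?lerDr ?sqr_ge0.
Qed.

Lemma cintg_le f h : cmeas f -> rint h -> (forall t, 0 <= h t) ->
  (\forall t \ae mu, csq (f t) <= h t ^+ 2) -> cintg f.
Proof.
move=> [a b] ih h0 fh; split; apply: (rint_le _ ih) => //;
  by apply: aeS fh => t ht; have [] := normr_Re_le (h0 t) ht.
Qed.

Lemma cintegralD f1 f2 : cintg f1 -> cintg f2 ->
  cintegral (fun t => f1 t + f2 t) = cintegral f1 + cintegral f2.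
Proof.
move=> [a1 b1] [a2 b2]; rewrite /cintegral.
under eq_Rintegral do rewrite ReD.
under [X in _ +i* X]eq_Rintegral do rewrite ImD.
by rewrite !RintegralD.
Qed.

Lemma cintegralZ (c : C) f : cintg f ->
  cintegral (fun t => c * f t) = c * cintegral f.
Proof.
move=> [a b]; rewrite /cintegral.
under eq_Rintegral do rewrite ReM -mulNr.
under [X in _ +i* X]eq_Rintegral do rewrite ImM.
rewrite !RintegralD ?RintegralZl//; try exact: rintZ.
by case: c => u v /=; apply: complex_ext; rewrite /= ?mulNr.
Qed.

Lemma cintegralJ f : cintg f -> cintegral (fun t => (f t)^*) = (cintegral f)^*.
Proof.
move=> [a b]; rewrite /cintegral.
under eq_Rintegral do rewrite ReJ.
under [X in _ +i* X]eq_Rintegral do rewrite ImJ -mulN1r.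
by rewrite RintegralZl// mulN1r.
Qed.

Lemma cintegral_cst (c : C) : cintegral (fun=> c) = c.
Proof. by rewrite /cintegral !Rintegral_cst// circT /= !mulr1; case: c. Qed.

Lemma cintegral_sum I (r : seq I) (f : I -> R -> C) : (forall i, cintg (f i)) ->
  cintegral (fun t => \sum_(i <- r) f i t) = \sum_(i <- r) cintegral (f i).
Proof.
move=> h; elim: r => [|i r IH].
  by rewrite big_nil -[RHS](cintegral_cst 0); congr cintegral; apply/funext => t; rewrite big_nil.
rewrite big_cons -IH -cintegralD//; last exact: cintg_sum.
by congr cintegral; apply/funext => t; rewrite big_cons.
Qed.

Lemma cintegral_ae f1 f2 : cmeas f1 -> cmeas f2 ->
  (\forall t \ae mu, f1 t = f2 t) -> cintegral f1 = cintegral f2.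
Proof.
move=> [a1 b1] [a2 b2] h; rewrite /cintegral; congr (_ +i* _); apply: Rint_ae => //;
  by apply: aeS h => t ->.
Qed.

Lemma L2s_cst (c : C) : L2s (fun=> c).
Proof. by split; [exact: cmeas_cst|exact: rint_cst]. Qed.

Lemma L2sD f1 f2 : L2s f1 -> L2s f2 -> L2s (fun t => f1 t + f2 t).
Proof.
move=> [m1 i1] [m2 i2]; have mD := cmeasD m1 m2; split => //.
apply: (rint_le (rmeas_csq mD) (rintZ 2 (rintD i1 i2))).
by apply: aeT => t; rewrite ger0_norm ?csq_ge0// csqD.
Qed.

Lemma L2s_mul (phi f : R -> C) (M : R) : cmeas phi ->
  (\forall t \ae mu, csq (phi t) <= M) -> L2s f -> L2s (fun t => phi t * f t).
Proof.
move=> mphi hM [mf jf]; have mM := cmeasM mphi mf; split=> //.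
apply: (rint_le (rmeas_csq mM) (rintZ M jf)).
apply: aeS hM => t hM; rewrite ger0_norm ?csq_ge0// csqM ler_wpM2r ?csq_ge0//.
Qed.

Lemma L2sZ (c : C) f : L2s f -> L2s (fun t => c * f t).
Proof. by apply: L2s_mul (cmeas_cst c) _ => //; exact: aeT. Qed.

Lemma L2sJ f : L2s f -> L2s (fun t => (f t)^*).
Proof.
move=> [m i1]; split; first exact: cmeasJ.
by under eq_fun do rewrite csqJ.
Qed.

Lemma L2s_sum I (r : seq I) (f : I -> R -> C) : (forall i, L2s (f i)) ->
  L2s (fun t => \sum_(i <- r) f i t).
Proof.
move=> h; elim: r => [|i r IH].
  by under eq_fun do rewrite big_nil; exact: L2s_cst.
by under eq_fun do rewrite big_cons; exact: L2sD.
Qed.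

Lemma L2s_ae f h : cmeas f -> L2s h -> (\forall t \ae mu, f t = h t) -> L2s f.
Proof.
move=> mf [mh ih] fh; split=> //; apply: (rint_ae (rmeas_csq mf) ih).
by apply: aeS fh => t ->.
Qed.

Lemma L2s_prod f1 f2 : L2s f1 -> L2s f2 -> cintg (fun t => f1 t * f2 t).
Proof.
move=> [m1 i1] [m2 i2]; apply: (cintg_le (cmeasM m1 m2) (rintD i1 i2)).
  by move=> t; rewrite addr_ge0 ?csq_ge0.
apply: aeT => t; rewrite csqM; have := csq_ge0 (f1 t); have := csq_ge0 (f2 t); nra.
Qed.

Lemma L2s_cintg f : L2s f -> cintg f.
Proof.
move=> h; have := L2s_prod h (L2s_cst 1).
by under eq_fun do rewrite mulr1.
Qed.

End integrable_functions.

(** * Riesz-Fischer theorem for real functions *)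

Section completeness.
Context {R : realType}.
Local Notation C := R[i].
Local Notation mu := (@circ R).

Lemma rmeasB (g h : R -> R) : rmeas g -> rmeas h -> rmeas (fun t => g t - h t).
Proof. by move=> mg mh; exact: measurable_funB. Qed.

Lemma emeas_sqr (g : R -> R) : rmeas g ->
  measurable_fun [set: measurableTypeR R] (fun t => (g t ^+ 2)%:E).
Proof. by move=> mg; apply/measurable_EFinP; exact: measurable_funX. Qed.

(** The inequality [|d| <= 2^k d^2 + 2^-k] turns the bounds on squares into integrals of [|d k|] of
    size at most [2 * 2^-k]. Hence the sum of the [|d k|] is integrable, so finite a.e., and the
    series of the [d k] telescopes to [g]. *)
Lemma rapid_ae_cvg (g : nat -> R -> R) : (forall k, rmeas (g k)) ->
  (forall k, (\int[mu]_t ((g k.+1 t - g k t) ^+ 2)%:E <= (4%:R ^- k)%:E)%E) ->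
  \forall t \ae mu, cvgn (fun k => g k t : R^o).
Proof.
move=> mg hg; pose d k t := g k.+1 t - g k t.
have md k : rmeas (d k) by exact: rmeasB.
have mad k : measurable_fun [set: measurableTypeR R] (fun t => `|d k t|%:E).
  by apply/measurable_EFinP; exact: (measurableT_comp (@normr_measurable R setT) (md k)).
have mq k : measurable_fun [set: measurableTypeR R] (fun t => (2%:R ^+ k * d k t ^+ 2)%:E).
  apply/measurable_EFinP; apply: measurable_funM; [exact: measurable_cst|exact: (measurable_funX _ (md k))].
have hd k : (\int[mu]_t `|d k t|%:E <= (2 * 2%:R ^- k)%:E)%E.
  have p2 : 0 < 2%:R ^+ k :> R by rewrite exprn_gt0.
  apply: (@le_trans _ _ (\int[mu]_t ((2%:R ^+ k * d k t ^+ 2)%:E + (2%:R ^- k)%:E))%E).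
    apply: ge0_le_integral => //=.
    - by apply: emeasurable_funD; [exact: mq|exact: measurable_cst].
    - move=> t _; rewrite -EFinD lee_fin.
      have : 2%:R ^+ k * 2%:R ^- k = 1 :> R by rewrite mulfV// gt_eqF.
      have : 0 < 2%:R ^- k :> R by rewrite invr_gt0.
      move: (2%:R ^- k) => b; move: (2%:R ^+ k) p2 => a a0 b0 ab.
      have := sqr_ge0 (a * `|d k t| - 1); rewrite -(real_normK (num_real (d k t))).
      move: (`|d k t|) => x.
      have -> : (a * x - 1) ^+ 2 = a * (a * x ^+ 2 - 2 * x + b).
        by transitivity (a ^+ 2 * x ^+ 2 - 2 * a * x + a * b); [rewrite ab; ring|ring].
      by rewrite pmulr_rge0// => h; have := normr_ge0 (d k t); nra.
  have q0 t : (0 <= (2%:R ^+ k * d k t ^+ 2)%:E)%E by rewrite lee_fin mulr_ge0 ?sqr_ge0 ?ltW.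
  have c0 : (0 <= (2%:R ^- k : R)%:E)%E by rewrite lee_fin invr_ge0 ltW.
  rewrite (ge0_integralD mu measurableT (fun t _ => q0 t) (mq k) (fun t _ => c0) (measurable_cst _)).
  rewrite integral_cst// circT mule1.
  under eq_integral do rewrite EFinM.
  rewrite ge0_integralZl_EFin ?(ltW p2)//; [|by move=> t _; rewrite lee_fin sqr_ge0|exact: emeas_sqr].
  apply: (@le_trans _ _ ((2%:R ^+ k)%:E * (4%:R ^- k)%:E + (2%:R ^- k)%:E)%E).
    by rewrite leeD2r// lee_pmul2l ?lte_fin//; exact: hg.
  rewrite -EFinM -EFinD lee_fin.
  have -> : 4%:R ^- k = 2%:R ^- k * 2%:R ^- k :> R.
    by rewrite -invfM -exprMn -natrM.
  rewrite mulrA mulfV ?gt_eqF// mul1r; lra.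
have sumfin : (\int[mu]_t (\sum_(0 <= k <oo) `|d k t|%:E) < +oo)%E.
  rewrite integral_nneseries//.
  apply: (@le_lt_trans _ _ (\sum_(0 <= k <oo) (2 * 2%:R ^- k)%:E)%E).
    apply: lee_nneseries => k _; last exact: hd.
    by move=> _; apply: integral_ge0 => t _; rewrite lee_fin.
  (* The term [4 / 2^(k+1)] is [2 * 2^-k]. *)
  have h4 : (\sum_(0 <= k <oo) (4 / (2 ^ k.+1)%:R)%:E <= 4%:E :> \bar R)%E.
    exact: epsilon_trick0.
  apply: (le_lt_trans _ (ltry 4)); apply: le_trans h4.
  apply: lee_nneseries => k _; first by move=> _; rewrite lee_fin mulr_ge0// invr_ge0 exprn_ge0.
  by rewrite lee_fin natrX exprS invfM mulrA; apply: ler_wpM2r; [rewrite invr_ge0 exprn_ge0|lra].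
have ie : mu.-integrable [set: measurableTypeR R] (fun t => \sum_(0 <= k <oo) `|d k t|%:E)%E.
  apply/integrableP; split.
    by apply: ge0_emeasurable_sum => // k t _ _; rewrite lee_fin.
  under eq_integral do rewrite gee0_abs ?nneseries_ge0//.
  exact: sumfin.
have := integrable_ae measurableT ie.
apply: aeS => t /(_ I) ft.
have cs : cvgn (series (fun k => `|d k t|)).
  apply: nondecreasing_is_cvgn.
    by apply: nondecreasing_series => k _.
  exists (fine (\sum_(0 <= k <oo) `|d k t|%:E)%E) => _ [n _ <-].
  rewrite -lee_fin fineK// /series/= -sumEFin.
  exact: nneseries_lim_ge.
have cd : cvgn (series (fun k => d k t : R^o)) by exact: normed_cvg.
have e k : g k t = g 0 t + series (fun k => d k t) k.
  rewrite /series /= /d telescope_sumr//; lra.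
under eq_fun do rewrite e.
apply: is_cvgD => //; exact: is_cvg_cst.
Qed.

Lemma real_L2_complete (g : nat -> R -> R) : (forall k, rmeas (g k)) ->
  (forall e : R, 0 < e -> exists N, forall m n, (N <= m)%N -> (N <= n)%N ->
     (\int[mu]_t ((g m t - g n t) ^+ 2)%:E <= e%:E)%E) ->
  exists f, rmeas f /\ forall e : R, 0 < e -> exists N, forall n, (N <= n)%N ->
     (\int[mu]_t ((g n t - f t) ^+ 2)%:E <= e%:E)%E.
Proof.
move=> mg cau.
have p4 k : 0 < 4%:R ^- k :> R by rewrite invr_gt0 exprn_gt0.
have /choice [N hN] : forall k, exists N, forall m n, (N <= m)%N -> (N <= n)%N ->
     (\int[mu]_t ((g m t - g n t) ^+ 2)%:E <= (4%:R ^- k)%:E)%E by move=> k; exact: cau.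
(* A strictly increasing sequence with [N k <= phi k], so that consecutive terms of the subsequence
   satisfy the bound [4^-k]. *)
pose phi := fix phi k := if k is k'.+1 then maxn (phi k').+1 (N k) else N 0%N.
have phiN k : (N k <= phi k)%N by case: k => [|k] //=; rewrite leq_maxr.
have phiS k : (phi k < phi k.+1)%N by rewrite /= leq_max leqnn.
have phik k : (k <= phi k)%N by elim: k => // k IH; apply: leq_ltn_trans (phiS k).
have ae := @rapid_ae_cvg (fun k => g (phi k)) (fun k => mg _).
have {}ae := ae (fun k => hN k _ _ (leq_trans (phiN k) (ltnW (phiS k))) (phiN k)).
(* The upper limit is measurable whether or not the sequence converges, and is the limit wherever it
   does. *)
pose f t := fine (limn_esup (fun k => (g (phi k) t)%:E)).
have mf : rmeas f.
  apply: measurableT_comp => //.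
  by apply: measurable_fun_limn_esup => k; apply/measurable_EFinP; exact: mg.
have fE : \forall t \ae mu, (fun k => g (phi k) t : R^o) @ \oo --> f t.
  apply: aeS ae => t ct.
  have h : (fun k => (g (phi k) t)%:E) @ \oo --> (limn (fun k => g (phi k) t : R^o))%:E.
    by apply: cvg_EFin => //; exact: nearW.
  by rewrite /f is_cvg_limn_esupE ?(cvg_lim _ h)//; apply/cvg_ex; eexists; exact: h.
exists f; split=> // e e0; have [M hM] := cau e e0.
exists M => n Mn.
have mD k : measurable_fun [set: measurableTypeR R] (fun t => ((g n t - g (phi k) t) ^+ 2)%:E).
  by apply: emeas_sqr; exact: rmeasB.
(* This prepares Fatou's lemma along the subsequence, with [n] fixed. *)
have -> : (\int[mu]_t ((g n t - f t) ^+ 2)%:E =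
    \int[mu]_t limn_einf (fun k => ((g n t - g (phi k) t) ^+ 2)%:E))%E.
  apply: ae_eq_integral => //.
  - by apply: emeas_sqr; exact: rmeasB.
  - apply: (eq_measurable_fun (fun t => - limn_esup (fun k => - ((g n t - g (phi k) t) ^+ 2)%:E))%E).
      move=> t _; rewrite -limn_einfN; congr limn_einf.
      by apply/funext => k; rewrite /= opprK.
    apply: measurableT_comp => //; apply: measurable_fun_limn_esup => k.
    exact: (measurableT_comp (@oppe_measurable R setT) (mD k)).
  - apply: aeS fE => t ft _; apply/esym.
    have h : (fun k => ((g n t - g (phi k) t) ^+ 2)%:E) @ \oo --> ((g n t - f t) ^+ 2)%:E.
      apply: cvg_EFin; first exact: nearW.
      rewrite expr2; under eq_fun do rewrite expr2.
      by apply: cvgM; apply: cvgB => //; exact: cvg_cst.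
    by rewrite is_cvg_limn_einfE ?(cvg_lim _ h)//; apply/cvg_ex; eexists; exact: h.
apply: le_trans (fatou mu measurableT mD _) _; first by move=> k t _; rewrite lee_fin sqr_ge0.
rewrite limn_einf_lim; apply: lime_le.
  exact: is_cvg_einfs.
apply: nearW => k; apply: ereal_inf_le.
pose k' := maxn k M; exists (\int[mu]_t ((g n t - g (phi k') t) ^+ 2)%:E)%E.
  by exists k' => //=; exact: leq_maxl.
by apply: hM => //; apply: leq_trans (phik _); exact: leq_maxr.
Qed.

End completeness.

(** * The Hilbert space of square integrable vector functions *)

Section vectors.
Context {R : realType}.
Local Notation C := R[i].
Local Notation mu := (@circ R).

Definition vsq n (x : 'cV[C]_n) : R := \sum_i csq (x i 0).

Lemma vsq_ge0 n (x : 'cV[C]_n) : 0 <= vsq x.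
Proof. by apply: sumr_ge0 => i _; exact: csq_ge0. Qed.

Lemma vnormE n (x : 'cV[C]_n) : vnorm x = Num.sqrt (vsq x).
Proof. by rewrite /vnorm; congr Num.sqrt; apply: eq_bigr => i _; rewrite csq_norm. Qed.

Lemma vsq_eq0 n (x : 'cV[C]_n) : vsq x = 0 -> x = 0.
Proof.
move=> /eqP; rewrite psumr_eq0; last by move=> *; exact: csq_ge0.
move=> /allP h; apply/matrixP => i j; rewrite ord1 mxE.
by apply: csq_eq0; apply/eqP; move: (h i); rewrite mem_index_enum => /(_ isT).
Qed.

Lemma vsq_le n (x : 'cV[C]_n) i : csq (x i 0) <= vsq x.
Proof. by rewrite /vsq (bigD1 i)//= lerDl sumr_ge0// => *; exact: csq_ge0. Qed.

Lemma vsq_adj n (x : 'cV[C]_n) : (vsq x)%:C = \sum_i x i 0 * (x i 0)^*.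
Proof. by rewrite rmorph_sum; apply: eq_bigr => i _; exact: csqE. Qed.

Lemma mxmeasurableP m n (F : R -> 'M[C]_(m, n)) :
  mxmeasurable F <-> forall i j, cmeas (fun t => F t i j).
Proof. by split=> h i j; have [] := h i j. Qed.

Lemma rmeas_sum I (r : seq I) (g : I -> R -> R) : (forall i, rmeas (g i)) ->
  rmeas (fun t => \sum_(i <- r) g i t).
Proof. by move=> h; exact: measurable_sum. Qed.

Lemma l2norm_int n (f : R -> 'cV[C]_n) :
  l2norm f = ((\int[mu]_t (vsq (f t))%:E) `^ 2^-1)%E.
Proof.
rewrite /l2norm unlock; congr poweR; apply: eq_integral => t _.
by rewrite abse_EFin poweR_EFin ger0_norm ?sqrtr_ge0// powR_mulrn ?sqrtr_ge0// vnormE sqr_sqrtr// vsq_ge0.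
Qed.

Lemma L2P n (f : R -> 'cV[C]_n) : L2 f <-> forall i, L2s (fun t => f t i 0).
Proof.
split=> [[/mxmeasurableP mf lf] i|h]; last first.
  split; first by apply/mxmeasurableP => i j; rewrite ord1; have [] := h i.
  rewrite l2norm_int.
  have : rint (fun t => vsq (f t)) by apply: rint_sum => i; have [] := h i.
  move=> /(integrable_fin_num measurableT); rewrite /= => hf.
  by rewrite -(fineK hf) poweR_EFin ltry.
split; first exact: mf.
have mv : rmeas (fun t => vsq (f t)).
  by apply: rmeas_sum => l; apply: rmeas_csq; exact: mf.
apply: (rint_le (rmeas_csq (mf i 0)) (h := fun t => vsq (f t))).
  apply/integrableP; split; first exact/measurable_EFinP.
  under eq_integral do rewrite abse_EFin ger0_norm ?vsq_ge0//.
  move: lf; rewrite l2norm_int; case: (\int[mu]_x _)%E => [r||] //=.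
  - by move=> _; exact: ltry.
  - by rewrite invr_eq0 pnatr_eq0.
by apply: aeT => t; rewrite ger0_norm ?csq_ge0// vsq_le.
Qed.

Definition L2pred n : {pred R -> 'cV[C]_n} := fun f => `[< L2 f >].

Arguments L2pred n : clear implicits.

Lemma L2pred_submod n : submod_closed (L2pred n).
Proof.
split.
  apply/asboolP/L2P => i; under eq_fun do rewrite mxE; exact: L2s_cst.
move=> a f g /asboolP/L2P hf /asboolP/L2P hg; apply/asboolP/L2P => i.
by under eq_fun do rewrite !mxE; apply: L2sD => //; exact: L2sZ.
Qed.

HB.instance Definition _ n := GRing.isSubmodClosed.Build _ _ (L2pred n) (@L2pred_submod n).

Record L2t n := MkL2 { L2fun :> R -> 'cV[C]_n; _ : L2fun \in L2pred n }.

HB.instance Definition _ n := [isSub for @L2fun n].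
HB.instance Definition _ n := [Choice of L2t n by <:].
HB.instance Definition _ n := [SubChoice_isSubLmodule of L2t n by <:].

End vectors.
Arguments L2pred {R} n.
Arguments L2t R n : clear implicits.

Section hilbert_L2.
Context {R : realType}.
Local Notation C := R[i].
Local Notation mu := (@circ R).

Lemma L2tP n (f : L2t R n) : L2 f.
Proof. by have := valP f => /asboolP. Qed.

Lemma L2t_L2s n (f : L2t R n) i : L2s (fun t => f t i 0).
Proof. by have /L2P := L2tP f. Qed.

Definition toL2 n (f : R -> 'cV[C]_n) (h : L2 f) : L2t R n := MkL2 (asboolT h : f \in L2pred n).

Lemma L2t_add n (f g : L2t R n) t : (f + g) t = f t + g t.
Proof. by rewrite -[L2fun (f + g)]/(\val (f + g)) raddfD. Qed.

Lemma L2t_scale n (a : C) (f : L2t R n) t : (a *: f) t = a *: f t.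
Proof. by rewrite -[L2fun (a *: f)]/(\val (a *: f)) linearZ. Qed.

Lemma L2t_opp n (f : L2t R n) t : (- f) t = - f t.
Proof. by rewrite -[L2fun (- f)]/(\val (- f)) raddfN. Qed.

Lemma L2t_zero n t : (0 : L2t R n) t = 0.
Proof. by rewrite -[L2fun 0]/(\val (0 : L2t R n)) raddf0. Qed.

Lemma L2t_sum n k (c : 'I_k -> C) (u : 'I_k -> L2t R n) t :
  (\sum_i c i *: u i) t = \sum_i c i *: u i t.
Proof.
elim: k c u => [|k IH] c u; first by rewrite !big_ord0 L2t_zero.
by rewrite !big_ord_recl L2t_add L2t_scale IH.
Qed.

Lemma L2t_eq n (f g : L2t R n) : (forall t, f t = g t) -> f = g.
Proof. by move=> h; apply: val_inj; apply/funext => t; exact: h. Qed.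

Lemma ip_cint n (f g : R -> 'cV[C]_n) : L2 f -> L2 g ->
  cintg (fun t => \sum_i f t i 0 * (g t i 0)^*).
Proof.
by move=> /L2P hf /L2P hg; apply: cintg_sum => i; apply: L2s_prod => //; exact: L2sJ.
Qed.

Lemma ip_vsq n (f : R -> 'cV[C]_n) : ip f f = (\int[mu]_t vsq (f t))%:C.
Proof.
have -> : ip f f = cintegral (fun t => (vsq (f t))%:C).
  by congr cintegral; apply/funext => t; rewrite vsq_adj.
by rewrite /cintegral /= Rintegral_cst// mul0r.
Qed.

Lemma L2t_sub n (f g : L2t R n) t : (f - g) t = f t - g t.
Proof. by rewrite L2t_add L2t_opp. Qed.

Lemma ip_vsq_sub n (f g : L2t R n) :
  complex.Re (ip (f - g) (f - g)) = \int[mu]_t vsq (f t - g t).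
Proof. by rewrite ip_vsq; apply: eq_Rintegral => t _; rewrite L2t_sub. Qed.

Lemma ip_lin n (a : C) (f g h : R -> 'cV[C]_n) : L2 f -> L2 g -> L2 h ->
  ip (a *: f + g) h = a * ip f h + ip g h.
Proof.
move=> hf hg hh; rewrite /ip -cintegralZ; last exact: ip_cint.
rewrite -cintegralD; [|by apply: cintgZ; exact: ip_cint|exact: ip_cint].
congr cintegral; apply/funext => t; rewrite mulr_sumr -big_split; apply: eq_bigr => i _.
by rewrite !mxE mulrDl mulrA.
Qed.

Lemma ip_symm n (f g : R -> 'cV[C]_n) : L2 f -> L2 g -> ip f g = (ip g f)^*.
Proof.
move=> hf hg; rewrite -cintegralJ; last exact: ip_cint.
congr cintegral; apply/funext => t; rewrite conj_sumc; apply: eq_bigr => i _.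
by rewrite conjMc conjcK mulrC.
Qed.

Lemma ip_ae n (f f' g g' : R -> 'cV[C]_n) : L2 f -> L2 f' -> L2 g -> L2 g' ->
  (\forall t \ae mu, f t = f' t) -> (\forall t \ae mu, g t = g' t) -> ip f g = ip f' g'.
Proof.
move=> hf hf' hg hg' ff gg; apply: cintegral_ae; try by apply: cintg_meas; exact: ip_cint.
by apply: aeS (aeI ff gg) => t [-> ->].
Qed.

Lemma rint_vsq n (f : R -> 'cV[C]_n) : L2 f -> rint (fun t => vsq (f t)).
Proof. by move=> /L2P h; apply: rint_sum => i; have [] := h i. Qed.

Lemma L2_complete n (u : nat -> L2t R n) :
  (forall e : R, 0 < e -> exists N, forall m n, (N <= m)%N -> (N <= n)%N ->
     complex.Re (ip (u m - u n) (u m - u n)) < e) ->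
  exists x : L2t R n, forall e : R, 0 < e -> exists N, forall n, (N <= n)%N ->
     complex.Re (ip (u n - x) (u n - x)) < e.
Proof.
move=> cau.
have cau' (e : R) : 0 < e -> exists N, forall m l, (N <= m)%N -> (N <= l)%N ->
    \int[mu]_t vsq (u m t - u l t) <= e.
  move=> e0; have [N hN] := cau e e0; exists N => m l Nm Nl.
  by apply: ltW; have := hN m l Nm Nl; rewrite ip_vsq_sub.
have mu_ m i : cmeas (fun t => u m t i 0) by have [] := L2t_L2s (u m) i.
have part (p : C -> R) (i : 'I_n) : (forall m, rmeas (fun t => p (u m t i 0))) ->
    (forall c d, (p c - p d) ^+ 2 <= csq (c - d)) ->
    exists f, rmeas f /\ forall e : R, 0 < e -> exists N, forall l, (N <= l)%N ->
     (\int[mu]_t ((p (u l t i 0) - f t) ^+ 2)%:E <= e%:E)%E.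
  move=> mp hp; apply: real_L2_complete => // e e0.
  have [N hN] := cau' e e0; exists N => m l Nm Nl.
  have iv : rint (fun t => vsq (u m t - u l t)).
    have := rint_vsq (L2tP (u m - u l)).
    by congr rint; apply/funext => t; rewrite L2t_sub.
  apply: (@le_trans _ _ (\int[mu]_t (vsq (u m t - u l t))%:E)%E).
    apply: ge0_le_integral => //=.
    - by move=> t _; rewrite lee_fin sqr_ge0.
    - by apply: emeas_sqr; exact: rmeasB.
    - by apply/measurable_EFinP; exact: rint_meas.
    - move=> t _; rewrite lee_fin; apply: le_trans (hp _ _) _.
      by apply: le_trans (vsq_le _ i); rewrite !mxE.
  by rewrite -[leLHS]fineK ?lee_fin ?hN// (integrable_fin_num measurableT iv).
have hRe c d : (complex.Re c - complex.Re d) ^+ 2 <= csq (c - d :> C).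
  by rewrite /csq ReD ReN lerDl sqr_ge0.
have hIm c d : (complex.Im c - complex.Im d) ^+ 2 <= csq (c - d :> C).
  by rewrite /csq ImD ImN lerDr sqr_ge0.
have /choice [a ha] : forall i, exists f, rmeas f /\ forall e : R, 0 < e -> exists N,
    forall l, (N <= l)%N -> (\int[mu]_t ((complex.Re (u l t i 0) - f t) ^+ 2)%:E <= e%:E)%E.
  by move=> i; apply: part => // m; have [] := mu_ m i.
have /choice [b hb] : forall i, exists f, rmeas f /\ forall e : R, 0 < e -> exists N,
    forall l, (N <= l)%N -> (\int[mu]_t ((complex.Im (u l t i 0) - f t) ^+ 2)%:E <= e%:E)%E.
  by move=> i; apply: part => // m; have [] := mu_ m i.
pose x t : 'cV[C]_n := \col_i (a i t +i* b i t).
have mx i : cmeas (fun t => x t i 0).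
  by split; under eq_fun do rewrite mxE /=; [have [] := ha i|have [] := hb i].
have mux l i : cmeas (fun t => u l t i 0 - x t i 0).
  have -> : (fun t => u l t i 0 - x t i 0) = (fun t => u l t i 0 + (-1) * x t i 0).
    by apply/funext => t; rewrite mulN1r.
  by apply: cmeasD => //; apply: cmeasM => //; exact: cmeas_cst.
have lim i (e : R) : 0 < e -> exists N, forall l, (N <= l)%N ->
    (\int[mu]_t (csq (u l t i 0 - x t i 0))%:E <= e%:E)%E.
  move=> e0; have [|N1 h1] := (ha i).2 (e / 2); first by rewrite divr_gt0.
  have [|N2 h2] := (hb i).2 (e / 2); first by rewrite divr_gt0.
  exists (maxn N1 N2) => l; rewrite geq_max => /andP[/h1 l1 /h2 l2].
  rewrite (splitr e) EFinD; apply: le_trans (leeD l1 l2).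
  have m1 : measurable_fun [set: measurableTypeR R] (fun t => ((complex.Re (u l t i 0) - a i t) ^+ 2)%:E).
    by apply: emeas_sqr; apply: rmeasB; [have [] := mu_ l i|have [] := ha i].
  have m2 : measurable_fun [set: measurableTypeR R] (fun t => ((complex.Im (u l t i 0) - b i t) ^+ 2)%:E).
    by apply: emeas_sqr; apply: rmeasB; [have [] := mu_ l i|have [] := hb i].
  rewrite -ge0_integralD//; try by move=> t _; rewrite lee_fin sqr_ge0.
  rewrite le_eqVlt; apply/orP; left; apply/eqP; apply: eq_integral => t _.
  by rewrite -EFinD /csq ReD ImD ReN ImN mxE.
(* Convergence alone, at [e = 1], shows that some [u N - x] is square integrable; hence so is every
   other difference, and then [x]. *)
have L2ux l i : L2s (fun t => u l t i 0 - x t i 0).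
  have [N hN] := lim i 1 ltr01.
  have dN : L2s (fun t => u N t i 0 - x t i 0).
    split=> //; apply/integrableP; split; first by apply/measurable_EFinP; exact: rmeas_csq.
    under eq_integral do rewrite abse_EFin ger0_norm ?csq_ge0//.
    exact: le_lt_trans (hN N (leqnn _)) (ltry _).
  have := L2sD (L2sD (L2t_L2s (u l) i) (L2sZ (-1) (L2t_L2s (u N) i))) dN.
  by congr L2s; apply/funext => t; rewrite mulN1r; ring.
have L2x : L2 x.
  apply/L2P => i; have := L2sD (L2t_L2s (u 0%N) i) (L2sZ (-1) (L2ux 0%N i)).
  by congr L2s; apply/funext => t; rewrite mulN1r; ring.
exists (toL2 L2x) => e e0.
(* With [n.+1] instead of [n], the sum of [n] terms is strictly below [e], and [n = 0] is
   covered. *)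
have e'0 : 0 < e / n.+1%:R by rewrite divr_gt0.
have /choice [N hN] := fun i => lim i _ e'0.
exists (\max_i N i) => l hl.
rewrite ip_vsq_sub /=.
have -> : \int[mu]_t vsq (u l t - x t) = \sum_i \int[mu]_t csq (u l t i 0 - x t i 0).
  have := @cintegral_sum R 'I_n (index_enum _) (fun i t => (csq (u l t i 0 - x t i 0))%:C).
  move=> h; have {}h := h (fun i => _) .
  rewrite /vsq.
  transitivity (complex.Re (cintegral (fun t => \sum_i (csq (u l t i 0 - x t i 0))%:C))).
    rewrite /cintegral /=; apply: eq_Rintegral => t _.
    by rewrite -rmorph_sum /=; apply: eq_bigr => i _; rewrite !mxE.
  rewrite h.
    by rewrite raddf_sum.
  by move=> i; split=> /=; [have [] := L2ux l i|exact: rint_cst].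
apply: (@le_lt_trans _ _ (\sum_(i < n) e / n.+1%:R)).
  apply: ler_sum => i _; rewrite -lee_fin fineK; first by apply: hN; apply: leq_trans hl; exact: leq_bigmax.
  by apply: integrable_fin_num => //; have [] := L2ux l i.
rewrite sumr_const card_ord -[X in X < _]mulr_natr mulrAC ltr_pdivrMr// ltr_pM2l//.
by rewrite ltr_nat.
Qed.

Lemma ip_Re_ge0 n (f : L2t R n) : 0 <= complex.Re (ip f f).
Proof. by rewrite ip_vsq; apply: Rintegral_ge0 => t _; exact: vsq_ge0. Qed.

Definition L2h n : hilbert R := @Hilbert R (L2t R n) (fun f g => ip f g)
  (fun a f g h => ip_lin a (L2tP f) (L2tP g) (L2tP h))
  (fun f g => ip_symm (L2tP f) (L2tP g))
  (@ip_Re_ge0 n)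
  (@L2_complete n).

End hilbert_L2.

(** * Multiplication by bounded matrix functions *)

Section multiplication.
Context {R : realType}.
Local Notation C := R[i].
Local Notation mu := (@circ R).

Definition mxadj m n (A : 'M[C]_(m, n)) : 'M[C]_(n, m) := (mxbar A)^T.

Lemma mxadjE m n (A : 'M[C]_(m, n)) i j : mxadj A i j = (A j i)^*.
Proof. by rewrite !mxE. Qed.

Lemma mxadjK m n (A : 'M[C]_(m, n)) : mxadj (mxadj A) = A.
Proof. by apply/matrixP => i j; rewrite !mxadjE conjcK. Qed.

Lemma unitary_mulV n (A : 'M[C]_n) : A \is unitarymx -> A *m mxadj A = 1%:M.
Proof.
by move=> /unitarymxP <-; congr (_ *m _); apply/matrixP => i j; rewrite mxadjE !mxE.
Qed.

Lemma unitary_Vmul n (A : 'M[C]_n) : A \is unitarymx -> mxadj A *m A = 1%:M.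
Proof. by move=> /unitary_mulV /mulmx1C. Qed.

(** The constant comes from iterating [csqD]; any bound depending only on [n] would serve. *)
Lemma csq_sum_le n (c : 'I_n -> C) : csq (\sum_i c i) <= 2%:R ^+ n * \sum_i csq (c i).
Proof.
elim: n c => [|n IH] c; first by rewrite !big_ord0 csq0 mulr0.
rewrite !big_ord_recl; apply: le_trans (csqD _ _) _.
rewrite exprS -mulrA ler_pM2l// mulrDr lerD// ler_peMl ?csq_ge0//.
by rewrite exprn_ege1// ler1n.
Qed.

Lemma vsq_mulmx_le m n (A : 'M[C]_(m, n)) (M : R) (x : 'cV[C]_n) :
  (forall i j, csq (A i j) <= M) -> vsq (A *m x) <= m%:R * 2%:R ^+ n * M * vsq x.
Proof.
move=> hA; rewrite /vsq.
apply: (@le_trans _ _ (\sum_(i < m) 2%:R ^+ n * M * vsq x)); last first.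
  by rewrite sumr_const card_ord -[X in X <= _]mulr_natl !mulrA.
apply: ler_sum => i _; rewrite mxE; apply: le_trans (csq_sum_le _) _.
rewrite -mulrA ler_pM2l ?exprn_gt0// mulr_sumr; apply: ler_sum => j _.
by rewrite csqM ler_wpM2r ?csq_ge0.
Qed.

(** Entrywise essential boundedness, stable under submatrices, products and adjoints. Both [Linf]
    functions and measurable unitary-valued functions have it. *)
Definition essbd m n (A : R -> 'M[C]_(m, n)) :=
  (forall i j, cmeas (fun t => A t i j)) /\
  exists M, \forall t \ae mu, forall i j, csq (A t i j) <= M.

Lemma essbd_adj m n (A : R -> 'M[C]_(m, n)) : essbd A -> essbd (fun t => mxadj (A t)).
Proof.
move=> [mA [M hM]]; split.
  by move=> i j; under eq_fun do rewrite mxadjE; exact: cmeasJ.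
by exists M; apply: aeS hM => t ht i j; rewrite mxadjE csqJ.
Qed.

Lemma essbd_tr m n (A : R -> 'M[C]_(m, n)) : essbd A -> essbd (fun t => (A t)^T).
Proof.
move=> [mA [M hM]]; split; first by move=> i j; under eq_fun do rewrite mxE.
by exists M; apply: aeS hM => t ht i j; rewrite mxE.
Qed.

Lemma cmeas_mulmx m n p (A : R -> 'M[C]_(m, n)) (B : R -> 'M[C]_(n, p)) :
  (forall i j, cmeas (fun t => A t i j)) -> (forall i j, cmeas (fun t => B t i j)) ->
  forall i j, cmeas (fun t => (A t *m B t) i j).
Proof.
move=> mA mB i j; under eq_fun do rewrite mxE.
by apply: cmeas_sum => k; exact: cmeasM.
Qed.

Lemma essbd_mul m n p (A : R -> 'M[C]_(m, n)) (B : R -> 'M[C]_(n, p)) :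
  essbd A -> essbd B -> essbd (fun t => A t *m B t).
Proof.
move=> [mA [M hM]] [mB [N hN]]; split; first exact: cmeas_mulmx.
exists (2%:R ^+ n * \sum_(k < n) `|M| * `|N|).
apply: aeS (aeI hM hN) => t [hA hB] i j; rewrite mxE.
apply: le_trans (csq_sum_le _) _; rewrite ler_pM2l ?exprn_gt0//; apply: ler_sum => k _.
rewrite csqM ler_pM ?csq_ge0//; apply: le_trans (ler_norm _); [exact: hA|exact: hB].
Qed.

Lemma essbd_ae m n (A B : R -> 'M[C]_(m, n)) : (forall i j, cmeas (fun t => A t i j)) ->
  essbd B -> (\forall t \ae mu, A t = B t) -> essbd A.
Proof.
move=> mA [mB [M hM]] AB; split=> //; exists M.
by apply: aeS (aeI hM AB) => t [h ->].
Qed.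

Lemma L2_mul m n (A : R -> 'M[C]_(m, n)) (f : R -> 'cV[C]_n) : essbd A -> L2 f ->
  L2 (fun t => A t *m f t).
Proof.
move=> [mA [M hM]] /L2P hf; apply/L2P => i; under eq_fun do rewrite mxE.
apply: L2s_sum => j; apply: (L2s_mul (M := M)) => //.
by apply: aeS hM => t.
Qed.

Lemma vsum_adj m n (A : 'M[C]_(m, n)) (x : 'cV[C]_n) (y : 'cV[C]_m) :
  \sum_i (A *m x) i 0 * (y i 0)^* = \sum_i x i 0 * ((mxadj A *m y) i 0)^*.
Proof.
under eq_bigr do rewrite mxE mulr_suml.
rewrite exchange_big; apply: eq_bigr => j _ /=.
rewrite mxE conj_sumc mulr_sumr; apply: eq_bigr => i _.
by rewrite conjMc mxadjE conjcK; ring.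
Qed.

Lemma ip_adj m n (A : R -> 'M[C]_(m, n)) (f : R -> 'cV[C]_n) (g : R -> 'cV[C]_m) :
  ip (fun t => A t *m f t) g = ip f (fun t => mxadj (A t) *m g t).
Proof. by congr cintegral; apply/funext => t; exact: vsum_adj. Qed.

Lemma vsq_unitary n (A : 'M[C]_n) (x : 'cV[C]_n) : A \is unitarymx -> vsq (A *m x) = vsq x.
Proof.
move=> /unitary_Vmul hA; apply: complexI; rewrite !vsq_adj vsum_adj.
by rewrite mulmxA hA mul1mx.
Qed.

Lemma unitary_bound n (A : 'M[C]_n) i j : A \is unitarymx -> csq (A i j) <= 1.
Proof.
move=> hA; have := vsq_unitary (delta_mx j 0 : 'cV_n) hA.
rewrite -colE => h.
have := vsq_le (col j A) i; rewrite mxE h /vsq (bigD1 j)//= big1.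
  by rewrite mxE !eqxx addr0 csq1.
by move=> k kj; rewrite mxE (negbTE kj) csq0.
Qed.

Lemma essbd_unitary n (A : R -> 'M[C]_n) : mxmeasurable A ->
  (\forall t \ae mu, A t \is unitarymx) -> essbd A.
Proof.
move=> /mxmeasurableP mA hA; split=> //; exists 1.
by apply: aeS hA => t h i j; exact: unitary_bound.
Qed.

(** A real supremum bounds its set only when the set is bounded above; the entries of [A] provide
    the bound. *)
Lemma mxopnorm_ub m n (A : 'M[C]_(m, n)) (x : 'cV[C]_n) : vnorm x <= 1 ->
  vnorm (A *m x) <= mxopnorm A.
Proof.
move=> hx; apply: ub_le_sup; last by exists x.
pose M := \sum_i \sum_j csq (A i j).
exists (Num.sqrt (m%:R * 2%:R ^+ n * M)) => _ [y hy <-].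
have hM i j : csq (A i j) <= M.
  rewrite /M (bigD1 i)//= (bigD1 j)//= -addrA lerDl addr_ge0 ?sumr_ge0//.
    by move=> *; exact: csq_ge0.
  by move=> *; apply: sumr_ge0 => *; exact: csq_ge0.
have M0 : 0 <= M by do 2!apply: sumr_ge0 => ? _; exact: csq_ge0.
have y1 : vsq y <= 1.
  by move: hy; rewrite /= vnormE => hy; rewrite -(sqr_sqrtr (vsq_ge0 y)) expr_le1// sqrtr_ge0.
rewrite vnormE ler_sqrt ?mulr_ge0 ?exprn_ge0//.
by apply: le_trans (vsq_mulmx_le _ hM) _; rewrite ler_piMr// !mulr_ge0 ?exprn_ge0.
Qed.

Lemma entry_le_mxopnorm m n (A : 'M[C]_(m, n)) i j : csq (A i j) <= mxopnorm A ^+ 2.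
Proof.
have h : vnorm (delta_mx j 0 : 'cV[C]_n) <= 1.
  rewrite vnormE /vsq (bigD1 j)//= big1.
    by rewrite mxE !eqxx addr0 csq1 sqrtr1.
  by move=> k kj; rewrite mxE (negbTE kj) csq0.
have := mxopnorm_ub A h; rewrite -colE vnormE => h1.
have := vsq_le (col j A) i; rewrite mxE => /le_trans; apply.
by rewrite -{1}(sqr_sqrtr (vsq_ge0 (col j A))) ler_pXn2r ?nnegrE ?sqrtr_ge0// (le_trans _ h1)// sqrtr_ge0.
Qed.

Lemma Linf_essbd m n (A : R -> 'M[C]_(m, n)) : Linf A -> essbd A.
Proof.
move=> [/mxmeasurableP mA lA]; split=> //.
have h := ess_sup_ge (@circ R) (fun t => (mxopnorm (A t))%:E).
rewrite -/(linfnorm A) in h.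
pose M := Num.max (fine (linfnorm A)) 0.
exists (M ^+ 2); apply: aeS h => t ht i j.
apply: le_trans (entry_le_mxopnorm _ i j) _.
have t0 : 0 <= mxopnorm (A t).
  have z0 : vnorm (0 : 'cV[C]_n) <= 1.
    by rewrite vnormE /vsq big1 ?sqrtr0// => k _; rewrite mxE csq0.
  by apply: le_trans (mxopnorm_ub (A t) z0); rewrite vnormE sqrtr_ge0.
have tM : mxopnorm (A t) <= M.
  rewrite le_max -lee_fin; move: lA ht; case: (linfnorm A) => [r||] //= _ ->//.
by rewrite ler_pXn2r ?nnegrE// (le_trans t0).
Qed.

Definition mulop m n (A : R -> 'M[C]_(m, n)) (hA : essbd A) (f : L2h n) : L2h m :=
  toL2 (L2_mul hA (L2tP f)).

Lemma L2h_lin n (a : C) (f g : L2h n) t : @L2fun R n (a *: f + g) t = a *: @L2fun R n f t + @L2fun R n g t.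
Proof. by rewrite (@L2t_add R n) (@L2t_scale R n). Qed.

Lemma L2h_scale n (a : C) (f : L2h n) t : @L2fun R n (a *: f) t = a *: @L2fun R n f t.
Proof. exact: (@L2t_scale R n). Qed.

Lemma L2h_sub n (f g : L2h n) t : @L2fun R n (f - g) t = @L2fun R n f t - @L2fun R n g t.
Proof. exact: (@L2t_sub R n). Qed.

Lemma L2h_sum n k (c : 'I_k -> C) (u : 'I_k -> L2h n) t :
  @L2fun R n (\sum_i c i *: u i) t = \sum_i c i *: @L2fun R n (u i) t.
Proof. exact: (@L2t_sum R n). Qed.

Lemma mulop_lin m n (A : R -> 'M[C]_(m, n)) (hA : essbd A) : lin (mulop hA).
Proof.
move=> a f g; apply: L2t_eq => t; rewrite L2h_lin.
by rewrite -[LHS]/(A t *m @L2fun R n (a *: f + g) t) L2h_lin mulmxDr scalemxAr.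
Qed.

Lemma hipE n (f g : L2h n) : hip f g = ip (@L2fun R n f) (@L2fun R n g).
Proof. by []. Qed.

Lemma nsq_int n (f : L2h n) : nsq f = \int[mu]_t vsq (f t).
Proof. by rewrite /nsq hipE ip_vsq. Qed.

Lemma Rint_le (g h : R -> R) : rint g -> rint h -> (forall t, 0 <= g t) -> (forall t, 0 <= h t) ->
  (\forall t \ae mu, g t <= h t) -> \int[mu]_t g t <= \int[mu]_t h t.
Proof.
move=> ig ih g0 h0 gh; rewrite -lee_fin !fineK ?(integrable_fin_num measurableT)//.
apply: ae_ge0_le_integral => //; try by move=> t _; rewrite lee_fin.
- by apply/measurable_EFinP; exact: rint_meas.
- by apply/measurable_EFinP; exact: rint_meas.
- by apply: aeS gh => t ? _; rewrite lee_fin.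
Qed.

Lemma mulop_bounded m n (A : R -> 'M[C]_(m, n)) (hA : essbd A) :
  exists2 L, 0 <= L & forall f, nrm (mulop hA f) <= L * nrm f.
Proof.
have [mA [M0 hM0]] := hA; pose M := `|M0|.
have hM : \forall t \ae mu, forall i j, csq (A t i j) <= M.
  by apply: aeS hM0 => t h i j; apply: le_trans (h i j) (ler_norm _).
pose K := m%:R * 2%:R ^+ n * M; have K0 : 0 <= K by rewrite /K !mulr_ge0 ?exprn_ge0 ?ler0n ?normr_ge0.
exists (Num.sqrt K); first exact: sqrtr_ge0.
move=> f; rewrite /nrm -sqrtrM// ler_sqrt ?(mulr_ge0 K0) ?nsq_ge0// (nsq_int (mulop hA f)) (nsq_int f).
have -> : K * \int[mu]_t vsq (f t) = \int[mu]_t (K * vsq (f t)).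
  by rewrite RintegralZl//; exact: (rint_vsq (L2tP f)).
apply: Rint_le.
- exact: (rint_vsq (L2tP (mulop hA f))).
- by apply: rintZ; exact: (rint_vsq (L2tP f)).
- by move=> t; exact: vsq_ge0.
- by move=> t; rewrite mulr_ge0 ?vsq_ge0.
- by apply: aeS hM => t h; exact: vsq_mulmx_le.
Qed.

Lemma nsq0_ae n (f : L2h n) : nsq f = 0 <-> \forall t \ae mu, f t = 0.
Proof.
rewrite nsq_int; split=> [h|h].
  have := Rint_eq0_ae (rint_vsq (L2tP f)) (fun t => vsq_ge0 (f t)) h.
  by apply: aeS => t /vsq_eq0.
rewrite -[RHS](_ : \int[mu]_t 0 = 0); last by rewrite Rintegral_cst// mul0r.
apply: Rint_ae; [by apply: rint_meas; exact: (rint_vsq (L2tP f))|exact: measurable_cst|].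
by apply: aeS h => t ->; rewrite /vsq big1// => i _; rewrite mxE csq0.
Qed.

Lemma l2norm_nrm n (f : L2h n) : l2norm (@L2fun R n f) = (@nrm R (L2h n) f)%:E.
Proof.
have i := rint_vsq (L2tP f).
rewrite l2norm_int -(fineK (integrable_fin_num measurableT i)) /=.
have i0 : 0 <= \int[mu]_t vsq (f t) by apply: Rintegral_ge0 => t _; exact: vsq_ge0.
by rewrite -[fine _]/(\int[mu]_t vsq (f t)) powR12_sqrt// /nrm (nsq_int f).
Qed.

End multiplication.

(** * Fourier coefficients *)

Section characters.
Context {R : realType}.
Local Notation C := R[i].
Local Notation mu := (@circ R).
Local Notation leb := (@lebesgue_measure R).
Local Notation I := (`[0%R, pi *+ 2]%classic : set R).

Lemma csq_z (t : R) : csq (z t) = 1.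
Proof. by rewrite /csq /= cos2Dsin2. Qed.

Lemma z_neq0 (t : R) : z t != 0.
Proof. by apply/eqP => h; have := csq_z t; rewrite h csq0 => /esym/eqP; rewrite oner_eq0. Qed.

Lemma zD (s t : R) : z (s + t) = z s * z t.
Proof. by rewrite /z cosD sinD; apply: complex_ext => /=; ring. Qed.

Lemma z0 : z 0 = 1 :> C.
Proof. by rewrite /z cos0 sin0. Qed.

Lemma conj_z (t : R) : (z t)^* = z (- t).
Proof. by rewrite /z cosN sinN. Qed.

Lemma z_inv (t : R) : (z t)^-1 = (z t)^*.
Proof.
apply: (mulfI (z_neq0 t)); rewrite divff ?z_neq0// conj_z -zD subrr.
by rewrite z0.
Qed.

Lemma zX (t : R) n : z t ^+ n = z (n%:R * t).
Proof.
elim: n => [|n IH]; first by rewrite mul0r z0.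
by rewrite exprS IH -zD -natr1 mulrDl mul1r addrC.
Qed.

Lemma zXz (t : R) (k : int) : z t ^ k = z (k%:~R * t).
Proof.
case: k => n; first exact: zX.
by rewrite NegzE -exprnN zX z_inv conj_z rmorphN /= mulNr.
Qed.

Lemma conj_zXz (t : R) (k : int) : (z t ^ k)^* = z t ^ (- k).
Proof. by rewrite !zXz conj_z rmorphN /= mulNr. Qed.

Lemma csq_zXz (t : R) (k : int) : csq (z t ^ k) = 1.
Proof. by rewrite zXz csq_z. Qed.

Lemma zXzD (t : R) (k l : int) : z t ^ (k + l) = z t ^ k * z t ^ l.
Proof. by rewrite expfzDr// z_neq0. Qed.

Lemma rmeas_continuous (g : R -> R) : continuous g -> rmeas g.
Proof. by move=> cg; exact: continuous_measurable_fun. Qed.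

Lemma continuous_cosM (c : R) : continuous (fun t => cos (c * t)).
Proof. by move=> t; apply: continuous_comp; [exact: mulrl_continuous|exact: continuous_cos]. Qed.

Lemma continuous_sinM (c : R) : continuous (fun t => sin (c * t)).
Proof. by move=> t; apply: continuous_comp; [exact: mulrl_continuous|exact: continuous_sin]. Qed.

Lemma cmeas_zXz (k : int) : cmeas (fun t : R => z t ^ k).
Proof.
under eq_fun do rewrite zXz; split; apply: rmeas_continuous.
  exact: continuous_cosM.
exact: continuous_sinM.
Qed.

Lemma cintg_mulb (phi f : R -> C) (M : R) : cmeas phi ->
  (\forall t \ae mu, csq (phi t) <= M) -> cintg f -> cintg (fun t => f t * phi t).
Proof.
move=> mphi hM jf; have [ia ib] := jf; have mf := cintg_meas jf.
pose h t := (1 + `|M|) * (`|complex.Re (f t)| + `|complex.Im (f t)|).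
apply: (cintg_le (cmeasM mf mphi) (h := h)).
- by apply: rintZ; apply: rintD; exact: integrable_norm.
- by move=> t; rewrite /h mulr_ge0 ?addr_ge0.
apply: aeS hM => t hM; rewrite csqM /h.
have h1 : csq (phi t) <= (1 + `|M|) ^+ 2.
  apply: (le_trans hM); apply: (le_trans (ler_norm _)); have := normr_ge0 M; nra.
have h2 : csq (f t) <= (`|complex.Re (f t)| + `|complex.Im (f t)|) ^+ 2.
  rewrite /csq -(real_normK (num_real (complex.Re _))) -(real_normK (num_real (complex.Im _))).
  have := normr_ge0 (complex.Re (f t)); have := normr_ge0 (complex.Im (f t)); nra.
by rewrite exprMn mulrC ler_pM ?csq_ge0.
Qed.

Lemma cintg_zXz (f : R -> C) (k : int) : cintg f -> cintg (fun t => f t * z t ^ k).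
Proof.
apply: (cintg_mulb (M := 1)) (cmeas_zXz k) _.
by apply: aeT => t; rewrite csq_zXz.
Qed.

Lemma L2s_zXz (k : int) : L2s (fun t : R => z t ^ k).
Proof.
split; first exact: cmeas_zXz.
by under eq_fun do rewrite csq_zXz; exact: rint_cst.
Qed.

(** Gives access to calculus on the interval. The density formula is applied to nonnegative
    functions, hence the splitting into positive and negative parts. *)
Lemma circ_leb (g : R -> R) : rint g -> leb.-integrable I (EFin \o g) /\
  \int[mu]_t g t = (pi *+ 2)^-1 * \int[leb]_(t in I) g t.
Proof.
move=> ig.
have pos (h : R -> \bar R) : measurable_fun [set: measurableTypeR R] h ->
    (forall t, (0 <= h t)%E) ->
    (\int[mu]_t h t = (pi *+ 2)^-1%:E * \int[leb]_(t in I) h t)%E.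
  by move=> mh h0; rewrite integral_uniform// subr0.
have mg := rint_meas ig.
have mge : measurable_fun [set: measurableTypeR R] (EFin \o g) by exact/measurable_EFinP.
have p2 : 0 < (pi *+ 2)^-1 :> R by rewrite invr_gt0 twopi_gt0.
have igl : leb.-integrable I (EFin \o g).
  apply/integrableP; split; first exact: measurable_funTS.
  move/integrableP: ig => [_]; rewrite pos//; last exact: measurableT_comp.
  by case: (\int[leb]_(t in I) _)%E => [r||] //=; rewrite ?ltry// gt0_muley ?lte_fin.
split=> //.
apply: EFin_inj; rewrite EFinM !fineK ?(integrable_fin_num _ igl)//; last first.
  exact: (integrable_fin_num measurableT ig).
have mI : measurable (I : set (measurableTypeR R)) by exact: measurable_itv.
rewrite [LHS](integralE mu setT (EFin \o g)) [X in (_ * X)%E](integralE leb I (EFin \o g)).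
rewrite (pos _ (measurable_funepos mge))// (pos _ (measurable_funeneg mge))//.
by rewrite [RHS]muleBr// fin_num_adde_defr// (integrable_pos_fin_num mI igl).
Qed.

Lemma int_trig (c : R) : c != 0 -> cos (c * (pi *+ 2)) = 1 -> sin (c * (pi *+ 2)) = 0 ->
  \int[leb]_(t in I) cos (c * t) = 0 /\ \int[leb]_(t in I) sin (c * t) = 0.
Proof.
move=> c0 hc hs.
have ftc (f F : R -> R) : continuous f -> (forall x, is_derive x (1:R) F (f x)) ->
    F (pi *+ 2) = F 0 -> \int[leb]_(t in I) f t = 0.
  move=> cf dF F0; rewrite /Rintegral (@continuous_FTC2 _ _ F) ?twopi_gt0//.
  - by rewrite F0 subee.
  - exact: continuous_subspaceT.
  - have cF x : F @ x --> F x.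
      by apply: differentiable_continuous; apply/derivable1_diffP; have [] := dF x.
    split; first by move=> x _; have [] := dF x.
      by apply: cvg_at_right_filter; exact: cF.
    by apply: cvg_at_left_filter; exact: cF.
  - by move=> x _; rewrite derive1E; have [] := dF x.
split; [apply: (ftc _ (fun t => c^-1 * sin (c * t)))|apply: (ftc _ (fun t => - (c^-1 * cos (c * t))))].
- exact: continuous_cosM.
- move=> x; apply: is_derive_eq; rewrite /GRing.scale /= mulr1.
  by field.
- by rewrite hs [c * 0]mulr0 sin0.
- exact: continuous_sinM.
- move=> x; apply: is_derive_eq; rewrite /GRing.scale /= mulr1.
  by field.
- by rewrite hc mulr0 cos0.
Qed.

End characters.

(** * An integrable function is determined by its Fourier coefficients *)

Section uniqueness.
Context {R : realType}.
Local Notation C := R[i].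
Local Notation mu := (@circ R).
Local Notation leb := (@lebesgue_measure R).
Local Notation I := (`[0%R, pi *+ 2]%classic : set R).

Lemma int_zXz (k : int) : k != 0 -> cintegral (fun t : R => z t ^ k) = 0.
Proof.
move=> k0.
have z2 : z (k%:~R * (pi *+ 2)) = 1 :> C.
  by rewrite -zXz /z cos2pi sin2pi exp1rz.
have [//|h1 h2] := @int_trig R k%:~R _ (congr1 (@complex.Re R) z2) (congr1 (@complex.Im R) z2).
  by rewrite intr_eq0.
have -> : (fun t : R => z t ^ k) = (fun t => z (k%:~R * t)).
  by apply/funext => t; rewrite zXz.
have [i1 i2] : cintg (fun t : R => z (k%:~R * t)).
  have -> : (fun t : R => z (k%:~R * t)) = (fun t => z t ^ k).
    by apply/funext => t; rewrite zXz.
  exact: L2s_cintg (L2s_zXz k).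
rewrite /cintegral; have [_ ->] := circ_leb i1; have [_ ->] := circ_leb i2.
by rewrite /= h1 h2 !mulr0.
Qed.

(** Trigonometric polynomials; the factor [z^-N] supplies the negative frequencies. *)
Definition trig (phi : R -> C) :=
  exists N (p : {poly C}), forall t, phi t = z t ^ (- N%:Z) * p.[z t].

Lemma trig_cst (c : C) : trig (fun=> c).
Proof. by exists 0%N, c%:P => t; rewrite hornerC expr0z mul1r. Qed.

Lemma trigM phi psi : trig phi -> trig psi -> trig (fun t => phi t * psi t).
Proof.
move=> [N [p hp]] [M [q hq]]; exists (N + M)%N, (p * q) => t.
by rewrite hp hq hornerM PoszD opprD zXzD; ring.
Qed.

Lemma trigD phi psi : trig phi -> trig psi -> trig (fun t => phi t + psi t).
Proof.
move=> [N [p hp]] [M [q hq]]; exists (N + M)%N, ('X^M * p + 'X^N * q) => t.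
rewrite hp hq hornerD !hornerM !hornerXn PoszD opprD zXzD.
have hN : z t ^ (- N%:Z) * z t ^+ N = 1 by rewrite -[z t ^+ N]/(z t ^ N%:Z) -zXzD addNr expr0z.
have hM : z t ^ (- M%:Z) * z t ^+ M = 1 by rewrite -[z t ^+ M]/(z t ^ M%:Z) -zXzD addNr expr0z.
transitivity (z t ^ (- N%:Z) * p.[z t] * (z t ^ (- M%:Z) * z t ^+ M) +
  z t ^ (- M%:Z) * q.[z t] * (z t ^ (- N%:Z) * z t ^+ N)); last by ring.
by rewrite hN hM !mulr1.
Qed.

Lemma trigX phi n : trig phi -> trig (fun t => phi t ^+ n).
Proof.
move=> h; elim: n => [|n IH]; first exact: (trig_cst 1).
by under eq_fun do rewrite exprS; exact: trigM.
Qed.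

Lemma trig_cos (c : R) : trig (fun t => (cos (t - c))%:C).
Proof.
exists 1%N, ((z (- c) / 2%:R)%:P * 'X^2 + (z c / 2%:R)%:P) => t.
rewrite hornerD hornerM !hornerC hornerXn.
have -> : z t ^ (- 1%:Z) = (z t)^* by rewrite -conj_zXz.
have e : z t * (z t)^* = 1 by rewrite -csqE csq_z.
transitivity ((z (t - c) + (z (t - c))^*) / 2%:R).
  by rewrite addcJ mulrAC divff ?mul1r// pnatr_eq0.
rewrite conj_z opprB [c - t]addrC !zD -(conj_z t).
transitivity ((z t * (z t)^*) * (z (-c) * z t) / 2%:R + (z t)^* * z c / 2%:R); last by ring.
by rewrite e mul1r; ring.
Qed.

Lemma trig_cmeas phi : trig phi -> cmeas phi.
Proof.
move=> [N [p hp]]; rewrite (_ : phi = fun t => \sum_(i < size p) z t ^ (- N%:Z) * (p`_i * z t ^ i%:Z)).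
  apply: cmeas_sum => i; apply: cmeasM; first exact: cmeas_zXz.
  by apply: cmeasM; [exact: cmeas_cst|exact: cmeas_zXz].
by apply/funext => t; rewrite hp horner_coef mulr_sumr.
Qed.

Lemma trig_int f phi : cintg f -> (forall k, fourier f k = 0) -> trig phi ->
  cintegral (fun t => f t * phi t) = 0.
Proof.
move=> jf f0 [N [p hp]].
have -> : (fun t => f t * phi t) =
    fun t => \sum_(i < size p) p`_i * (f t * z t ^ (- (N%:Z - i%:Z))).
  apply/funext => t; rewrite hp horner_coef !mulr_sumr; apply: eq_bigr => i _.
  rewrite opprB addrC zXzD -[z t ^+ i]/(z t ^ i%:Z); ring.
rewrite cintegral_sum; last by move=> i; apply: cintgZ; exact: cintg_zXz.
rewrite big1// => i _; rewrite cintegralZ; last exact: cintg_zXz.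
by rewrite -/(fourier f _) f0 mulr0.
Qed.

Lemma bernoulli_ge (x : R) n : 0 <= x <= 1 -> 1 - n%:R * x <= (1 - x) ^+ n.
Proof.
move=> /andP[x0 x1]; elim: n => [|n IH]; first by rewrite mul0r subr0.
rewrite exprS -natr1; have : (1 - x) * (1 - n%:R * x) <= (1 - x) * (1 - x) ^+ n.
  by rewrite ler_wpM2l// subr_ge0.
have : 0 <= n%:R * x ^+ 2 by rewrite mulr_ge0// sqr_ge0.
move: (n%:R) => m; nra.
Qed.

Lemma bernoulli_le (x : R) n : 0 <= x -> 1 + n%:R * x <= (1 + x) ^+ n.
Proof.
move=> x0; elim: n => [|n IH]; first by rewrite mul0r addr0.
rewrite exprS -natr1; have : (1 + x) * (1 + n%:R * x) <= (1 + x) * (1 + x) ^+ n.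
  by rewrite ler_wpM2l// addr_ge0.
have : 0 <= n%:R * x ^+ 2 by rewrite mulr_ge0// sqr_ge0.
move: (n%:R) => m; nra.
Qed.

(** Polynomials converging on [[0, 1]] to the indicator of [x < 1/2]. The familiar choice is
    [(1 - x^n)^(2^n)], which tends to [1/e] at [x = 1/2]; the extra factor [n] in the exponent makes
    that limit [0]. *)
Definition bump (n : nat) (x : R) : R := (1 - x ^+ n) ^+ (n * 2 ^ n).

Lemma bump_ge0 n x : 0 <= x <= 1 -> 0 <= bump n x <= 1.
Proof.
move=> /andP[x0 x1].
have xn0 : 0 <= x ^+ n by rewrite exprn_ge0.
have xn1 : x ^+ n <= 1 by rewrite exprn_ile1.
have a0 : 0 <= 1 - x ^+ n by rewrite subr_ge0.
have a1 : 1 - x ^+ n <= 1 by rewrite lerBlDr lerDl.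
by rewrite /bump exprn_ge0// exprn_ile1.
Qed.

(** For [s] the square root of [y], Bernoulli bounds [n s^n] by a constant [K], and
    [n y^n = (n s^n) s^n <= K s^n]. *)
Lemma natr_expr_cvg0 (y : R) : 0 <= y < 1 -> n%:R * y ^+ n @[n --> \oo] --> (0 : R).
Proof.
move=> /andP[y0 y1].
have [->|yn0] := eqVneq y 0.
  apply: (@cvg_trans _ (cst 0 @ \oo)); last exact: cvg_cst.
  by apply: near_eq_cvg; near=> n; rewrite expr0n gtn_eqF ?mulr0//; near: n; exact: nbhs_infty_gt.
have yp : 0 < y by rewrite lt_neqAle eq_sym yn0.
pose s := Num.sqrt y.
have s0 : 0 < s by rewrite sqrtr_gt0.
have s1 : s < 1 by rewrite -sqrtr1 ltr_sqrt.
have sE : s ^+ 2 = y by rewrite sqr_sqrtr.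
pose K := (s^-1 - 1)^-1.
have d0 : 0 < s^-1 - 1 by rewrite subr_gt0 invf_gt1.
have hK n : n%:R * s ^+ n <= K.
  have sn0 : 0 < s ^+ n by rewrite exprn_gt0.
  have := @bernoulli_le (s^-1 - 1) n (ltW d0).
  rewrite subrKC exprVn => h.
  have := ler_wpM2r (ltW sn0) h; rewrite mulVf ?gt_eqF// => {}h.
  rewrite /K -(ler_pM2r d0) mulVf ?gt_eqF//; have := ltW sn0; lra.
apply: (@squeeze_cvgr _ _ _ _ (fun=> 0) (fun n => K * s ^+ n)).
- near=> n; rewrite mulr_ge0 ?exprn_ge0//= -sE -exprM mul2n -addnn exprD mulrA.
  by rewrite ler_wpM2r// exprn_ge0// ltW.
- exact: cvg_cst.
- rewrite -[X in _ --> X](mulr0 K); apply: cvgM; first exact: cvg_cst.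
  by apply: cvg_expr; rewrite ger0_norm ?ltW.
Unshelve. all: by end_near. Qed.

(** Below [1/2], Bernoulli gives [1 - n (2x)^n] as a lower bound. From [1/2] on, the product of
    [bump n x] with [(1 + x^n)^(n 2^n)] is at most [1], while the second factor is at least
    [1 + n (2x)^n >= n + 1]. *)
Lemma bump_cvg (x : R) : 0 <= x <= 1 -> bump n x @[n --> \oo] --> ((x < 2^-1)%R%:R : R).
Proof.
move=> x01; have /andP[x0 x1] := x01.
have eE n : (n * 2 ^ n)%:R * x ^+ n = n%:R * (2 * x) ^+ n.
  by rewrite natrM natrX exprMn mulrA.
case: ltP => hx.
  apply: (@squeeze_cvgr _ _ _ _ (fun n => 1 - n%:R * (2 * x) ^+ n) (fun=> 1)).
  - near=> n; have /andP[_ ->] := bump_ge0 n x01; rewrite andbT -eE.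
    by apply: bernoulli_ge; rewrite exprn_ge0// exprn_ile1.
  - rewrite -[X in _ --> X]subr0; apply: cvgB; first exact: cvg_cst.
    apply: natr_expr_cvg0; rewrite mulr_ge0//=.
    lra.
  - exact: cvg_cst.
apply: (@squeeze_cvgr _ _ _ _ (fun=> 0) (fun n => (n.+1%:R)^-1)).
- near=> n; have /andP[-> _] /= := bump_ge0 n x01.
  have h1 : 1 <= 2 * x by lra.
  have xn : 0 <= x ^+ n by rewrite exprn_ge0.
  have h2 : n.+1%:R <= (1 + x ^+ n) ^+ (n * 2 ^ n).
    apply: le_trans (bernoulli_le _ xn); rewrite eE -natr1 addrC lerD2l.
    by rewrite ler_peMr// exprn_ege1.
  have n0 : 0 < n.+1%:R :> R by [].
  have p0 : 0 < (1 + x ^+ n) ^+ (n * 2 ^ n) by rewrite exprn_gt0// ltr_wpDr.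
  rewrite -[leRHS]mul1r ler_pdivlMr//.
  apply: (@le_trans _ _ (bump n x * (1 + x ^+ n) ^+ (n * 2 ^ n))).
    by rewrite ler_wpM2l//; have /andP[] := bump_ge0 n x01.
  rewrite /bump -exprMn -subr_sqr expr1n.
  have a0 : 0 <= (x ^+ n) ^+ 2 by rewrite sqr_ge0.
  have a1 : (x ^+ n) ^+ 2 <= 1 by rewrite -exprM exprn_ile1.
  have b0 : 0 <= 1 - (x ^+ n) ^+ 2 by rewrite subr_ge0.
  have b1 : 1 - (x ^+ n) ^+ 2 <= 1 by rewrite lerBlDr lerDl.
  by rewrite exprn_ile1.
- exact: cvg_cst.
- exact: cvg_harmonic.
Unshelve. all: by end_near. Qed.

(** An arc is a superlevel set of the cosine centred at its midpoint. For angles beyond [pi],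
    reflection at [pi] reduces to the interval where the cosine decreases. *)
Lemma cos_arc (x t : R) : 0 < x < pi *+ 2 -> 0 <= t <= pi *+ 2 ->
  (cos (x / 2) < cos (t - x / 2)) = (0 < t < x).
Proof.
move=> /andP[x0 x2] /andP[t0 t2].
have c0 : x / 2 \in `[0, pi] by rewrite in_itv /=; apply/andP; split; lra.
have key u : 0 <= u <= pi -> (cos (x / 2) < cos u) = (u < x / 2).
  by move=> h; rewrite ltr_cos// in_itv.
have [tx|tx] := ltP t x; last first.
  rewrite andbF; have [h|h] := leP (t - x / 2) pi.
    rewrite key; last by apply/andP; split; lra.
    by apply/negbTE; rewrite -leNgt; lra.
  have -> : cos (t - x / 2) = cos (pi *+ 2 - (t - x / 2)).
    by rewrite -cosN opprB -(cosD2pi) [_ + pi *+ 2]addrC.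
  rewrite key; last by apply/andP; split; lra.
  by apply/negbTE; rewrite -leNgt; lra.
rewrite andbT -[cos (t - _)]cos_norm key; last first.
  rewrite normr_ge0 ler_norml; apply/andP; split; lra.
rewrite ltr_norml; apply/andP/idP; first by case; lra.
by move=> h; split; lra.
Qed.

Lemma trig_ext phi psi : trig phi -> (forall t, psi t = phi t) -> trig psi.
Proof. by move=> [N [p hp]] h; exists N, p => t; rewrite h hp. Qed.

Section real_part.
Variable g : R -> R.
Hypotheses (ig : rint g)
  (gtrig : forall psi : R -> R, trig (fun t => (psi t)%:C) -> \int[mu]_t (g t * psi t) = 0).

(** The indicator of the arc is a bounded pointwise limit of trigonometric polynomials, namely
    [bump n] composed with one of them. *)
Lemma int_initial_arc (x : R) : 0 < x < pi *+ 2 -> \int[leb]_(t in `[0, x]) g t = 0.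
Proof.
(* By [cos_arc], [y t < 1/2] exactly on the open arc. The difference of cosines is at most [2] in
   absolute value, so dividing by [4] keeps [y] in [[0, 1]]. *)
move=> x02; pose y t := 2^-1 - (cos (t - x / 2) - cos (x / 2)) / 4.
have y01 t : 0 <= y t <= 1.
  have := cos_geN1 (t - x / 2); have := cos_le1 (t - x / 2).
  have := cos_geN1 (x / 2); have := cos_le1 (x / 2).
  by rewrite /y => ? ? ? ?; apply/andP; split; lra.
have ty : trig (fun t => (y t)%:C).
  have h := trigD (trig_cst (2^-1 + cos (x / 2) / 4)%:C) (trigM (trig_cst (- 4^-1)%:C) (trig_cos (x / 2))).
  apply: (trig_ext h) => t; rewrite -rmorphM -rmorphD /y; congr (_%:C); rewrite /=; lra.
have tb n : trig (fun t => (bump n (y t))%:C).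
  have h := trigX (n * 2 ^ n) (trigD (trig_cst 1) (trigM (trig_cst (-1)) (trigX n ty))).
  by apply: (trig_ext h) => t; rewrite /bump mulN1r rmorphXn rmorphB rmorph1 rmorphXn.
have mb n : rmeas (fun t => bump n (y t)) by have [] := trig_cmeas (tb n).
have my : rmeas y by have [] := trig_cmeas ty.
pose ind t : R := (y t < 2^-1)%R%:R.
have gn n : \int[mu]_t (g t * bump n (y t)) = 0 by exact: gtrig.
have mg := rint_meas ig.
have mind : rmeas ind.
  have -> : ind = \1_[set t | y t < 2^-1].
    apply/funext => t; rewrite indicE /ind; congr (nat_of_bool _)%:R.
    by apply/idP/idP; rewrite inE.
  apply: measurable_indic.
  have -> : [set t | y t < 2^-1] = (y : measurableTypeR R -> R) @^-1` `]-oo, 2^-1[.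
    by apply/seteqP; split=> t /=; rewrite in_itv.
  rewrite -[X in measurable X]setTI; exact: my.
have iind : rint (fun t => g t * ind t).
  apply: (rint_le _ (integrable_norm ig)); first exact: measurable_funM.
  apply: aeT => t; rewrite normrM ler_piMr// /ind; case: (_ < _)%R; rewrite ?normr1 ?normr0 ?ler01//.
(* Dominated convergence, with [|g|] as the dominating function. *)
have h0 : \int[mu]_t (g t * ind t) = 0.
  have mn n : measurable_fun [set: measurableTypeR R] (fun t => (g t * bump n (y t))%:E).
    by apply/measurable_EFinP; exact: (measurable_funM mg (mb n)).
  have mi : measurable_fun [set: measurableTypeR R] (fun t => (g t * ind t)%:E).
    by apply/measurable_EFinP; exact: (measurable_funM mg mind).
  have cv : {ae mu, forall t, setT t ->
      (fun n => (g t * bump n (y t))%:E) @ \oo --> (g t * ind t)%:E}.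
    apply: aeT => t _; apply: cvg_EFin; first exact: nearW.
    by apply: cvgM; [exact: cvg_cst|exact: bump_cvg].
  have dom : {ae mu, forall t n, setT t -> (`|(g t * bump n (y t))%:E| <= `|g t|%:E)%E}.
    apply: aeT => t n _; rewrite lee_fin normrM ler_piMr//.
    by have /andP[b0 b1] := bump_ge0 n (y01 t); rewrite ger0_norm.
  have [_ _ h] := dominated_convergence measurableT mn mi cv (integrable_norm ig) dom.
  move: h; set u := [sequence _]_n.
  have -> : u = (fun=> 0%E).
    apply/funext => n; rewrite /u /= -[LHS]fineK.
      by rewrite -[fine _]/(\int[mu]_t (g t * bump n (y t))) gn.
    apply: integrable_fin_num => //.
    apply: (rint_le (h := fun t => `|g t|)); first exact: (measurable_funM mg (mb n)).
      exact: (integrable_norm ig).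
    apply: aeT => t; rewrite normrM ler_piMr//.
    by have /andP[b0 b1] := bump_ge0 n (y01 t); rewrite ger0_norm.
  move=> /(cvg_lim (@ereal_hausdorff R)); rewrite lim_cst; last exact: ereal_hausdorff.
  by rewrite /Rintegral => <-.
have [iindl] := circ_leb iind; rewrite h0 => /esym/eqP.
rewrite mulf_eq0 invr_eq0 gt_eqF ?twopi_gt0//= => /eqP h1.
have xE t : t \in I -> ind t = (0 < t < x)%R%:R.
  rewrite inE /= in_itv /= => /andP[t0 t2]; rewrite /ind -cos_arc//; last by rewrite t0.
  by rewrite /y; congr (nat_of_bool _)%:R; apply/idP/idP; lra.
have [igl _] := circ_leb ig.
have sub (s : interval R) : [set` s] `<=` I -> leb.-integrable [set` s] (EFin \o g).
  move=> sI; apply: (@integrableS _ (measurableTypeR R) _ leb I) igl => //; exact: measurable_itv.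
have /andP[x0 x2] := x02.
rewrite -Rintegral_itv_bndo_bndc; last first.
  by apply: sub => t /=; rewrite !in_itv /= => /andP[-> h]; exact: ltW (lt_trans h x2).
rewrite -Rintegral_itv_obnd_cbnd; last first.
  by apply: sub => t /=; rewrite !in_itv /= => /andP[h h']; rewrite (ltW h) (ltW (lt_trans h' x2)).
rewrite -[RHS]h1 Rintegral_mkcond [RHS]Rintegral_mkcond; apply: eq_Rintegral => t _.
rewrite /patch; case: ifPn => tx.
  have tI : t \in I.
    by move: tx; rewrite !inE /= !in_itv /= => /andP[h h']; rewrite (ltW h) (ltW (lt_trans h' x2)).
  by rewrite tI xE//; move: tx; rewrite inE /= in_itv /= => ->; rewrite mulr1.
case: ifPn => // tI; rewrite xE//; move: tx; rewrite notin_setE /= in_itv /= => /negP/negbTE ->.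
by rewrite mulr0.
Qed.

(** The primitive of [g] vanishes on the open interval, and by Lebesgue differentiation its
    derivative is [g] a.e. *)
Lemma real_unique : \forall t \ae mu, g t = 0.
Proof.
have [igl _] := circ_leb ig.
have mI : measurable (I : set (measurableTypeR R)) by exact: measurable_itv.
(* Extension by zero, since the differentiation theorem is applied on the whole line. *)
pose G := g \_ I.
have iG : leb.-integrable setT (EFin \o G).
  by rewrite /G -restrict_EFin; apply/(integrable_mkcond _ mI).
have iGy y : leb.-integrable [set` Interval (BLeft 0) (BRight y)] (EFin \o G).
  by apply: (@integrableS _ (measurableTypeR R) _ leb setT) iG => //; exact: measurable_itv.
have ftc := @FTC1 R G (BLeft 0) iGy (open_integrable_locally openT iG).
have F0 x : 0 < x < pi *+ 2 -> \int[leb]_(t in [set` Interval (BLeft 0) (BRight x)]) G t = 0.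
  move=> x02; rewrite -[RHS](int_initial_arc x02); apply: eq_Rintegral => t.
  rewrite inE /= in_itv /= => /andP[t0 tx]; rewrite /G patchE mem_set//=.
  by rewrite in_itv /= t0 (le_trans tx)//; case/andP: x02 => _ /ltW.
have aeG : {ae leb, forall x, 0 < x < pi *+ 2 -> g x = 0}.
  have [N [mN N0 hN]] := ftc; exists N; split => // x; apply: contraPP => Nx.
  apply; apply: contrapT => h; apply: Nx; apply: hN => /= h'; apply: h => x02.
  have /andP[x0 x2] := x02.
  have [|_] := h' _; first by rewrite lte_fin.
  rewrite /G patchE mem_set/=; last by rewrite in_itv /= !ltW.
  move=> <-; rewrite derive1E.
  rewrite (@near_eq_derive _ _ _ _ (cst 0)) ?derive_cst//.
  near=> y; apply: F0; near: y.
  have := @near_in_itvoo R 0 (pi *+ 2) x; rewrite in_itv /= => /(_ x02).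
  by apply: filterS => y; rewrite in_itv.
have ina := integrable_norm ig.
apply: aeS (Rint_eq0_ae ina (fun t => normr_ge0 (g t)) _) => [t /eqP|].
  by rewrite normr_eq0 => /eqP.
have [inal ->] := circ_leb ina.
rewrite [X in _ * X](_ : _ = 0) ?mulr0//.
have sub (s : interval R) : [set` s] `<=` I -> leb.-integrable [set` s] (EFin \o (fun t => `|g t|)).
  move=> sI; apply: (@integrableS _ (measurableTypeR R) _ leb I) inal => //; exact: measurable_itv.
(* [aeG] speaks of the open interval, so both endpoints are removed from the domain of
   integration. *)
rewrite -Rintegral_itv_bndo_bndc; last first.
  by apply: sub => t /=; rewrite !in_itv /= => /andP[-> /ltW].
rewrite -Rintegral_itv_obnd_cbnd; last first.
  by apply: sub => t /=; rewrite !in_itv /= => /andP[/ltW -> /ltW].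
rewrite /Rintegral (@ae_eq_integral_abs _ _ _ leb _ (measurable_itv _) (EFin \o g) _).2//.
  apply: (measurable_funS mI); last exact: measurable_int igl.
  by move=> t /=; rewrite !in_itv /= => /andP[/ltW -> /ltW].
have [N [mN N0 hN]] := aeG; exists N; split => // x; apply: contraPP => Nx; apply.
apply: contrapT => h; apply: Nx; apply: hN => /= h'; apply: h; rewrite /= in_itv /= => x02.
by rewrite h'.
Unshelve. all: by end_near. Qed.

End real_part.

(** Integrability suffices, which matters because the function it serves in [unimodular_perp] is a
    product of two square integrable ones. Real test functions separate the real and imaginary
    parts. *)
Theorem fourier_unique (f : R -> C) : cintg f -> (forall k, fourier f k = 0) ->
  \forall t \ae mu, f t = 0.
Proof.
move=> jf f0; have [iRe iIm] := jf.
have h psi : trig (fun t => (psi t)%:C) ->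
    \int[mu]_t (complex.Re (f t) * psi t) = 0 /\ \int[mu]_t (complex.Im (f t) * psi t) = 0.
  move=> tpsi; have := trig_int jf f0 tpsi; rewrite /cintegral => /eqP.
  rewrite eq_complex /= => /andP[/eqP h1 /eqP h2]; split.
    by rewrite -[RHS]h1; apply: eq_Rintegral => t _; case: (f t) => a b /=; rewrite mulr0 subr0.
  by rewrite -[RHS]h2; apply: eq_Rintegral => t _; case: (f t) => a b /=; rewrite mulr0 add0r.
have h1 := real_unique iRe (fun psi tpsi => (h psi tpsi).1).
have h2 := real_unique iIm (fun psi tpsi => (h psi tpsi).2).
by apply: aeS (aeI h1 h2) => t [e1 e2]; apply: complex_ext.
Qed.

End uniqueness.

(** * Hardy spaces *)

Section hardy.
Context {R : realType}.
Local Notation C := R[i].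
Local Notation mu := (@circ R).

Definition H2s (f : R -> C) := L2s f /\ forall k : int, k < 0 -> fourier f k = 0.

Lemma H2P n (f : R -> 'cV[C]_n) : H2 f <-> forall i, H2s (fun t => f t i 0).
Proof.
split=> [[/L2P h1 h2] i|h]; first by split=> // k k0; exact: h2.
by split; [apply/L2P => i; have [] := h i|move=> i; have [] := h i].
Qed.

Lemma H2_scal (f : R -> C) : H2 (scal f) <-> H2s f.
Proof.
have e (i : 'I_1) : (fun t => scal f t i 0) = f by apply/funext => t; rewrite ord1 mxE.
by split=> [/H2P /(_ 0)|h]; [rewrite e|apply/H2P => i; rewrite e].
Qed.

Lemma fourier_ae (f g : R -> C) k : cintg f -> cintg g -> (\forall t \ae mu, f t = g t) ->
  fourier f k = fourier g k.
Proof.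
move=> jf jg fg; apply: cintegral_ae; try by apply: cintg_meas; exact: cintg_zXz.
by apply: aeS fg => t ->.
Qed.

Lemma H2s_ae (f g : R -> C) : cmeas f -> H2s g -> (\forall t \ae mu, f t = g t) -> H2s f.
Proof.
move=> mf [lg hg] fg; have lf : L2s f by exact: L2s_ae fg.
by split=> // k k0; rewrite (fourier_ae k _ _ fg) ?hg//; exact: L2s_cintg.
Qed.

Lemma H2_ae n (f g : R -> 'cV[C]_n) : mxmeasurable f -> H2 g ->
  (\forall t \ae mu, f t = g t) -> H2 f.
Proof.
move=> /mxmeasurableP mf /H2P hg fg; apply/H2P => i; apply: (H2s_ae _ (hg i)) => //.
by apply: aeS fg => t ->.
Qed.

Lemma H2s_zX k : H2s (fun t => z t ^ k%:Z).
Proof.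
split=> [|l l0]; first exact: L2s_zXz.
rewrite /fourier; under [X in cintegral X]eq_fun do rewrite -zXzD.
by rewrite int_zXz// gt_eqF// ltr_wpDl// oppr_gt0.
Qed.

Definition zdelta n (i : 'I_n) (k : int) : R -> 'cV[C]_n :=
  fun t => z t ^ k *: delta_mx i 0.

Lemma zdeltaE n (i j : 'I_n) k t : zdelta i k t j 0 = (j == i)%:R * z t ^ k.
Proof. by rewrite !mxE eqxx andbT mulrC. Qed.

Lemma L2_zdelta n (i : 'I_n) k : L2 (zdelta i k).
Proof.
apply/L2P => j; under eq_fun do rewrite zdeltaE; apply: L2sZ; exact: L2s_zXz.
Qed.

Lemma H2_zdelta n (i : 'I_n) (k : nat) : H2 (zdelta i k).
Proof.
apply/H2P => j; under eq_fun do rewrite zdeltaE.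
split=> [|l l0]; first by apply: L2sZ; exact: L2s_zXz.
rewrite /fourier; under [X in cintegral X]eq_fun do rewrite -mulrA.
have [h1 h2] := H2s_zX k; rewrite cintegralZ; last by apply: cintg_zXz; exact: L2s_cintg.
by rewrite -/(fourier _ _) h2// mulr0.
Qed.

Lemma ip_conjcE n (f g : R -> 'cV[C]_n) :
  ip f g = cintegral (fun t => \sum_i f t i 0 * conjc (g t i 0)).
Proof. by []. Qed.

Lemma ip_zdelta n (f : R -> 'cV[C]_n) (i : 'I_n) k :
  ip f (zdelta i k) = fourier (fun t => f t i 0) k.
Proof.
rewrite ip_conjcE; congr cintegral; apply/funext => t; rewrite (bigD1 i)//= big1 ?addr0.
  by rewrite zdeltaE eqxx mul1r -conj_zXz.
move=> j ji; have -> : zdelta i k t j 0 = 0 by rewrite zdeltaE (negbTE ji) mul0r.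
by rewrite conjc0 mulr0.
Qed.

Lemma L2_unique n (f : R -> 'cV[C]_n) : L2 f ->
  (forall i k, fourier (fun t => f t i 0) k = 0) -> \forall t \ae mu, f t = 0.
Proof.
move=> /L2P hf h.
have : \forall t \ae mu, forall i, f t i 0 = 0.
  by apply: ae_fin => i; apply: fourier_unique => // ; exact: L2s_cintg.
by apply: aeS => t ht; apply/matrixP => i j; rewrite ord1 mxE.
Qed.

Definition H2h n : set (L2h n) := [set f | H2 (@L2fun R n f)].
Arguments H2h n : clear implicits.

Lemma closed_ext (H : hilbert R) (A B : set H) : A = B -> closed_sp A -> closed_sp B.
Proof. by move=> ->. Qed.

Lemma closed_setI (H : hilbert R) (A B : set H) :
  closed_sp A -> closed_sp B -> closed_sp (A `&` B).
Proof.
move=> [[A0 sA] cA] [[B0 sB] cB]; split; first split=> //.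
  by move=> a x y [? ?] [? ?]; split; [exact: sA|exact: sB].
by move=> x h; split; [apply: cA|apply: cB] => e e0; have [y [? ?] ?] := h e e0; exists y.
Qed.

(** [H2] is the orthogonal complement of the exponentials of negative frequency. *)
Lemma closed_H2h n : closed_sp (H2h n).
Proof.
apply: (closed_ext _ (closed_perp
  [set f : L2h n | exists i k, k < 0 /\ f = toL2 (L2_zdelta i k)])).
apply/seteqP; split=> f /= h.
  split=> [|i k k0]; first exact: L2tP.
  rewrite -ip_zdelta; apply: (h (toL2 (L2_zdelta i k))); by exists i, k.
move=> _ [i [k [k0 ->]]]; rewrite -[LHS]/(ip (@L2fun R n f) (zdelta i k)) ip_zdelta.
by have [_] := h; apply.
Qed.

(* The projection of [w] onto [H2] has no nonzero Fourier coefficient. *)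
Lemma H2_perp n (w f : R -> 'cV[C]_n) : L2 w ->
  (forall i (k : nat), fourier (fun t => w t i 0) k = 0) -> H2 f -> ip w f = 0.
Proof.
move=> lw hw hf; have lf : L2 f by case: hf.
pose w' : L2h n := toL2 lw; pose p := proj (H2h n) w'.
have [Hp hp] := projP w' (closed_H2h n).
have wp e : H2h n e -> hip w' e = hip p e.
  by move=> He; apply/eqP; rewrite -subr_eq0 -ipBl; apply/eqP; exact: hp.
have p0 : \forall t \ae mu, @L2fun R n p t = 0.
  apply: L2_unique => [|i k]; first exact: L2tP.
  have [k0|k0] := ltP k 0; first by have [_] := Hp; apply.
  case: k k0 => // k _.
  have e1 : ip w (zdelta i k) = ip (@L2fun R n p) (zdelta i k).
    by apply: (wp (toL2 (L2_zdelta i k))); exact: H2_zdelta.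
  by rewrite -ip_zdelta -e1 ip_zdelta hw.
rewrite -[LHS](hipE w' (toL2 lf)) (wp (toL2 lf) hf); apply: ip_eq0C; apply: ip_null.
by apply/nsq0_ae.
Qed.

(** The conjugate of [g z^(l+1)] has only negative frequencies, hence is orthogonal to [f]. This
    handles products of two [H2] functions, which need only be integrable. *)
Lemma H2s_int_mul (f g : R -> C) (l : nat) : H2s f -> H2s g ->
  cintegral (fun t => f t * g t * z t ^ l.+1%:Z) = 0.
Proof.
move=> hf hg; have [lf _] := hf; have [lg g0] := hg.
have lgz : L2s (fun t => g t * z t ^ l.+1%:Z).
  under eq_fun do rewrite mulrC; apply: (L2s_mul (M := 1)) => //; first exact: cmeas_zXz.
  by apply: aeT => t; rewrite csq_zXz.
pose w t : 'cV[C]_1 := scal (fun t => (g t * z t ^ l.+1%:Z)^*) t.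
have sE (u : R -> C) : (fun t => scal u t 0 0) = u by apply/funext => t; rewrite mxE.
have lw : L2 w.
  by apply/L2P => i; rewrite ord1 sE; exact: L2sJ.
have hw i (k : nat) : fourier (fun t => w t i 0) k = 0.
  rewrite ord1 sE /fourier.
  have -> : (fun t => (g t * z t ^ l.+1%:Z)^* * z t ^ (- k%:Z)) =
      (fun t => (g t * z t ^ (- (- (l.+1%:Z + k%:Z))))^*).
    by apply/funext => t; rewrite !conjMc !conj_zXz !opprK -mulrA -zXzD opprD.
  rewrite cintegralJ; last by apply: cintg_zXz; exact: L2s_cintg.
  by rewrite -/(fourier g _) g0 ?conjc0// oppr_lt0.
have := H2_perp lw hw ((H2_scal f).2 hf).
rewrite ip_symm//; last by have [] := (H2_scal f).2 hf.
move=> /(congr1 conjc); rewrite conjcK conjc0 ip_conjcE => <-.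
congr cintegral; apply/funext => t; rewrite big_ord1 !mxE !mulr1n conjcK; ring.
Qed.

Lemma fourier_mul (f g : R -> C) (k : int) : H2s f -> H2s g -> k < 0 ->
  fourier (fun t => f t * g t) k = 0.
Proof. by case: k => // k hf hg _; rewrite /fourier NegzE opprK H2s_int_mul. Qed.

Lemma H2s_mul (phi f : R -> C) (M : R) : H2s phi ->
  (\forall t \ae mu, csq (phi t) <= M) -> H2s f -> H2s (fun t => phi t * f t).
Proof.
move=> hphi hM hf; have [[mphi _] _] := hphi; have [lf _] := hf.
split=> [|k k0]; first exact: L2s_mul hM lf.
exact: fourier_mul.
Qed.

Lemma H2sD f g : H2s f -> H2s g -> H2s (fun t => f t + g t).
Proof.
move=> [lf hf] [lg hg]; split=> [|k k0]; first exact: L2sD.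
rewrite /fourier; under [X in cintegral X]eq_fun do rewrite mulrDl.
rewrite cintegralD; [|by apply: cintg_zXz; exact: L2s_cintg..].
by rewrite -!/(fourier _ _) hf// hg// addr0.
Qed.

Lemma H2s0 : H2s (fun=> 0).
Proof.
split=> [|k k0]; first exact: L2s_cst.
rewrite /fourier; under [X in cintegral X]eq_fun do rewrite mul0r.
exact: cintegral_cst.
Qed.

Lemma H2s_sum I (r : seq I) (f : I -> R -> C) : (forall i, H2s (f i)) ->
  H2s (fun t => \sum_(i <- r) f i t).
Proof.
move=> h; elim: r => [|i r IH].
  by under eq_fun do rewrite big_nil; exact: H2s0.
by under eq_fun do rewrite big_cons; exact: H2sD.
Qed.

Lemma Hinf_H2s m n (F : R -> 'M[C]_(m, n)) i j : Hinf F -> H2s (fun t => F t i j).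
Proof.
move=> [lF hF]; split=> [|k k0]; last exact: hF.
have [mF [M hM]] := Linf_essbd lF; split=> //.
apply: (rint_le (rmeas_csq (mF i j)) (rint_cst M)).
by apply: aeS hM => t h; rewrite ger0_norm ?csq_ge0.
Qed.

Lemma Hinf_essbd m n (F : R -> 'M[C]_(m, n)) : Hinf F -> essbd F.
Proof. by case=> /Linf_essbd. Qed.

Lemma Hinf_mul m n (F : R -> 'M[C]_(m, n)) (f : R -> 'cV[C]_n) : Hinf F -> H2 f ->
  H2 (fun t => F t *m f t).
Proof.
move=> hF /H2P hf; apply/H2P => i; under eq_fun do rewrite mxE.
apply: H2s_sum => j; have [_ [M hM]] := Hinf_essbd hF.
apply: (H2s_mul (M := M)) => //; first exact: Hinf_H2s.
by apply: aeS hM.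
Qed.

Lemma inner_scal (theta : R -> C) : inner (scal theta) ->
  [/\ H2s theta, \forall t \ae mu, csq (theta t) = 1 & cmeas theta].
Proof.
move=> [hi iso]; have h := Hinf_H2s 0 0 hi.
have e : (fun t => scal theta t 0 0) = theta by apply/funext => t; rewrite mxE.
rewrite e in h; split=> //; last by have [[]] := h.
apply: aeS iso => t /(_ 1%:M).
rewrite !vnormE /scal /vsq !big_ord1 mulmx1 !mxE csq1 => /(congr1 (fun x => x ^+ 2)).
by rewrite !sqr_sqrtr ?csq_ge0.
Qed.

(* An outer function vanishing on a set would keep the constant [1] at a positive distance
   from its multiples. *)
Lemma outer_neq0 (w : R -> C) : outer (scal w) -> \forall t \ae mu, w t != 0.
Proof.
move=> [hw dw].
have hw1 := Hinf_H2s 0 0 hw.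
have e1 (u : R -> C) : (fun t => scal u t 0 0) = u by apply/funext => t; rewrite mxE.
rewrite e1 in hw1; have [[mw _] _] := hw1.
pose A := [set t | w t = 0].
have mA : measurable (A : set (measurableTypeR R)).
  have -> : A = (fun t => csq (w t)) @^-1` [set 0].
    by apply/seteqP; split=> t /= h; [rewrite h csq0|exact: csq_eq0].
  rewrite -[X in measurable X]setTI; apply: (rmeas_csq mw) => //; exact: measurable_set1.
have one : H2 (scal (fun=> 1) : R -> 'cV[C]_1).
  by apply/H2_scal; have := H2s_zX 0; congr H2s; apply/funext => t; rewrite expr0z.
have muA (e : R) : 0 < e -> (mu A <= (e ^+ 2)%:E)%E.
  move=> e0; have [f hf hlt] := dw _ one e e0.
  have lf : L2 (fun t => scal (fun=> 1) t - scal w t *m f t : 'cV[C]_1).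
    have l1 : L2 (fun t => scal w t *m f t : 'cV[C]_1) by apply: L2_mul; [exact: Hinf_essbd|case: hf].
    have l2 : L2 (scal (fun=> 1 : C)) by case: one.
    have := L2tP (toL2 l2 - toL2 l1); congr L2; apply/funext => t; exact: L2t_sub.
  move: hlt; rewrite -[X in l2norm X]/(L2fun (toL2 lf)) l2norm_nrm lte_fin nrm_lt// nsq_int /= => /ltW.
  rewrite -lee_fin; apply: le_trans; rewrite /Rintegral fineK; last first.
    exact: (integrable_fin_num measurableT (rint_vsq lf)).
  have -> : mu A = (\int[mu]_t (\1_A t)%:E)%E by rewrite integral_indic// setIT.
  apply: ge0_le_integral => //=.
  - by apply/measurable_EFinP; exact: measurable_indic.
  - by apply/measurable_EFinP; apply: rint_meas; exact: (rint_vsq lf).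
  - move=> t _; rewrite lee_fin indicE; case: (boolP (t \in A)) => [|_]; last exact: vsq_ge0.
    rewrite inE /A /= => wt.
    by rewrite /vsq big_ord1 !mxE big_ord1 !mxE wt mul0rn mul0r subr0 mulr1n csq1.
exists A; split=> //; last by move=> t /= /negP; rewrite negbK => /eqP.
apply/eqP; rewrite eq_le measure_ge0 andbT; apply/lee_addgt0Pr => e e0.
rewrite add0e; have s0 : 0 < Num.sqrt e by rewrite sqrtr_gt0.
by have := muA _ s0; rewrite sqr_sqrtr// ltW.
Qed.

End hardy.
Arguments H2h {R} n.

(** * Four block operators *)

Section four_block_spaces.
Context {R : realType}.
Local Notation C := R[i].
Local Notation mu := (@circ R).

Lemma vsum_split m1 m2 (x y : 'cV[C]_(m1 + m2)) :
  \sum_i x i 0 * (y i 0)^* = \sum_i usubmx x i 0 * (usubmx y i 0)^* +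
    \sum_i dsubmx x i 0 * (dsubmx y i 0)^*.
Proof. by rewrite big_split_ord; congr (_ + _); apply: eq_bigr => i _; rewrite !mxE. Qed.

Lemma L2_usub m1 m2 (f : R -> 'cV[C]_(m1 + m2)) : L2 f -> L2 (fun t => usubmx (f t)).
Proof. by move=> /L2P h; apply/L2P => i; under eq_fun do rewrite mxE. Qed.

Lemma L2_dsub m1 m2 (f : R -> 'cV[C]_(m1 + m2)) : L2 f -> L2 (fun t => dsubmx (f t)).
Proof. by move=> /L2P h; apply/L2P => i; under eq_fun do rewrite mxE. Qed.

Lemma L2_col m1 m2 (f : R -> 'cV[C]_m1) (g : R -> 'cV[C]_m2) : L2 f -> L2 g ->
  L2 (fun t => col_mx (f t) (g t)).
Proof.
move=> /L2P hf /L2P hg; apply/L2P => i.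
case: (split_ordP i) => l ->; first by under eq_fun do rewrite col_mxEu.
by under eq_fun do rewrite col_mxEd.
Qed.

Lemma L2_zero n : L2 (fun=> 0 : 'cV[C]_n).
Proof. by apply/L2P => i; under eq_fun do rewrite mxE; exact: L2s_cst. Qed.

Lemma H2_zero n : H2 (fun=> 0 : 'cV[C]_n).
Proof. by apply/H2P => i; under eq_fun do rewrite mxE; exact: H2s0. Qed.

Lemma L2_col_inv m1 m2 (f : R -> 'cV[C]_(m1 + m2)) : L2 (fun t => usubmx (f t)) ->
  L2 (fun t => dsubmx (f t)) -> L2 f.
Proof.
move=> hu hd; have := L2_col hu hd; congr L2; apply/funext => t; exact: vsubmxK.
Qed.

Lemma ip_split m1 m2 (f g : R -> 'cV[C]_(m1 + m2)) : L2 f -> L2 g ->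
  ip f g = ip (fun t => usubmx (f t)) (fun t => usubmx (g t)) +
           ip (fun t => dsubmx (f t)) (fun t => dsubmx (g t)).
Proof.
move=> hf hg; rewrite !ip_conjcE -cintegralD; last 2 first.
- by apply: ip_cint; exact: L2_usub.
- by apply: ip_cint; exact: L2_dsub.
congr cintegral; apply/funext => t; exact: vsum_split.
Qed.

Lemma ip0 n (f : R -> 'cV[C]_n) : ip f (fun=> 0) = 0.
Proof.
rewrite ip_conjcE -[RHS](cintegral_cst 0); congr cintegral; apply/funext => t.
by rewrite big1// => i _; rewrite mxE conjc0 mulr0.
Qed.

Definition domh n1 n2 : set (L2h (n1 + n2)) :=
  [set f | H2 (fun t => usubmx (@L2fun R (n1 + n2) f t))].

(** [H^2] plus zero, the orthogonal complement of the codomain of [Gamma] in the full [L^2] space: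
    it is what the projection in [Gamma] removes. *)
Definition analh m1 m2 : set (L2h (m1 + m2)) :=
  [set f | H2 (fun t => usubmx (@L2fun R (m1 + m2) f t)) /\
           \forall t \ae mu, dsubmx (@L2fun R (m1 + m2) f t) = 0].

Arguments domh n1 n2 : clear implicits.
Arguments analh m1 m2 : clear implicits.

Lemma closed_domh n1 n2 : closed_sp (domh n1 n2).
Proof.
apply: (closed_ext _ (closed_perp [set f : L2h (n1 + n2) |
  exists i k, k < 0 /\ f = toL2 (L2_zdelta (lshift n2 i) k)])).
apply/seteqP; split=> f /= h.
  split=> [|i k k0]; first by apply: L2_usub; exact: L2tP.
  under [X in fourier X]eq_fun do rewrite mxE.
  rewrite -ip_zdelta; apply: (h (toL2 (L2_zdelta (lshift n2 i) k))); by exists i, k.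
move=> _ [i [k [k0 ->]]].
rewrite -[LHS]/(ip (@L2fun R (n1 + n2) f) (zdelta (lshift n2 i) k)) ip_zdelta.
have [_ /(_ i k k0) <-] := h; congr fourier.
by apply/funext => t; rewrite mxE.
Qed.

(** Orthogonality to the range of [lower] expresses that the second block vanishes a.e., which makes
    [analh] an intersection of orthogonal complements. *)
Definition lower m1 m2 (g : L2h (m1 + m2)) : L2h (m1 + m2) :=
  toL2 (L2_col (L2_zero m1) (L2_dsub (L2tP g))).

Lemma ip_lower m1 m2 (f g : L2h (m1 + m2)) : hip f (lower g) =
  ip (fun t => dsubmx (@L2fun R (m1 + m2) f t)) (fun t => dsubmx (@L2fun R (m1 + m2) g t)).
Proof.
rewrite -[LHS]/(ip (@L2fun R (m1 + m2) f) (@L2fun R (m1 + m2) (lower g))) ip_split; try exact: L2tP.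
rewrite -[RHS]add0r; congr (_ + _).
  rewrite -[RHS](ip0 (fun t => usubmx (@L2fun R (m1 + m2) f t))); congr ip.
  by apply/funext => t; rewrite col_mxKu.
by congr ip; apply/funext => t; rewrite col_mxKd.
Qed.

Lemma ip_self_eq0 n (f : R -> 'cV[C]_n) : L2 f -> ip f f = 0 -> \forall t \ae mu, f t = 0.
Proof.
move=> lf h; apply: (nsq0_ae (toL2 lf)).1.
by rewrite /nsq -[hip _ _]/(ip f f) h.
Qed.

Lemma closed_analh m1 m2 : closed_sp (analh m1 m2).
Proof.
have -> : analh m1 m2 = domh m1 m2 `&` [set f | forall e, (range (@lower m1 m2)) e -> hip f e = 0].
  apply/seteqP; split=> f [hu hd]; split=> //.
    move=> _ [g _ <-]; rewrite ip_lower.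
    rewrite (ip_ae _ (L2_zero m2) _ _ hd (aeT (fun=> erefl))); try by apply: L2_dsub; exact: L2tP.
    by rewrite ip_symm ?ip0 ?conjc0//; [exact: L2_zero|apply: L2_dsub; exact: L2tP].
  apply: ip_self_eq0; first by apply: L2_dsub; exact: L2tP.
  by rewrite -ip_lower; apply: hd; exists f.
by apply: closed_setI; [exact: closed_domh|exact: closed_perp].
Qed.

Lemma fb_domP n1 n2 (f : R -> 'cV[C]_(n1 + n2)) :
  fb_dom f <-> L2 f /\ H2 (fun t => usubmx (f t)).
Proof.
split=> [[hu hd]|[lf hu]]; split=> //; last exact: L2_dsub.
by apply: L2_col_inv => //; case: hu.
Qed.

Lemma fb_codP m1 m2 (e : R -> 'cV[C]_(m1 + m2)) :
  fb_cod e <-> L2 e /\ forall r : L2h (m1 + m2), analh m1 m2 r -> ip e (@L2fun R (m1 + m2) r) = 0.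
Proof.
split=> [[[lu hu] hd]|[le he]].
  have le := L2_col_inv lu hd; split=> // r [r1 r2]; rewrite ip_split//; last exact: L2tP.
  rewrite hu// add0r (ip_ae _ hd _ (L2_zero m2) (aeT (fun=> erefl)) r2) ?ip0//.
  by apply: L2_dsub; exact: L2tP.
split; last exact: L2_dsub.
split=> [|g hg]; first exact: L2_usub.
have lg : L2 (fun t => col_mx (g t) (0 : 'cV[C]_m2)) by apply: L2_col; [case: hg|exact: L2_zero].
have := he (toL2 lg); rewrite ip_split//= => h.
rewrite -[RHS]h; last first.
  split; last by apply: aeT => t; rewrite col_mxKd.
  by move: hg; congr H2; apply/funext => t; rewrite col_mxKu.
rewrite -[LHS]addr0; congr (_ + _).
  by congr ip; apply/funext => t; rewrite col_mxKu.
rewrite -[LHS](ip0 (fun t => dsubmx (e t))); congr ip.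
by apply/funext => t; rewrite col_mxKd.
Qed.

(* The compression of [y] to the complement of [analh], as the raw function used by [Gamma]. *)
Lemma oproj_spec m1 m2 (y : R -> 'cV[C]_(m1 + m2)) (ly : L2 y) :
  fb_cod (oproj (@fb_cod R m1 m2) y) /\
  \forall t \ae mu, oproj (@fb_cod R m1 m2) y t =
    @L2fun R (m1 + m2) (toL2 ly - proj (analh m1 m2) (toL2 ly : L2h (m1 + m2)) : L2h (m1 + m2)) t.
Proof.
have cA := @closed_analh m1 m2.
pose y' : L2h (m1 + m2) := toL2 ly; pose G := y' - proj (analh m1 m2) y'.
have [Hp hp] := projP y' cA.
have codG : fb_cod (@L2fun R (m1 + m2) G).
  by apply/fb_codP; split; [exact: L2tP|exact: hp].
have perpG e : fb_cod e -> ip (y - @L2fun R (m1 + m2) G) e = 0.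
  move=> /fb_codP [le he].
  have -> : y - @L2fun R (m1 + m2) G = @L2fun R (m1 + m2) (proj (analh m1 m2) y').
    apply/funext => t; rewrite -[LHS]/(y t - @L2fun R (m1 + m2) G t) /G L2h_sub.
    by rewrite opprB addrC subrK.
  by rewrite ip_symm ?he ?conjc0//; exact: L2tP.
have [c h] : [set g | fb_cod g /\ forall e, fb_cod e -> ip (y - g) e = 0] (oproj (@fb_cod R m1 m2) y).
  by apply: xgetPex; exists (@L2fun R (m1 + m2) G).
split=> //; have [lo _] := (fb_codP _).1 c.
have lyo : L2 (y - oproj (@fb_cod R m1 m2) y).
  have := L2tP (y' - toL2 lo : L2h (m1 + m2)); congr L2; apply/funext => t; exact: L2h_sub.
(* The difference [d] of the two candidates lies in the codomain and is orthogonal to it, so it is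
   null. *)
pose o' : L2h (m1 + m2) := toL2 lo; pose d : L2h (m1 + m2) := o' - G.
have cd : fb_cod (@L2fun R (m1 + m2) d).
  apply/fb_codP; split=> [|r Hr]; first exact: L2tP.
  rewrite -[LHS]/(hip d r) /d ipBl -[hip G r]/(ip (@L2fun R (m1 + m2) G) (@L2fun R (m1 + m2) r)).
  rewrite -[hip o' r]/(ip (oproj (@fb_cod R m1 m2) y) (@L2fun R (m1 + m2) r)).
  by rewrite ((fb_codP _).1 c).2// ((fb_codP _).1 codG).2// subrr.
have d0 : nsq d = 0.
  have h1 : hip (y' - o') d = 0.
    rewrite -[RHS](h _ cd) -[LHS]/(ip (@L2fun R (m1 + m2) (y' - o')) (@L2fun R (m1 + m2) d)).
    by congr ip; apply/funext => t; exact: L2h_sub.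
  have h2 : hip (y' - G) d = 0.
    rewrite -[RHS](perpG _ cd) -[LHS]/(ip (@L2fun R (m1 + m2) (y' - G)) (@L2fun R (m1 + m2) d)).
    by congr ip; apply/funext => t; exact: L2h_sub.
  have e1 : d = (y' - G) - (y' - o') by rewrite (opprB y' o') [RHS]addrC (subrKA y').
  by rewrite /nsq {1}e1 ipBl h1 h2 subrr.
have /nsq0_ae := d0; apply: aeS => t; rewrite /d L2h_sub => /eqP.
by rewrite subr_eq0 => /eqP.
Qed.

End four_block_spaces.
Arguments domh {R} n1 n2.
Arguments analh {R} m1 m2.

Lemma nrm_scale {R : realType} {H : hilbert R} (r : R) (x : H) : nrm (r%:C *: x) = `|r| * nrm x.
Proof. by rewrite {1}/nrm nsqZ csqC sqrtrM ?sqr_ge0// sqrtr_sqr. Qed.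

(** * Four block operators as compressions, and their singular numbers *)

Section compressions.
Context {R : realType} {m1 m2 n1 n2 : nat}.
Local Notation C := R[i].
Local Notation mu := (@circ R).
Local Notation HN := (L2h (n1 + n2) : hilbert R).
Local Notation HM := (L2h (m1 + m2) : hilbert R).
Local Notation fN := (@L2fun R (n1 + n2)).
Local Notation fM := (@L2fun R (m1 + m2)).
Local Notation Hq := (analh m1 m2).
Variables (Phi : R -> 'M[C]_(m1 + m2, n1 + n2)) (hPhi : essbd Phi).

Definition symb (f : HN) : HM := mulop hPhi f.
Local Notation A := symb.
Local Notation G := (compr1 Hq A).

Lemma symb_lin : lin A. Proof. exact: mulop_lin. Qed.

Lemma l2norm_ae n (f g : R -> 'cV[C]_n) (lf : L2 f) (lg : L2 g) :
  (\forall t \ae mu, f t = g t) -> l2norm f = l2norm g.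
Proof.
move=> fg; rewrite -[l2norm f]/(l2norm (@L2fun R n (toL2 lf))) -[l2norm g]/(l2norm (@L2fun R n (toL2 lg))).
rewrite !l2norm_nrm; congr EFin; pose f' : L2h n := toL2 lf; pose g' : L2h n := toL2 lg.
have h : nsq (f' - g') = 0.
  by apply/nsq0_ae; apply: aeS fg => t e; rewrite L2h_sub /= e subrr.
rewrite -[toL2 lf]/f' -[toL2 lg]/g' -{1}(subrK g' f') addrC /nrm.
by rewrite nsq_add_null.
Qed.

(** The bridge between [Gamma], defined on raw functions, and the compression in the Hilbert
    space. *)
Lemma Gamma_ae (f : HN) : fb_cod (Gamma Phi (fN f)) /\
  \forall t \ae mu, Gamma Phi (fN f) t = fM (G f) t.
Proof. by have := oproj_spec (L2_mul hPhi (L2tP f)). Qed.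

Lemma fb_cod_L2 e : @fb_cod R m1 m2 e -> L2 e.
Proof. by move=> /fb_codP []. Qed.

Lemma compr_min (u e : HM) : Hq e -> nrm (u - proj Hq u) <= nrm (u - e).
Proof.
have cH := @closed_analh R m1 m2; have [Ep hp] := projP u cH => He.
have -> : u - e = (u - proj Hq u) + (proj Hq u - e) by rewrite subrKA.
rewrite nrm_le ?nrm_ge0// nrm_sq [leRHS]nsqD hp; last by apply: subspB => //; case: cH.
by have := nsq_ge0 (proj Hq u - e); rewrite /=; lra.
Qed.

Lemma compr_le (f : HN) : nrm (G f) <= nrm (A f).
Proof.
have := compr_min (A f) (e := 0); rewrite subr0; apply.
by case: (@closed_analh R m1 m2) => [[]].
Qed.

Lemma domh_fb (f : HN) : domh n1 n2 f -> fb_dom (fN f).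
Proof. by move=> h; apply/fb_domP; split=> //; exact: L2tP. Qed.

Lemma compr_bound K (s : R) (f : HN) : bounded_linear (@fb_dom R n1 n2) (@fb_cod R m1 m2) K ->
  (op_norm (@fb_dom R n1 n2) (Gamma Phi \- K)%R <= s%:E)%E ->
  domh n1 n2 f -> (\forall t \ae mu, K (fN f) t = 0) -> nrm (G f) <= s * nrm f.
Proof.
move=> [Kcod Klin _] hs Df Kf.
have [L L0 hL] := mulop_bounded hPhi.
have := nrm_ge0 f; rewrite le_eqVlt => /orP[/eqP f0|fp].
  rewrite -f0 mulr0; apply: le_trans (compr_le f) _.
  by apply: le_trans (hL f) _; rewrite -f0 mulr0.
pose l : C := ((nrm f)^-1)%:C; pose f' : HN := l *: f.
have [sD _] := @closed_domh R n1 n2.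
have Df' : domh n1 n2 f' by exact: subspZ.
have D0 : domh n1 n2 (0 : HN) by case: sD.
have nf' : nrm f' = 1.
  by rewrite /f' nrm_scale ger0_norm ?invr_ge0 ?nrm_ge0// mulVf ?gt_eqF.
have Kf' : \forall t \ae mu, K (fN f') t = 0.
  (* [K] is linear only up to null sets, and only in the shape [a *: f + g]. Hence [f'] is written
     as [l *: f + 0], and [K 0 = 0] a.e. comes from additivity at [0]. *)
  have h0 := Klin 1 _ _ (domh_fb D0) (domh_fb D0).
  have h1 := Klin l _ _ (domh_fb Df) (domh_fb D0).
  apply: aeS (aeI (aeI h0 h1) Kf) => t [[e0 e1] e2].
  have z0 : fN 0 = 0 by apply/funext => x; exact: L2t_zero.
  have z1 : fN f' = l *: fN f + fN 0.
    by apply/funext => x; rewrite L2h_scale -[RHS]/(l *: fN f x + fN 0 x) z0 addr0.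
  have e3 : K (fN 0) t = 0.
    move: e0; have -> : 1 *: fN 0 + fN 0 = fN 0 by rewrite z0 scaler0 addr0.
    by rewrite scale1r => /eqP; rewrite -subr_eq0 opprD addrA subrr sub0r oppr_eq0 => /eqP.
  by rewrite z1 e1 e2 e3 scaler0 addr0.
have [cG aG] := Gamma_ae f'.
have lK : L2 (K (fN f')) by apply: fb_cod_L2; apply: Kcod; exact: domh_fb.
have lGK : L2 ((Gamma Phi \- K) (fN f')).
  have := L2tP (toL2 (fb_cod_L2 cG) - toL2 lK); congr L2; apply/funext => t; exact: L2t_sub.
have e1 : l2norm ((Gamma Phi \- K) (fN f')) = (nrm (G f'))%:E.
  rewrite -l2norm_nrm; apply: l2norm_ae => //; first exact: L2tP.
  apply: aeS (aeI aG Kf') => t [h1 h2].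
  by rewrite -[LHS]/(Gamma Phi (fN f') t - K (fN f') t) h1 h2 subr0.
have h1 : nrm (G f') <= s.
  rewrite -lee_fin -e1; apply: le_trans hs; apply: ereal_sup_ubound.
  by exists (fN f') => //; split; [exact: domh_fb|rewrite l2norm_nrm nf'].
have lf : l * (nrm f)%:C = 1 by rewrite -rmorphM mulVf ?gt_eqF.
have fE : f = (nrm f)%:C *: f' by rewrite /f' scalerA mulrC lf scale1r.
(* [G] depends on chosen projections and need not be homogeneous; the minimality of the residual
   gives the inequality. *)
have h2 : nrm (G f) <= nrm f * nrm (G f').
  have cH := @closed_analh R m1 m2; have [Ep _] := projP (A f') cH.
  have Ee : Hq ((nrm f)%:C *: proj Hq (A f')) by apply: subspZ => //; case: cH.
  apply: le_trans (compr_min (A f) Ee) _.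
  rewrite {1}fE (linZ symb_lin) -scalerBr -/(G f').
  by rewrite nrm_scale ger0_norm// nrm_ge0.
by apply: (le_trans h2); rewrite mulrC ler_wpM2r// nrm_ge0.
Qed.

Lemma lin_sum_ae K : bounded_linear (@fb_dom R n1 n2) (@fb_cod R m1 m2) K ->
  forall k (c : 'I_k -> C) (u : 'I_k -> HN), (forall i, domh n1 n2 (u i)) ->
  \forall t \ae mu, K (fN (\sum_i c i *: u i)) t = \sum_i c i *: K (fN (u i)) t.
Proof.
move=> [Kcod Klin _]; have [sD _] := @closed_domh R n1 n2.
have D0 : domh n1 n2 (0 : HN) by case: sD.
elim=> [|k IH] c u Du.
  have h0 := Klin 1 _ _ (domh_fb D0) (domh_fb D0).
  apply: aeS h0 => t; rewrite !big_ord0 => e0.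
  have z0 : fN 0 = 0 by apply/funext => x; exact: L2t_zero.
  move: e0; have -> : 1 *: fN 0 + fN 0 = fN 0 by rewrite z0 scaler0 addr0.
  by rewrite scale1r => /eqP; rewrite -subr_eq0 opprD addrA subrr sub0r oppr_eq0 => /eqP.
have h1 := IH (fun i => c (lift ord0 i)) (fun i => u (lift ord0 i)) (fun i => Du _).
have Ds : domh n1 n2 (\sum_i c (lift ord0 i) *: u (lift ord0 i)) by exact: subsp_sum.
have h2 := Klin (c ord0) _ _ (domh_fb (Du ord0)) (domh_fb Ds).
by apply: aeS (aeI h1 h2) => t [e1 e2]; rewrite !big_ord_recl -e1 -e2.
Qed.

(** The coefficients of the [K (u i)] on [k] spanning functions form an [n] by [k] matrix; for
    [k < n] a nonzero row of its left kernel gives a combination annihilated by [K]. *)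
Lemma small_rank_kernel K k n (s : R) (u : 'I_n -> HN) : (k < n)%N ->
  bounded_linear (@fb_dom R n1 n2) (@fb_cod R m1 m2) K -> rank_le (@fb_dom R n1 n2) k K ->
  (op_norm (@fb_dom R n1 n2) (Gamma Phi \- K)%R <= s%:E)%E ->
  (forall i, domh n1 n2 (u i)) ->
  exists c : 'I_n -> C, (exists i, c i != 0) /\
    let f := \sum_i c i *: u i in nrm (G f) <= s * nrm f.
Proof.
move=> kn bK [b hb] hs Du.
have /choice [a ha] : forall i, exists c : 'I_k -> C,
    \forall t \ae mu, K (fN (u i)) t = \sum_l c l *: b l t.
  by move=> i; apply: hb; exact: domh_fb.
pose M : 'M[C]_(n, k) := \matrix_(i, l) a i l.
have kM : kermx M != 0.
  rewrite -mxrank_eq0 mxrank_ker subn_eq0 -ltnNge.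
  exact: leq_ltn_trans (rank_leq_col M) kn.
have [i0 ci0] : exists i, row i (kermx M) != 0.
  apply: contrapT => h; move/eqP: kM; apply; apply/row_matrixP => i.
  by rewrite row0; apply/eqP; apply: contrapT => /negP h'; apply: h; exists i.
pose c i := row i0 (kermx M) 0 i.
exists c; split.
  apply: contrapT => h; move/eqP: ci0; apply; apply/rowP => i; rewrite [RHS]mxE.
  by apply/eqP; apply: contrapT => /negP h'; apply: h; exists i.
have cM l : \sum_i c i * a i l = 0.
  have /sub_kermxP := row_sub i0 (kermx M) => /rowP /(_ l); rewrite !mxE => h.
  by rewrite -[RHS]h; apply: eq_bigr => i _; rewrite /c !mxE.
apply: (compr_bound bK hs).
  by apply: subsp_sum => //; case: (@closed_domh R n1 n2).
apply: aeS (aeI (lin_sum_ae bK c Du) (ae_fin ha)) => t [-> hat].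
under eq_bigr do rewrite hat scaler_sumr.
rewrite exchange_big big1// => l _.
under eq_bigr do rewrite scalerA.
by rewrite -scaler_suml cM scale0r.
Qed.

(** The approximant is [Gamma] composed with the map sending [f] to [\sum_l hip f (e l) *: e l], of
    rank at most [j]. *)
Lemma snum_le j (s : R) (e : 'I_j -> HN) : 0 <= s -> (forall i, domh n1 n2 (e i)) ->
  (forall f, domh n1 n2 f -> nrm (G (f - \sum_l hip f (e l) *: e l)) <= s * nrm f) ->
  (fb_snum j (Gamma Phi) <= s%:E)%E.
Proof.
move=> s0 De he.
have ce i := (Gamma_ae (e i)).1.
pose ge i : HM := toL2 (fb_cod_L2 (ce i)).
have geE i : fM (ge i) = Gamma Phi (fN (e i)) by [].
pose K (f : R -> 'cV[C]_(n1 + n2)) : R -> 'cV[C]_(m1 + m2) :=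
  fun t => \sum_i ip f (fN (e i)) *: Gamma Phi (fN (e i)) t.
have KE (f : HN) : K (fN f) = fM (\sum_i hip f (e i) *: ge i).
  by apply/funext => t; rewrite (L2h_sum (fun i => hip f (e i)) ge).
have bK : bounded_linear (@fb_dom R n1 n2) (@fb_cod R m1 m2) K.
  split.
  - move=> f /fb_domP [lf _]; rewrite -[f]/(fN (toL2 lf)) KE.
    apply/fb_codP; split; first exact: L2tP.
    move=> r Hr; rewrite -[LHS]/(hip (\sum_i hip (toL2 lf : HN) (e i) *: ge i) r) ip_suml big1// => i _.
    by have [_ /(_ r Hr) h] := (fb_codP _).1 (ce i); rewrite -[hip (ge i) r]/(ip (Gamma Phi (fN (e i))) (fM r)) h mulr0.
  - move=> a f g /fb_domP [lf _] /fb_domP [lg _]; apply: aeT => t.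
    rewrite /K scaler_sumr -big_split; apply: eq_bigr => i _.
    by rewrite ip_lin//; [rewrite scalerDl scalerA|exact: L2tP].
  - pose B := Num.sqrt (\sum_i nsq (e i)) * \sum_i nrm (ge i).
    apply: (@le_lt_trans _ _ B%:E); last exact: ltry.
    apply: ge_ereal_sup => _ [f [/fb_domP [lf _] f1] <-].
    rewrite -[f]/(fN (toL2 lf)) KE l2norm_nrm lee_fin; apply: le_trans (nrm_sum _ _) _.
    apply: ler_wpM2r; first by apply: sumr_ge0 => i _; exact: nrm_ge0.
    rewrite ler_sqrt; last by apply: sumr_ge0 => i _; exact: nsq_ge0.
    apply: ler_sum => i _; apply: le_trans (cauchy_schwarz _ _) _.
    rewrite ler_piMl ?nsq_ge0//; move: f1; rewrite -[f]/(fN (toL2 lf)) l2norm_nrm lee_fin => f1.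
    by rewrite -nrm_sq expr_le1 ?nrm_ge0.
apply: (@le_trans _ _ (op_norm (@fb_dom R n1 n2) (Gamma Phi \- K))).
  apply: ereal_inf_lbound; exists K => //; split=> //.
  exists (fun i => Gamma Phi (fN (e i))) => f _; exists (fun i => ip f (fN (e i))).
  exact: aeT.
apply: ge_ereal_sup => _ [f0 [df f1] <-].
have [lf uf] := (fb_domP f0).1 df.
pose f : HN := toL2 lf; pose c i := hip f (e i); pose f' := f - \sum_l c l *: e l.
have [cG aG] := Gamma_ae f.
have cH := @closed_analh R m1 m2; have [sH _] := cH.
have lK : L2 (K f0) by apply: fb_cod_L2; case: bK => h _ _; exact: h.
have lGK : L2 ((Gamma Phi \- K) f0).
  have := L2tP (toL2 (fb_cod_L2 cG) - toL2 lK); congr L2; apply/funext => t; exact: L2t_sub.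
(* The linear combination of projections that would be [proj Hq (A f')] if [proj] were linear; it
   agrees with it up to a null vector. *)
pose X := proj Hq (A f) - \sum_i c i *: proj Hq (A (e i)).
have PP (g : HN) := projP (A g) cH.
have HX : Hq X.
  by apply: subspB => //; [have [] := PP f|apply: subsp_sum => // i; have [] := PP (e i)].
have AX : A f' - X = G f - \sum_i c i *: G (e i).
  rewrite /f' (linB symb_lin) (lin_sum symb_lin) /X /compr1.
  under [in RHS]eq_bigr do rewrite scalerBr.
  by rewrite sumrB !opprB addrACA [in RHS]addrACA; congr (_ + _); rewrite addrC.
have perpX r : Hq r -> hip (A f' - X) r = 0.
  move=> Hr; rewrite AX ipBl ip_suml big1 => [|i _]; last first.
    by have [_ h] := PP (e i); rewrite h// mulr0.
  by have [_ h] := PP f; rewrite h// subr0.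
have [HP hP] := PP f'.
have nX : nsq (A f' - X) = nsq (G f').
  have h := proj_unique sH HP hP HX perpX.
  rewrite (_ : A f' - X = G f' + (proj Hq (A f') - X)); last by rewrite subrKA.
  by rewrite nsq_add_null.
have -> : l2norm ((Gamma Phi \- K) f0) = (nrm (A f' - X))%:E.
  rewrite -l2norm_nrm; apply: l2norm_ae => //; first exact: L2tP.
  apply: aeS (aeI aG (ae_fin (fun i => (Gamma_ae (e i)).2))) => t [h1 h2].
  rewrite AX L2h_sub (L2h_sum c (fun i => G (e i))) -[LHS]/(Gamma Phi f0 t - K f0 t).
  rewrite -[Gamma Phi f0 t]/(Gamma Phi (fN f) t) h1; congr (_ - _); apply: eq_bigr => i _.
  by rewrite h2.
rewrite lee_fin /nrm nX -/(nrm (G f')); apply: le_trans (he f uf) _.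
move: f1; rewrite -[f0]/(fN f) l2norm_nrm lee_fin => f1.
by rewrite -[leRHS]mulr1 ler_wpM2l.
Qed.

End compressions.

(** * Unitary frames *)

Section frames.
Context {R : realType}.
Local Notation C := R[i].
Local Notation mu := (@circ R).

(** The unitarity of the matrix with first column [v] and remaining columns [B], written blockwise.
    Leaving [n] free allows [q.+1 + r] rows without a cast to [1 + (q + r)]. *)
Definition frame n k (v : 'cV[C]_n) (B : 'M[C]_(n, k)) :=
  [/\ mxadj v *m v = 1%:M, mxadj v *m B = 0, mxadj B *m v = 0, mxadj B *m B = 1%:M &
      v *m mxadj v + B *m mxadj B = 1%:M].

Lemma mxadj_row_mx n k l (A : 'M[C]_(n, k)) (B : 'M[C]_(n, l)) :
  mxadj (row_mx A B) = col_mx (mxadj A) (mxadj B).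
Proof. by rewrite /mxadj /mxbar map_row_mx tr_row_mx. Qed.

Lemma mxadj_col_mx n k l (A : 'M[C]_(k, n)) (B : 'M[C]_(l, n)) :
  mxadj (col_mx A B) = row_mx (mxadj A) (mxadj B).
Proof. by rewrite /mxadj /mxbar map_col_mx tr_col_mx. Qed.

Lemma mxadj0 n k : mxadj (0 : 'M[C]_(n, k)) = 0.
Proof. by apply/matrixP => i j; rewrite mxadjE !mxE conjc0. Qed.

Lemma mxbarK n k (A : 'M[C]_(n, k)) : mxbar (mxbar A) = A.
Proof. by apply/matrixP => i j; rewrite !mxE conjcK. Qed.

Lemma mxadj_bar n k (A : 'M[C]_(n, k)) : mxadj (mxbar A) = A^T.
Proof. by rewrite /mxadj mxbarK. Qed.

Lemma unitary_frame k (V : 'M[C]_(1 + k)) : V \is unitarymx -> frame (lsubmx V) (rsubmx V).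
Proof.
move=> hV; have h1 := unitary_Vmul hV; have h2 := unitary_mulV hV.
rewrite -(hsubmxK V) mxadj_row_mx mul_col_row (@scalar_mx_block _ 1 k) in h1.
rewrite -(hsubmxK V) mxadj_row_mx mul_row_col in h2.
by have [e1 e2 e3 e4] := eq_block_mx h1.
Qed.

Lemma frame_vsq n k (v : 'cV[C]_n) (B : 'M[C]_(n, k)) (x : 'cV[C]_n) : frame v B ->
  vsq x = vsq (mxadj v *m x) + vsq (mxadj B *m x).
Proof.
move=> [_ _ _ _ h]; apply: complexI; rewrite rmorphD /= !vsq_adj !vsum_adj !mxadjK -big_split /=.
apply: eq_bigr => i _; rewrite -mulrDr -conjDc !mulmxA; congr (_ * (_)^*).
have e : v *m mxadj v *m x + B *m mxadj B *m x = x by rewrite -mulmxDl h mul1mx.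
by rewrite -{1}e mxE.
Qed.

Lemma frame_vsqD n k (v : 'cV[C]_n) (B : 'M[C]_(n, k)) (a : 'cV[C]_1) (y : 'cV[C]_k) :
  frame v B -> vsq (v *m a + B *m y) = vsq a + vsq y.
Proof.
move=> fr; rewrite (frame_vsq _ fr); have [h1 h2 h3 h4 _] := fr.
by rewrite !mulmxDr !mulmxA h1 h2 h3 h4 !mul1mx !mul0mx addr0 add0r.
Qed.

Section structured_frame.
Context {q r : nat}.
Variables (v : 'cV[C]_(q.+1 + r)) (vi : 'cV[C]_q.+1) (vo : C) (vc : 'M[C]_(q.+1, q)).
Variable vs : 'M[C]_(q.+1 + r, r).
Local Notation B := (row_mx (col_mx (mxbar vc) 0) vs).
Hypotheses (fr : frame v B) (vE : usubmx v = vo *: vi) (vo0 : vo != 0).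
Hypothesis un : (row_mx vi (mxbar vc) : 'M[C]_q.+1) \is unitarymx.

(** As [y] has no lower block and [vo] is nonzero, orthogonality to [v] means orthogonality of its
    upper block to [vi]. The unitary matrix with columns [vi] and [mxbar vc] then places that block
    in the range of [mxbar vc]. *)
Lemma frame_range (y : 'cV[C]_(q.+1 + r)) : dsubmx y = 0 -> mxadj v *m y = 0 ->
  usubmx y = mxbar vc *m (vc^T *m usubmx y) /\
  mxadj B *m y = col_mx (vc^T *m usubmx y) 0.
Proof.
move=> dy vy.
have viy : mxadj vi *m usubmx y = 0.
  move: vy; rewrite -{1}(vsubmxK v) -{1}(vsubmxK y) mxadj_col_mx mul_row_col dy mulmx0 addr0 vE.
  have -> : mxadj (vo *: vi) = vo^* *: mxadj vi.
    by apply/matrixP => i j; rewrite mxadjE !mxE conjMc.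
  rewrite -scalemxAl => /eqP; rewrite scaler_eq0 => /orP[|/eqP //].
  by rewrite conjc_eq0 (negbTE vo0).
have uy : usubmx y = mxbar vc *m (vc^T *m usubmx y).
  have h : row_mx vi (mxbar vc) *m mxadj (row_mx vi (mxbar vc)) = 1%:M := unitary_mulV un.
  rewrite mxadj_row_mx mul_row_col mxadj_bar in h.
  by rewrite -{1}[usubmx y]mul1mx -h mulmxDl -!mulmxA viy mulmx0 add0r.
split=> //; have [_ _ _ BB _] := fr.
have e : y = B *m col_mx (vc^T *m usubmx y) 0.
  by rewrite mul_row_col mulmx0 addr0 mul_col_mx mul0mx -uy -{1}(vsubmxK y) dy.
by rewrite {1}e mulmxA BB mul1mx.
Qed.

(** The zero block below [mxbar vc] removes the nonanalytic component of [f]; this is why passing to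
    the last coordinates preserves the domain. *)
Lemma usub_frame (f : 'cV[C]_(q.+1 + r)) : usubmx (mxadj B *m f) = vc^T *m usubmx f.
Proof.
rewrite mxadj_row_mx mul_col_mx col_mxKu mxadj_col_mx mxadj0 -{1}(vsubmxK f).
by rewrite mul_row_col mul0mx addr0 mxadj_bar.
Qed.

End structured_frame.

Lemma unitary_bar n (A : 'M[C]_n) : A \is unitarymx -> mxbar A \is unitarymx.
Proof. by rewrite -(conjC_unitary A). Qed.

(** The measure has total mass [1], so a null set is not everything. *)
Lemma ae_exists (P : R -> Prop) : (\forall t \ae mu, P t) -> exists t, P t.
Proof.
move=> [N [mN N0 hN]]; apply: contrapT => h.
have NT : N = setT by apply/seteqP; split=> // t _; apply: hN => /= Pt; apply: h; exists t.
by have := @circT R; rewrite -NT N0 => -[/eqP]; rewrite eq_sym oner_eq0.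
Qed.

Lemma csqV (c : C) : csq c^-1 = (csq c)^-1.
Proof.
have [->|c0] := eqVneq c 0; first by rewrite invr0 csq0 invr0.
have d0 : csq c != 0 by apply/eqP => /csq_eq0 /eqP; apply/negP.
by apply: (mulfI d0); rewrite -csqM !divff// csq1.
Qed.

(** The inverse is the conjugate divided by the squared modulus. At zeros of [f] the conjugate
    vanishes, in agreement with the convention that [0^-1 = 0]. *)
Lemma cmeasV (f : R -> C) : cmeas f -> cmeas (fun t => (f t)^-1).
Proof.
move=> mf.
have -> : (fun t => (f t)^-1) = (fun t => ((csq (f t)) `^ (-1))%:C * (f t)^*).
  apply/funext => t; rewrite powR_inv1 ?csq_ge0//.
  have [e|c0] := eqVneq (f t) 0; first by rewrite e invr0 conjc0 mulr0.
  by apply: (mulfI c0); rewrite divff// mulrCA -csqE -rmorphM mulVf//; apply/eqP => /csq_eq0 /eqP; apply/negP.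
apply: cmeasM; last exact: cmeasJ.
split; last exact: measurable_cst.
by apply: (measurableT_comp (measurable_powR (-1))); exact: rmeas_csq.
Qed.

End frames.

(** * The factorization *)

Section outer_density.
Context {R : realType}.
Local Notation C := R[i].
Local Notation mu := (@circ R).

(** Density of the multiples of [F], in dual form; it is applied to the transposes of [fac_Vc] and
    [fac_Wc], which are outer by co-outerness. *)
Lemma outer_perp m n (F : R -> 'M[C]_(m, n)) (eta : R -> 'cV[C]_m) : outer F -> L2 eta ->
  (forall x, H2 x -> ip (fun t => F t *m x t) eta = 0) ->
  forall g, H2 g -> ip g eta = 0.
Proof.
move=> [hF dF] le he g Hg; have [lg _] := Hg.
pose eta' : L2h m := toL2 le; pose g' : L2h m := toL2 lg.
have bound (e : R) : 0 < e -> csq (ip g eta) <= e ^+ 2 * nsq eta'.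
  move=> e0; have [x Hx hx] := dF g Hg e e0.
  have lFx : L2 (fun t => F t *m x t) by apply: L2_mul; [exact: Hinf_essbd|case: Hx].
  pose y : L2h m := toL2 lFx.
  have e1 : ip g eta = hip (g' - y) eta'.
    by rewrite ipBl -[hip y eta']/(ip (fun t => F t *m x t) eta) he// subr0.
  rewrite e1; apply: le_trans (cauchy_schwarz _ _) _.
  rewrite ler_wpM2r ?nsq_ge0// ltW// -nrm_lt// -lte_fin -(l2norm_nrm (g' - y)).
  by move: hx; congr (l2norm _ < _)%E; apply/funext => t; rewrite L2h_sub.
apply: csq_eq0; apply/eqP; rewrite eq_le csq_ge0 andbT; apply/ler_addgt0Pr => e e0.
have n0 : 0 < nsq eta' + 1 by rewrite ltr_wpDl ?nsq_ge0.
have d0 : 0 < e / (nsq eta' + 1) by rewrite divr_gt0.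
have s0 : 0 < Num.sqrt (e / (nsq eta' + 1)) by rewrite sqrtr_gt0.
apply: le_trans (bound _ s0) _; rewrite sqr_sqrtr ?(ltW d0)// add0r mulrAC ler_pdivrMr//.
by rewrite ler_wpM2l ?(ltW e0)// lerDl.
Qed.

End outer_density.

Lemma mxbar_row_mx {R : realType} m n1 n2 (A : 'M[R[i]]_(m, n1)) (B : 'M[R[i]]_(m, n2)) :
  mxbar (row_mx A B) = row_mx (mxbar A) (mxbar B).
Proof. exact: map_row_mx. Qed.

Lemma mxbar_col_mx {R : realType} m1 m2 n (A : 'M[R[i]]_(m1, n)) (B : 'M[R[i]]_(m2, n)) :
  mxbar (col_mx A B) = col_mx (mxbar A) (mxbar B).
Proof. exact: map_col_mx. Qed.

Lemma block_decomp {R : realType} a b (W : 'M[R[i]]_(1 + a)) (P : 'M[R[i]]_(1 + a, 1 + b))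
    (V : 'M[R[i]]_(1 + b)) (s : R[i]) (Q : 'M[R[i]]_(a, b)) (f : 'cV[R[i]]_(1 + b)) :
  W \is unitarymx -> V \is unitarymx -> W *m P *m V = block_mx s%:M 0 0 Q ->
  P *m f = lsubmx (mxadj W) *m (s%:M *m (mxadj (lsubmx V) *m f)) +
           rsubmx (mxadj W) *m (Q *m (mxadj (rsubmx V) *m f)).
Proof.
move=> hW hV e; have eV := unitary_mulV hV; have eW := unitary_Vmul hW.
have -> : P *m f = mxadj W *m (W *m P *m V) *m (mxadj V *m f).
  by rewrite !mulmxA eW mul1mx -[P *m V *m _]mulmxA eV mulmx1.
rewrite e -{1}(hsubmxK (mxadj W)) -{1}(hsubmxK V) mxadj_row_mx mul_col_mx -mulmxA.
by rewrite mul_block_col !mul0mx addr0 add0r mul_row_col.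
Qed.

Section factor.
Context {R : realType} {p q m2 n2 : nat}.
Local Notation C := R[i].
Local Notation mu := (@circ R).
Variables (Phi : R -> 'M[C]_(p.+1 + m2, q.+1 + n2)) (F : factorization Phi).
Hypothesis lPhi : essbd Phi.

Local Notation t0 := (fac_t0 F).
Local Notation h := (fac_h F).
Local Notation u0 := (fac_u0 F).

(** Columns are read off [V] and the adjoint of [W] instead of [fac_v] and [fac_w]: they agree a.e.
    with [fac_v] and the conjugate of [fac_w], but inherit measurability and bounds directly,
    without division by [h]. *)
Definition Vcol t : 'cV[C]_(q.+1 + n2) := @lsubmx C (q.+1 + n2) 1 (q + n2) (fac_V F t).
Definition Vrest t : 'M[C]_(q.+1 + n2, q + n2) := @rsubmx C (q.+1 + n2) 1 (q + n2) (fac_V F t).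
Definition Wcol t : 'cV[C]_(p.+1 + m2) :=
  @lsubmx C (p.+1 + m2) 1 (p + m2) (mxadj (fac_W F t)).
Definition Wrest t : 'M[C]_(p.+1 + m2, p + m2) :=
  @rsubmx C (p.+1 + m2) 1 (p + m2) (mxadj (fac_W F t)).

Lemma essbd_reindex m n m' n' (A : R -> 'M[C]_(m, n)) (B : R -> 'M[C]_(m', n'))
  (f : 'I_m' -> 'I_m) (g : 'I_n' -> 'I_n) :
  (forall t i j, B t i j = A t (f i) (g j)) -> essbd A -> essbd B.
Proof.
move=> BA [mA [M hM]]; split; first by move=> i j; under eq_fun do rewrite BA.
by exists M; apply: aeS hM => t hA i j; rewrite BA.
Qed.

Lemma essbd_V : essbd (fac_V F).
Proof. by apply: essbd_unitary; [exact: fac_V_measurable|exact: fac_V_unitary]. Qed.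

Lemma essbd_W : essbd (fac_W F).
Proof. by apply: essbd_unitary; [exact: fac_W_measurable|exact: fac_W_unitary]. Qed.

Lemma essbd_Vcol : essbd Vcol.
Proof.
apply: (essbd_reindex (f := id) (g := @lshift 1 (q + n2)) _ essbd_V) => t i j.
by rewrite mxE.
Qed.

Lemma essbd_Vrest : essbd Vrest.
Proof.
apply: (essbd_reindex (f := id) (g := @rshift 1 (q + n2)) _ essbd_V) => t i j.
by rewrite mxE.
Qed.

Lemma essbd_Wcol : essbd Wcol.
Proof.
apply: (essbd_reindex (f := id) (g := @lshift 1 (p + m2)) _ (essbd_adj essbd_W)) => t i j.
by rewrite mxE.
Qed.

Lemma essbd_Wrest : essbd Wrest.
Proof.
apply: (essbd_reindex (f := id) (g := @rshift 1 (p + m2)) _ (essbd_adj essbd_W)) => t i j.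
by rewrite mxE.
Qed.

Lemma essbd_Phi1 : essbd (fac_Phi1 F).
Proof.
have h0 : essbd (fun t => fac_W F t *m Phi t *m fac_V F t).
  by apply: essbd_mul; [apply: essbd_mul => //; exact: essbd_W|exact: essbd_V].
have h1 : essbd (fun t => @drsubmx C 1 (p + m2) 1 (q + n2) (fac_W F t *m Phi t *m fac_V F t)).
  apply: (essbd_reindex (f := @rshift 1 (p + m2)) (g := @rshift 1 (q + n2)) _ h0) => t i j.
  by rewrite !mxE.
apply: (essbd_ae _ h1); first by apply/mxmeasurableP; exact: fac_Phi1_measurable.
by apply: aeS (fac_Phi1E F) => t ->; rewrite block_mxKdr.
Qed.

Lemma frame_V : \forall t \ae mu, frame (Vcol t) (Vrest t).
Proof. by apply: aeS (fac_V_unitary F) => t hV; exact: (@unitary_frame R (q + n2)). Qed.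

Lemma unitary_adj n (A : 'M[C]_n) : A \is unitarymx -> mxadj A \is unitarymx.
Proof. by rewrite -trmxC_unitary => hA; rewrite /mxadj /mxbar map_trmx. Qed.

Lemma frame_W : \forall t \ae mu, frame (Wcol t) (Wrest t).
Proof.
by apply: aeS (fac_W_unitary F) => t hW; apply: (@unitary_frame R (p + m2)); exact: unitary_adj.
Qed.

Lemma VcolE : \forall t \ae mu, Vcol t = fac_v F t.
Proof. by apply: aeS (fac_VE F) => t e; rewrite /Vcol e row_mxKl. Qed.

Lemma VrestE : \forall t \ae mu,
  Vrest t = row_mx (col_mx (mxbar (fac_Vc F t)) 0) (fac_Vstar F t).
Proof. by apply: aeS (fac_VE F) => t e; rewrite /Vrest e row_mxKr. Qed.

Lemma mxadj_trE n (A : 'M[C]_n) : mxadj A = mxbar A^T.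
Proof. by apply/matrixP => i j; rewrite !mxE. Qed.

Lemma W_adjE : \forall t \ae mu, mxadj (fac_W F t) = row_mx (mxbar (fac_w F t))
  (row_mx (col_mx (mxbar (mxbar (fac_Wc F t))) 0) (mxbar (fac_Wstar F t)))
    :> 'M[C]_(p.+1 + m2, 1 + (p + m2)).
Proof.
apply: aeS (fac_WE F) => t e; rewrite mxadj_trE e.
have <- : mxbar (row_mx (fac_w F t) (row_mx (col_mx (mxbar (fac_Wc F t)) 0) (fac_Wstar F t))) =
    row_mx (mxbar (fac_w F t))
      (row_mx (col_mx (mxbar (mxbar (fac_Wc F t))) 0) (mxbar (fac_Wstar F t))).
  rewrite !mxbar_row_mx mxbar_col_mx; congr (row_mx _ (row_mx (col_mx _ _) _)).
  by apply/matrixP => i j; rewrite !mxE conjc0.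
by [].
Qed.

Lemma WcolE : \forall t \ae mu, Wcol t = mxbar (fac_w F t).
Proof. by apply: aeS W_adjE => t e; rewrite /Wcol e row_mxKl. Qed.

Lemma WrestE : \forall t \ae mu,
  Wrest t = row_mx (col_mx (mxbar (mxbar (fac_Wc F t))) 0) (mxbar (fac_Wstar F t)).
Proof. by apply: aeS W_adjE => t e; rewrite /Wrest e row_mxKr. Qed.

Lemma colvec_neq0 n (v : 'cV[C]_n) : mxadj v *m v = 1%:M -> v != 0.
Proof.
move=> hv; apply/eqP => v0; move: hv; rewrite v0 mulmx0 => /matrixP /(_ 0 0).
by rewrite !mxE => /esym/eqP; rewrite oner_eq0.
Qed.

(** Where [h] vanishes, the convention [0^-1 = 0] would make the first column of a unitary matrix
    zero. *)
Lemma h_neq0 : \forall t \ae mu, h t != 0.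
Proof.
apply: aeS (aeI frame_V VcolE) => t [[/colvec_neq0 v0 _ _ _ _] e].
by apply: contraNneq v0 => h0; rewrite e /fac_v h0 invr0 mulr0 scale0r.
Qed.

(** For the same reason: [t0 = 0] would give [g = 0], hence a zero column in the adjoint of [W]. *)
Lemma t0_neq0 : t0 != 0.
Proof.
have [t [[/colvec_neq0 v0 _ _ _ _] e]] := ae_exists (aeI frame_W WcolE).
apply: contraNneq v0 => t00; rewrite e.
apply/eqP/matrixP => i j; rewrite !mxE.
by rewrite t00 invr0 mul0r !(conjc0, mulr0).
Qed.

Lemma theta_inner : [/\ H2s (fac_theta F), \forall t \ae mu, csq (fac_theta F t) = 1 &
  cmeas (fac_theta F)].
Proof. by case: (fac_thetaP F) => /inner_scal. Qed.

Lemma tau_inner : [/\ H2s (fac_tau F), \forall t \ae mu, csq (fac_tau F t) = 1 &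
  cmeas (fac_tau F)].
Proof. by case: (fac_tauP F) => /inner_scal. Qed.

Lemma h_H2s : H2s h.
Proof. by apply/H2_scal; case: (fac_h_outer F). Qed.

Lemma h_cmeas : cmeas h.
Proof. by have [[]] := h_H2s. Qed.

Lemma z_cmeas : cmeas (@z R).
Proof. by have := cmeas_zXz (R := R) 1. Qed.

Lemma u0_cmeas : cmeas u0.
Proof.
have [_ _ mth] := theta_inner; have [_ _ mta] := tau_inner.
apply: cmeasM; last by apply: cmeasV; exact: h_cmeas.
apply: cmeasM; last by apply: cmeasJ; exact: h_cmeas.
apply: cmeasM; last exact: cmeasJ.
by apply: cmeasM; apply: cmeasJ => //; exact: z_cmeas.
Qed.

Lemma csq_u0 : \forall t \ae mu, csq (u0 t) = 1.
Proof.
have [_ th _] := theta_inner; have [_ ta _] := tau_inner.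
apply: aeS (aeI h_neq0 (aeI th ta)) => t [h0 [e1 e2]].
rewrite /fac_u0 !csqM !csqJ csq_z e1 e2 csqV !mul1r divff//.
by apply/eqP => /csq_eq0 /eqP; apply/negP.
Qed.

Lemma vo_neq0 : \forall t \ae mu, fac_vo F t != 0.
Proof. exact: outer_neq0 (fac_vo_outer F). Qed.

Lemma wo_neq0 : \forall t \ae mu, fac_wo F t != 0.
Proof. exact: outer_neq0 (fac_wo_outer F). Qed.

(* [Phi = W^* diag(t0 u0, Phi1) V^*] *)
Lemma Phi_decomp : \forall t \ae mu, forall f : 'cV[C]_(q.+1 + n2), Phi t *m f =
  Wcol t *m ((t0%:C * u0 t)%:M *m (mxadj (Vcol t) *m f)) +
  Wrest t *m (fac_Phi1 F t *m (mxadj (Vrest t) *m f)).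
Proof.
apply: aeS (aeI (fac_Phi1E F) (aeI (fac_V_unitary F) (fac_W_unitary F))) => t [e [hV hW]] f.
exact: (@block_decomp R (p + m2) (q + n2) (fac_W F t) (Phi t) (fac_V F t) _ _ f hW hV e).
Qed.

End factor.

(** * The factorization as operators between Hilbert spaces *)

Section factor_operators.
Context {R : realType} {p q m2 n2 : nat}.
Local Notation C := R[i].
Local Notation mu := (@circ R).
Variables (Phi : R -> 'M[C]_(p.+1 + m2, q.+1 + n2)) (F : factorization Phi).
Hypothesis lPhi : essbd Phi.

Local Notation t0 := (fac_t0 F).
Local Notation h := (fac_h F).
Local Notation u0 := (fac_u0 F).
Local Notation N := (q.+1 + n2)%N.
Local Notation M := (p.+1 + m2)%N.
Local Notation N1 := (q + n2)%N.
Local Notation M1 := (p + m2)%N.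
Local Notation Hq := (analh p.+1 m2).
Local Notation Hq1 := (analh p m2).
Local Notation D := (domh q.+1 n2).
Local Notation D1 := (domh q n2).
Local Notation A := (symb lPhi).
Local Notation A1 := (symb (essbd_Phi1 F lPhi)).

Definition compress (f : L2h N) : L2h N1 := mulop (essbd_adj (essbd_Vrest F)) f.
Definition coord (f : L2h N) : L2h 1 := mulop (essbd_adj (essbd_Vcol F)) f.
Definition lift (xi : L2h 1) : L2h N := mulop (essbd_Vcol F) xi.
Local Notation b := compress.

Lemma nsq_comb n m l (c : R) (f : L2h n) (g : L2h m) (k : L2h l) :
  (\forall t \ae mu, vsq (@L2fun R n f t) = c * vsq (@L2fun R m g t) + vsq (@L2fun R l k t)) ->
  nsq f = c * nsq g + nsq k.
Proof.
move=> e; rewrite (nsq_int f) (nsq_int g) (nsq_int k).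
have ig := rint_vsq (L2tP g); have ik := rint_vsq (L2tP k); have jf := rint_vsq (L2tP f).
rewrite -RintegralZl// -RintegralD//; last exact: rintZ.
apply: Rint_ae => //; first exact: rint_meas jf.
by apply: rint_meas; apply: rintD => //; exact: rintZ.
Qed.

Lemma nsq_symb (f : L2h N) : nsq (A f) = t0 ^+ 2 * nsq (coord f) + nsq (A1 (b f)).
Proof.
apply: nsq_comb; apply: aeS (aeI (Phi_decomp F) (aeI (frame_W F) (csq_u0 F))) => t [e [fr u1]].
rewrite -[@L2fun R M (A f) t]/(Phi t *m @L2fun R N f t) e (frame_vsqD _ _ fr); congr (_ + _).
by rewrite /vsq !big_ord1 mul_scalar_mx mxE (csqM (t0%:C * u0 t)) (csqM t0%:C) u1 mulr1 csqC.
Qed.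

Lemma nsq_frame (f : L2h N) : nsq f = nsq (coord f) + nsq (b f).
Proof.
rewrite -[nsq (coord f)]mul1r; apply: nsq_comb; apply: aeS (frame_V F) => t fr.
by rewrite mul1r; exact: frame_vsq.
Qed.

Lemma compress_dom (f : L2h N) : D f -> D1 (b f).
Proof.
move=> Df; have [hVc _] := fac_Vc_co_outer F.
apply: (H2_ae _ (Hinf_mul hVc Df)).
  by have [] := L2_usub (L2tP (b f)).
apply: aeS (VrestE F) => t e.
rewrite -[@L2fun R N1 (b f) t]/(mxadj (Vrest F t) *m @L2fun R N f t) e.
by rewrite usub_frame.
Qed.

(** [y = Vrest g] is orthogonal to the whole domain. Orthogonality to zero plus [L^2] kills its
    lower block, so [frame_range] gives that [g] has zero lower block and the upper block of [y] is
    [mxbar Vc] times that of [g]. Orthogonality to the analytic part then says that the upper block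
    of [g] is orthogonal to [Vc^T H^2], dense because [Vc] is co-outer; being in [H^2], it
    vanishes. *)
Lemma compress_dense (g : L2h N1) : D1 g -> (forall f, D f -> hip (b f) g = 0) -> nsq g = 0.
Proof.
move=> Dg hg; have lV := essbd_Vrest F.
pose y : L2h N := mulop lV g.
have hy f : D f -> hip f y = 0.
  move=> Df; rewrite -[RHS](hg f Df) -[LHS]/(ip (@L2fun R N f) (@L2fun R N y)).
  rewrite -[RHS]/(ip (fun t => mxadj (Vrest F t) *m @L2fun R N f t) (@L2fun R N1 g)) ip_adj.
  by congr ip; apply/funext => t; rewrite mxadjK.
have dy : \forall t \ae mu, dsubmx (@L2fun R N y t) = 0.
  apply: ip_self_eq0; first by apply: L2_dsub; exact: L2tP.
  rewrite -ip_lower; apply: ip_eq0C; apply: hy.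
  by have := H2_zero (R := R) q.+1; congr H2; apply/funext => t; rewrite col_mxKu.
have gE : \forall t \ae mu,
    usubmx (@L2fun R N y t) = mxbar (fac_Vc F t) *m usubmx (@L2fun R N1 g t) /\
    dsubmx (@L2fun R N1 g t) = 0.
  apply: aeS (aeI dy (aeI (frame_V F) (aeI (VrestE F) (aeI (VcolE F) (aeI (fac_v1E F)
    (aeI (vo_neq0 F) (fac_Vc_unitary F))))))) => t [dyt [fr [eB [ev [v1 [vo0 un]]]]]].
  have yE : @L2fun R N y t = Vrest F t *m @L2fun R N1 g t by [].
  have [_ vB _ BB _] := fr.
  have vy : mxadj (Vcol F t) *m @L2fun R N y t = 0 by rewrite yE mulmxA vB mul0mx.
  have By : mxadj (Vrest F t) *m @L2fun R N y t = @L2fun R N1 g t.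
    by rewrite yE mulmxA BB mul1mx.
  rewrite eB in fr By; rewrite -ev in v1.
  have [uy] := frame_range fr v1 vo0 un dyt vy; rewrite By => gt.
  by rewrite gt col_mxKu col_mxKd.
have ga0 : ip (fun t => usubmx (@L2fun R N1 g t)) (fun t => usubmx (@L2fun R N1 g t)) = 0.
  apply: (outer_perp (fac_Vc_co_outer F)) => //; first by apply: L2_usub; exact: L2tP.
  move=> x Hx; have lx : L2 x by case: Hx.
  have lc : L2 (fun t => col_mx (x t) (0 : 'cV[C]_n2)) by apply: L2_col => //; exact: L2_zero.
  have Dc : D (toL2 lc) by move: Hx; congr H2; apply/funext => t; rewrite col_mxKu.
  rewrite ip_adj -[RHS](hy _ Dc) -[RHS]/(ip (fun t => col_mx (x t) 0) (@L2fun R N y)).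
  rewrite ip_split//; last exact: L2tP.
  have -> : ip (fun t => dsubmx (col_mx (x t) 0)) (fun t => dsubmx (@L2fun R N y t)) = 0.
    rewrite (ip_ae (L2_dsub lc) (L2_dsub lc) (L2_dsub (L2tP y)) (L2_zero n2) (aeT (fun=> erefl)) dy).
    exact: ip0.
  have lVc := Hinf_essbd (fac_Vc_inner F).1.
  have lg := L2_usub (L2tP g).
  rewrite addr0; apply: ip_ae => //.
  - exact: (L2_usub lc).
  - by apply: L2_mul => //; apply: essbd_adj; exact: essbd_tr.
  - exact: (L2_usub (L2tP y)).
  - by apply: aeT => t; rewrite col_mxKu.
  - apply: aeS gE => t [-> _]; congr (_ *m _).
    by apply/matrixP => i j; rewrite mxadjE !mxE.
have g0 := ip_self_eq0 (L2_usub (L2tP g)) ga0.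
apply/nsq0_ae; apply: aeS (aeI g0 gE) => t [e1 [_ e2]].
by rewrite -(vsubmxK (@L2fun R N1 g t)) e1 e2 col_mx0.
Qed.

(** The upper block of [v] is [vo vi], both factors bounded and analytic. *)
Lemma lift_dom (xi : L2h 1) : H2 (@L2fun R 1 xi) -> D (lift xi).
Proof.
move=> Hxi; have [hvo _] := fac_vo_outer F; have [hvi _] := fac_vi_inner F.
apply: (H2_ae _ (Hinf_mul hvi (Hinf_mul hvo Hxi))).
  by have [] := L2_usub (L2tP (lift xi)).
apply: aeS (aeI (VcolE F) (fac_v1E F)) => t [e1 e2].
rewrite -[@L2fun R N (lift xi) t]/(Vcol F t *m @L2fun R 1 xi t) e1 -{1}(vsubmxK (fac_v F t)).
by rewrite mul_col_mx col_mxKu e2 mulmxA; congr (_ *m _); rewrite mul_mx_scalar.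
Qed.

Lemma compress_lift (xi : L2h 1) : nsq (b (lift xi)) = 0.
Proof.
apply/nsq0_ae; apply: aeS (frame_V F) => t [_ _ Bv _ _].
rewrite -[LHS]/(mxadj (Vrest F t) *m (Vcol F t *m @L2fun R 1 xi t)).
by rewrite mulmxA Bv mul0mx.
Qed.

Lemma coord_lift (xi : L2h 1) : nsq (coord (lift xi) - xi) = 0.
Proof.
apply/nsq0_ae; apply: aeS (frame_V F) => t [vv _ _ _ _]; rewrite L2h_sub.
rewrite -[@L2fun R 1 (coord _) t]/(mxadj (Vcol F t) *m (Vcol F t *m @L2fun R 1 xi t)).
by rewrite mulmxA vv mul1mx subrr.
Qed.

Definition bdry (r : L2h M) : R -> C := fun t => (mxadj (Wcol F t) *m @L2fun R M r t) 0 0.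

Lemma L2_bdry r : L2 (fun t => mxadj (Wcol F t) *m @L2fun R M r t).
Proof. by apply: L2_mul; [apply: essbd_adj; exact: essbd_Wcol|exact: L2tP]. Qed.

Lemma L2s_bdry r : L2s (bdry r).
Proof. exact: ((L2P _).1 (L2_bdry r) 0). Qed.

Lemma bdryE (r : L2h M) : Hq r -> \forall t \ae mu, bdry r t =
  fac_wo F t * \sum_i fac_wi F t i 0 * usubmx (@L2fun R M r t) i 0.
Proof.
move=> [_ dr]; apply: aeS (aeI dr (aeI (WcolE F) (fac_w1E F))) => t [d0 [e1 e2]].
rewrite /bdry e1 mxadj_bar -{1}(vsubmxK (fac_w F t)) -{1}(vsubmxK (@L2fun R M r t)) d0.
rewrite tr_col_mx mul_row_col mulmx0 addr0 e2 mxE mulr_sumr; apply: eq_bigr => i _.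
by rewrite !mxE mulrA.
Qed.

(** Without a lower block in [r], only the upper block [wo wi] of [w] counts, and it is bounded and
    analytic. *)
Lemma H2s_bdry (r : L2h M) : Hq r -> H2s (bdry r).
Proof.
move=> Hr; apply: (H2s_ae _ _ (bdryE Hr)); first by have [] := L2s_bdry r.
have [hwo _] := fac_wo_outer F; have [hwi _] := fac_wi_inner F.
have [_ [B hB]] := Hinf_essbd hwo; have [_ [B' hB']] := Hinf_essbd hwi.
have e (u : R -> C) : (fun t => scal u t 0 0) = u by apply/funext => t; rewrite mxE.
apply: (H2s_mul (M := B)).
- by have := Hinf_H2s 0 0 hwo; rewrite e.
- by apply: aeS hB => t /(_ 0 0); rewrite mxE.
apply: H2s_sum => i; apply: (H2s_mul (M := B')); first exact: Hinf_H2s.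
  by apply: aeS hB' => t /(_ i 0).
exact: ((H2P _).1 Hr.1 i).
Qed.

Lemma u0E t : u0 t = conjc (z t) * conjc (fac_theta F t) * conjc (fac_tau F t) * conjc (h t) / h t.
Proof. by []. Qed.

Lemma cint_u0 (xi be : R -> C) : L2s xi -> L2s be -> cintg (fun t => u0 t * xi t * (be t)^*).
Proof.
move=> lx lb; apply: L2s_prod; last exact: L2sJ.
apply: (L2s_mul (M := 1)) => //; first exact: u0_cmeas.
by apply: aeS (csq_u0 F) => t ->.
Qed.

(** Multiplication by [Phi] sends [v xi] to [t0 u0 xi] times the conjugate of [w], the first column
    of the adjoint of [W]. *)
Lemma hip_symb_lift (xi : L2h 1) (r : L2h M) : hip (A (lift xi)) r =
  t0%:C * cintegral (fun t => u0 t * @L2fun R 1 xi t 0 0 * (bdry r t)^*).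
Proof.
have lx := L2t_L2s xi 0.
rewrite -cintegralZ; last by apply: cint_u0 => //; exact: L2s_bdry.
rewrite -[LHS]/(ip (@L2fun R M (A (lift xi))) (@L2fun R M r)) ip_conjcE.
apply: cintegral_ae.
- by apply: cintg_meas; apply: ip_cint; exact: L2tP.
- by apply: cintg_meas; apply: cintgZ; apply: cint_u0 => //; exact: L2s_bdry.
apply: aeS (aeI (Phi_decomp F) (frame_V F)) => t [e [vv _ Bv _ _]].
rewrite -[@L2fun R M (A (lift xi)) t]/(Phi t *m (Vcol F t *m @L2fun R 1 xi t)) e.
have c1 : mxadj (Vcol F t) *m (Vcol F t *m @L2fun R 1 xi t) = @L2fun R 1 xi t.
  by rewrite mulmxA vv mul1mx.
have c2 : mxadj (Vrest F t) *m (Vcol F t *m @L2fun R 1 xi t) = 0 by rewrite mulmxA Bv mul0mx.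
rewrite c1 c2 !mulmx0 addr0 vsum_adj big_ord1 -/(bdry r t) mul_scalar_mx mxE; ring.
Qed.

(* Multiplying by [h] turns orthogonality to [u0 H2] into the vanishing of all
   Fourier coefficients. *)
Lemma unimodular_perp (be : R -> C) : H2s be ->
  (forall xi, H2s xi -> cintegral (fun t => u0 t * xi t * (be t)^*) = 0) ->
  \forall t \ae mu, be t = 0.
Proof.
move=> hbe hperp; have [lbe _] := hbe; have hh := h_H2s F; have [lh _] := hh.
have [hth th1 mth] := theta_inner F; have [hta ta1 mta] := tau_inner F.
have lub : L2s (fun t => (u0 t)^* * be t).
  apply: (L2s_mul (M := 1)) => //; first by apply: cmeasJ; exact: u0_cmeas.
  by apply: aeS (csq_u0 F) => t u1; rewrite csqJ u1.
pose phi t := (u0 t)^* * be t * (h t)^*.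
have jphi : cintg phi by apply: L2s_prod => //; exact: L2sJ.
pose ga t := fac_theta F t * (fac_tau F t * be t).
have hga : H2s ga.
  apply: (H2s_mul (M := 1)) => //; first by apply: aeS th1 => t ->.
  by apply: (H2s_mul (M := 1)) => //; apply: aeS ta1 => t ->.
(* The conjugate of [u0] is [z theta tau h] divided by the conjugate of [h], so the denominator
   cancels. *)
have phiE : \forall t \ae mu, phi t = h t * ga t * z t ^ 1%:Z.
  apply: aeS (h_neq0 F) => t h0; rewrite /phi u0E /ga !conjMc !conjcK conjc_inv.
  by rewrite expr1z; field; rewrite conjc_eq0.
have jhg : cintg (fun t => h t * ga t) by apply: L2s_prod => //; case: hga.
have phi0 : \forall t \ae mu, phi t = 0.
  (* Frequencies [k <= 0] vanish because [phi] is [z] times a product of two [H2] functions, the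
     factor [z] covering [k = 0]. Frequencies [k > 0] vanish by orthogonality to [u0 xi] with
     [xi = z^k h]. *)
  apply: fourier_unique => // k; have [k0|k0] := leP k 0.
    rewrite (fourier_ae k jphi (cintg_zXz 1 jhg) phiE) /fourier.
    case: k k0 => [[|k]|k] // _.
      under [X in cintegral X]eq_fun do rewrite oppr0 expr0z mulr1.
      exact: (H2s_int_mul 0).
    under [X in cintegral X]eq_fun do rewrite -mulrA -zXzD.
    rewrite NegzE opprK; exact: (H2s_int_mul k.+1).
  case: k k0 => // k _.
  have hx : H2s (fun t => z t ^ k%:Z * h t).
    by apply: (H2s_mul (M := 1)) => //; [exact: H2s_zX|apply: aeT => t; rewrite csq_zXz].
  have := hperp _ hx => /(congr1 conjc); rewrite conjc0 -cintegralJ; last first.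
    by apply: cint_u0 => //; case: hx.
  move=> e; rewrite -[RHS]e; congr cintegral; apply/funext => t.
  by rewrite (conjMc (u0 t * _)) (conjMc (u0 t)) (conjMc (z t ^ _)) conjcK conj_zXz /phi; ring.
apply: aeS (aeI (aeI phi0 phiE) (aeI (h_neq0 F) (aeI th1 ta1))) => t [[e1 e2] [h0 [e3 e4]]].
have nz (c : C) : csq c = 1 -> c != 0.
  by move=> c1; apply/eqP => c0; move: c1; rewrite c0 csq0 => /esym/eqP; rewrite oner_eq0.
move: e2; rewrite e1 /ga => /esym/eqP.
rewrite !mulf_eq0 (negbTE h0) (negbTE (nz _ e3)) (negbTE (nz _ e4)) (negbTE (nz _ (csq_zXz t 1))).
by rewrite orbF => /eqP.
Qed.

(** With [bdry r = 0], [r] is recovered from its last coordinates [y], and its upper block is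
    [Wc zeta]. That [zeta] is analytic uses co-outerness: an outer [Wc^T] allows [Wc] to be
    cancelled without leaving [H^2]. *)
Lemma key_vector (r : L2h M) : Hq r ->
  (forall f, D f -> nsq (b f) = 0 -> hip (A f) r = 0) ->
  exists y, [/\ Hq1 y, nsq y <= nsq r &
    forall f, D f -> hip (A f) r = hip (A1 (b f)) y].
Proof.
move=> Hr hr; have [ur dr] := Hr.
have lc (xi : R -> C) : H2s xi -> L2 (scal xi) by move=> /H2_scal [].
have be0 : \forall t \ae mu, bdry r t = 0.
  apply: unimodular_perp => [|xi hxi]; first exact: H2s_bdry.
  have := hr _ (lift_dom (xi := toL2 (lc _ hxi)) ((H2_scal xi).2 hxi)) (compress_lift _).
  rewrite hip_symb_lift => /eqP; rewrite mulf_eq0 => /orP[/eqP t00|/eqP h0].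
    by have := t0_neq0 F; rewrite (complexI t00) eqxx.
  by rewrite -[RHS]h0; congr cintegral; apply/funext => t; rewrite mxE.
pose y : L2h M1 := mulop (essbd_adj (essbd_Wrest F)) r.
have yE t : @L2fun R M1 y t = mxadj (Wrest F t) *m @L2fun R M r t by [].
pose zeta t : 'cV[C]_p := (mxbar (fac_Wc F t))^T *m usubmx (@L2fun R M r t).
have rE : \forall t \ae mu, usubmx (@L2fun R M r t) = fac_Wc F t *m zeta t /\
    @L2fun R M1 y t = col_mx (zeta t) 0.
  apply: aeS (aeI dr (aeI be0 (aeI (frame_W F) (aeI (WrestE F) (aeI (WcolE F) (aeI (fac_w1E F)
    (aeI (wo_neq0 F) (fac_Wc_unitary F)))))))) => t [drt [bt [fr [eB [ev [w1 [wo0 un]]]]]]].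
  have wr : mxadj (Wcol F t) *m @L2fun R M r t = 0.
    by apply/matrixP => i j; rewrite !ord1 [RHS]mxE; exact: bt.
  have v1 : usubmx (Wcol F t) = (fac_wo F t)^* *: mxbar (fac_wi F t).
    have <- : mxbar (fac_wo F t *: fac_wi F t) = (fac_wo F t)^* *: mxbar (fac_wi F t).
      by apply/matrixP => i j; rewrite !mxE conjMc.
    by rewrite -w1 ev; apply/matrixP => i j; rewrite !mxE.
  have wo0' : (fac_wo F t)^* != 0 by rewrite conjc_eq0.
  have un' : (row_mx (mxbar (fac_wi F t)) (mxbar (mxbar (fac_Wc F t))) : 'M[C]_p.+1) \is unitarymx.
    by rewrite -mxbar_row_mx; exact: (unitary_bar un).
  rewrite yE eB; rewrite eB in fr.
  by have [e1 e2] := frame_range fr v1 wo0' un' drt wr; rewrite mxbarK in e1.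
have yzeta i : \forall t \ae mu, usubmx (@L2fun R M1 y t) i 0 = zeta t i 0.
  by apply: aeS rE => t [_ ->]; rewrite col_mxKu.
have ly := L2_usub (L2tP y).
exists y; split.
- split; last by apply: aeS rE => t [_ ->]; rewrite col_mxKd.
  split=> // i [//|l] _.
  (* Pairing [Wc^T x] with [eta] gives the integral of [x^T (Wc zeta) z^(l+1)]. Both [x] and
     [Wc zeta] are analytic, so it vanishes. *)
  pose eta t : 'cV[C]_p := \col_k (z t ^ l.+1%:Z * usubmx (@L2fun R M1 y t) k 0)^*.
  have leta : L2 eta.
    apply/L2P => k; under eq_fun do rewrite mxE; apply: L2sJ.
    apply: (L2s_mul (M := 1)); first exact: cmeas_zXz.
      by apply: aeT => t; rewrite csq_zXz.
    exact: ((L2P _).1 ly k).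
  have perp x : H2 x -> ip (fun t => (fac_Wc F t)^T *m x t) eta = 0.
    move=> Hx; have [lx _] := Hx.
    have lWx : L2 (fun t => (fac_Wc F t)^T *m x t).
      by apply: L2_mul => //; apply: essbd_tr; exact: (Hinf_essbd (fac_Wc_inner F).1).
    have hxr k := (H2P _).1 Hx k; have hrr k := (H2P _).1 ur k.
    have jk k : cintg (fun t => x t k 0 * usubmx (@L2fun R M r t) k 0 * z t ^ l.+1%:Z).
      by apply: cintg_zXz; apply: L2s_prod; [have [] := hxr k|have [] := hrr k].
    rewrite ip_conjcE; transitivity (cintegral (fun t =>
        \sum_k x t k 0 * usubmx (@L2fun R M r t) k 0 * z t ^ l.+1%:Z)); last first.
      by rewrite cintegral_sum// big1// => k _; exact: H2s_int_mul.
    apply: cintegral_ae.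
    - by apply: cintg_meas; exact: ip_cint.
    - by apply: cintg_meas; exact: cintg_sum.
    apply: aeS (aeI rE (ae_fin yzeta)) => t [[e1 _] e2].
    under eq_bigr do rewrite [eta t _ _]mxE conjcK e2 mxE mulr_suml.
    rewrite exchange_big; apply: eq_bigr => k _ /=.
    rewrite e1 mxE mulr_sumr mulr_suml; apply: eq_bigr => k' _.
    by rewrite mxE; ring.
  (* Testing against the constant vector [delta_mx i 0] yields the coefficient of frequency
     [-(l+1)]. *)
  have h0 := outer_perp (fac_Wc_co_outer F) leta perp (H2_zdelta i 0).
  rewrite -[RHS]h0 ip_conjcE /fourier; congr cintegral; apply/funext => t.
  rewrite (bigD1 i)//= big1 => [|k ki]; last by rewrite zdeltaE (negbTE ki) mul0r mul0r.
  by rewrite zdeltaE eqxx expr0z !mul1r addr0 [eta t _ _]mxE conjcK NegzE opprK mulrC.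
- rewrite (nsq_int y) (nsq_int r); apply: Rint_le.
  + exact: (rint_vsq (L2tP y)).
  + exact: (rint_vsq (L2tP r)).
  + by move=> t; exact: vsq_ge0.
  + by move=> t; exact: vsq_ge0.
  apply: aeS (frame_W F) => t fr.
  by rewrite (frame_vsq (@L2fun R M r t) fr) yE lerDr vsq_ge0.
- move=> f _; rewrite -[LHS]/(ip (@L2fun R M (A f)) (@L2fun R M r)).
  rewrite -[RHS]/(ip (@L2fun R M1 (A1 (b f))) (@L2fun R M1 y)) !ip_conjcE.
  apply: cintegral_ae; try by apply: cintg_meas; apply: ip_cint; exact: L2tP.
  apply: aeS (aeI (Phi_decomp F) be0) => t [e bt].
  rewrite -[@L2fun R M (A f) t]/(Phi t *m @L2fun R N f t) e.
  under eq_bigr do rewrite mxE mulrDl.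
  rewrite big_split /= vsum_adj [X in _ + X = _]vsum_adj big_ord1 -/(bdry r t) bt.
  by rewrite conjc0 mulr0 add0r.
Qed.

(** A zero Toeplitz image means that [u0 xi] is orthogonal to [H^2], to which [bdry r] belongs. *)
Lemma hip_symb_KerT (xi : L2h 1) (r : L2h M) : KerT u0 (@L2fun R 1 xi) -> Hq r ->
  hip (A (lift xi)) r = 0.
Proof.
move=> [Hxi T0] Hr; rewrite hip_symb_lift.
have lu : L2 (fun t => u0 t *: @L2fun R 1 xi t).
  apply/L2P => i; under eq_fun do rewrite mxE; apply: (L2s_mul (M := 1)).
  - exact: u0_cmeas.
  - by apply: aeS (csq_u0 F) => t ->.
  - exact: L2t_L2s.
pose w : L2h 1 := toL2 lu.
have [Hp hp] : [set g | H2 g /\ forall e, H2 e -> ip ((fun t => u0 t *: @L2fun R 1 xi t) - g) e = 0]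
    (Toeplitz u0 (@L2fun R 1 xi)).
  have [HP hP] := projP w (@closed_H2h R 1).
  apply: xgetPex; exists (@L2fun R 1 (proj (H2h 1) w)); split=> // e He.
  have [le _] := He; rewrite -[RHS](hP (toL2 le) He).
  by rewrite -[RHS]/(ip (@L2fun R 1 (w - proj (H2h 1) w)) e); congr ip.
have lb := H2s_bdry Hr; have Hb : H2 (scal (bdry r)) by apply/H2_scal.
have [lb' _] := Hb; have [lT _] := Hp.
rewrite -[X in _ * X](_ : ip (fun t => u0 t *: @L2fun R 1 xi t) (scal (bdry r)) = _); last first.
  by rewrite ip_conjcE; congr cintegral; apply/funext => t; rewrite big_ord1 !mxE mulr1n.
rewrite -[RHS](mulr0 t0%:C); congr (_ * _); rewrite -[RHS](hp _ Hb).
have lw' : L2 ((fun t => u0 t *: @L2fun R 1 xi t) - Toeplitz u0 (@L2fun R 1 xi)).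
  have := L2tP (toL2 lu - toL2 lT); congr L2; apply/funext => t; exact: L2t_sub.
apply: ip_ae => //; last exact: aeT.
by apply: aeS T0 => t e; rewrite -[RHS]/(u0 t *: @L2fun R 1 xi t - Toeplitz u0 (@L2fun R 1 xi) t) e subr0.
Qed.

End factor_operators.

(** * Comparison of singular numbers *)

Section singular_values.
Context {R : realType} {p q m2 n2 : nat}.
Local Notation C := R[i].
Local Notation mu := (@circ R).
Variables (Phi : R -> 'M[C]_(p.+1 + m2, q.+1 + n2)) (F : factorization Phi).
Hypothesis lPhi : essbd Phi.
Local Notation t0 := (fac_t0 F).
Local Notation u0 := (fac_u0 F).
Local Notation dom := (@fb_dom R q.+1 n2).
Local Notation cod := (@fb_cod R p.+1 m2).
Local Notation G := (compr1 (analh p.+1 m2) (symb lPhi)).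

Local Notation zop := (fun _ : R -> 'cV[C]_(q.+1 + n2) => (0 : R -> 'cV[C]_(p.+1 + m2))).

Lemma l2norm0 n : l2norm (0 : R -> 'cV[C]_n) = 0%E.
Proof.
have e : (0 : R -> 'cV[C]_n) = @L2fun R n (0 : L2h n).
  by apply/funext => t; rewrite -[RHS]/(@L2fun R n (0 : L2t R n) t) L2t_zero.
by rewrite e l2norm_nrm /nrm nsq0 sqrtr0.
Qed.

Lemma fb_cod0 : cod (fun=> 0).
Proof.
by apply/fb_codP; split=> [|r _]; [exact: L2_zero|rewrite ip_symm ?ip0 ?conjc0//; [exact: L2_zero|exact: L2tP]].
Qed.

Lemma op_norm_ge0 (T : (R -> 'cV[C]_(q.+1 + n2)) -> (R -> 'cV[C]_(p.+1 + m2))) : (0 <= op_norm dom T)%E.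
Proof.
have d0 : dom 0.
  apply/fb_domP; split; first exact: L2_zero.
  by have := H2_zero (R := R) q.+1; congr H2; apply/funext => t; apply/matrixP => i j; rewrite !mxE.
apply: (@le_trans _ _ (l2norm (T 0))); first exact: Lnorm_ge0.
by apply: ereal_sup_ubound; exists 0 => //; split=> //; rewrite l2norm0.
Qed.

Lemma bounded_linear0 : bounded_linear dom cod zop.
Proof.
split=> [f _|a f g _ _|]; first exact: fb_cod0.
  by apply: aeT => t; rewrite scaler0 addr0.
apply: (@le_lt_trans _ _ 0%E); last exact: ltry.
by apply: ge_ereal_sup => _ [f _ <-]; rewrite l2norm0.
Qed.

Lemma rank_le0 : rank_le dom 0 zop.
Proof.
exists (fun=> 0) => f _; exists (fun=> 0); apply: aeT => t.
by rewrite big_ord0.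
Qed.

(** Since [t0] is defined through [fine], the norm must be shown finite. The zero operator appears
    as the competitor of rank [0]. *)
Lemma op_norm_Gamma : op_norm dom (Gamma Phi \- zop)%R = t0%:E.
Proof.
have -> : Gamma Phi \- zop = Gamma Phi.
  by apply/funext => f; exact: subr0.
have [L L0 hL] := mulop_bounded lPhi.
rewrite fineK// ge0_fin_numE; last exact: op_norm_ge0.
apply: (@le_lt_trans _ _ L%:E); last exact: ltry.
apply: ge_ereal_sup => _ [f [/fb_domP [lf uf] f1] <-].
have [cG aG] := Gamma_ae lPhi (toL2 lf).
have -> : l2norm (Gamma Phi f) = (nrm (G (toL2 lf)))%:E.
  by rewrite -l2norm_nrm; apply: l2norm_ae aG; [exact: fb_cod_L2|exact: L2tP].
rewrite lee_fin; apply: le_trans (compr_le _ _) _; apply: le_trans (hL _) _.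
move: f1; rewrite -[f]/(@L2fun R _ (toL2 lf)) l2norm_nrm lee_fin => f1.
by rewrite -[leRHS]mulr1 ler_wpM2l.
Qed.

Lemma t0_ge0 : 0 <= t0.
Proof. by rewrite -lee_fin -op_norm_Gamma op_norm_ge0. Qed.

Lemma factor_transfer (s : R) j k0 (ka : 'I_k0 -> L2h 1) : 0 <= s -> s <= t0 ->
  (k0 = 0%N \/ s < t0) -> (forall i, KerT u0 (@L2fun R 1 (ka i))) ->
  (forall c : 'I_k0 -> C, nsq (\sum_i c i *: ka i) = 0 -> forall i, c i = 0) ->
  (forall u : 'I_(j.+1 + k0) -> L2h (q.+1 + n2), (forall i, domh q.+1 n2 (u i)) ->
    exists c : 'I_(j.+1 + k0) -> C, (exists i, c i != 0) /\
      let f := \sum_i c i *: u i in nrm (G f) <= s * nrm f) ->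
  (fb_snum j (Gamma (fac_Phi1 F)) <= s%:E)%E.
Proof.
move=> s0 st kst hka fka few.
have lPhi1 := essbd_Phi1 F lPhi.
have [L L0 hL] := mulop_bounded lPhi1.
have [sD _] := @closed_domh R q.+1 n2.
(* [coord] inverts [lift] up to null vectors and does not increase the norm, so [lift] preserves
   independence. *)
have lift_free (c : 'I_k0 -> C) : nsq (\sum_i c i *: lift F (ka i)) = 0 -> forall i, c i = 0.
  move=> h; apply: fka; set xi := \sum_i _.
  have e : \sum_i c i *: lift F (ka i) = lift F xi.
    by rewrite /lift (lin_sum (mulop_lin (essbd_Vcol F))).
  have n0 : nsq (coord F (lift F xi)) = 0.
    have := nsq_frame F (lift F xi); rewrite -{1}e h.
    have := nsq_ge0 (coord F (lift F xi)); have := nsq_ge0 (compress F (lift F xi)); lra.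
  rewrite -(subKr (coord F (lift F xi)) xi) nsqB n0 coord_lift ip_null ?coord_lift//=; lra.
have [e [De he]] : exists e : 'I_j -> L2h (q + n2), (forall i, domh q n2 (e i)) /\
    forall f, domh q n2 f -> nrm (f - \sum_l hip f (e l) *: e l) <= nrm f /\
      nrm (compr1 (analh p m2) (symb lPhi1) (f - \sum_l hip f (e l) *: e l)) <= s * nrm f.
  apply: (transfer (A := symb lPhi) (b := compress F) (xsq := fun f => nsq (coord F f))
    (kappa := fun i => lift F (ka i)) (A1s := mulop (essbd_adj lPhi1)) sD
    (@closed_analh R p.+1 m2) _ _ (symb_lin lPhi) _ _ _ L0 hL s0 st kst).
  - exact: closed_domh.
  - exact: closed_analh.
  - exact: mulop_lin.
  - exact: mulop_lin.
  - by move=> f y; exact: (ip_adj (fac_Phi1 F)).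
  - exact: nsq_symb.
  - exact: nsq_frame.
  - by move=> f; exact: nsq_ge0.
  - by move=> f; exact: compress_dom.
  - by move=> g; exact: compress_dense.
  - by move=> r; exact: key_vector.
  - by move=> i; exact: lift_dom (hka i).1.
  - by move=> i; exact: compress_lift.
  - by move=> i r; exact: hip_symb_KerT (hka i).
  - exact: lift_free.
  - exact: few.
by apply: (snum_le (e := e) (hPhi := lPhi1)) => // f Df; have [] := he f Df.
Qed.

(** If the kernel has no finite dimension, [hdim] is [0] by convention and the empty family
    serves. *)
Lemma KerT_basis : exists ka : 'I_(hdim (KerT u0)) -> L2h 1,
  (forall i, KerT u0 (@L2fun R 1 (ka i))) /\
  forall c : 'I_(hdim (KerT u0)) -> C, nsq (\sum_i c i *: ka i) = 0 -> forall i, c i = 0.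
Proof.
rewrite /hdim; case: xgetP => [k _ [b [hb fb _]]|_]; last first.
  by exists (fun=> 0); split=> [[]|c _ []].
have lb i : L2 (b i) by have [[]] := hb i.
exists (fun i => toL2 (lb i)); split=> // c h; apply: fb.
have /nsq0_ae := h; apply: aeS => t.
by rewrite (L2h_sum c (fun i => toL2 (lb i))).
Qed.

End singular_values.

Lemma snum_le_snum0 {R : realType} {m1 m2 n1 n2 : nat} j
    (T : (R -> 'cV[R[i]]_(n1 + n2)) -> (R -> 'cV[R[i]]_(m1 + m2))) :
  (fb_snum j T <= fb_snum 0 T)%E.
Proof.
apply: ereal_inf_le_tmp => _ [K [bK [b hb]] <-].
exists K => //; split=> //; exists (fun=> 0) => f Df; have [c hc] := hb f Df.
exists (fun=> 0); apply: aeS hc => t ->; rewrite big_ord0 big1// => i _.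
by rewrite scale0r.
Qed.

Theorem theorem10p1 (R : realType) (p q m2 n2 : nat)
    (T : (R -> 'cV[R[i]]_(q.+1 + n2)) -> (R -> 'cV[R[i]]_(p.+1 + m2)))
    (Phi : R -> 'M[R[i]]_(p.+1 + m2, q.+1 + n2))
    (hT : four_block_operator T)
    (hess : (fb_ess_norm T < fb_op_norm T)%E)
    (hPhi : superoptimal_symbol Phi T)
    (F : factorization Phi)
    (j : nat) :
  (fb_snum j (Gamma (fac_Phi1 F))
     <= fb_snum (j + hdim (KerT (fac_u0 F))) (Gamma Phi))%E.
Proof.
have lPhi : essbd Phi by apply: Linf_essbd; exact: hPhi.1.1.
apply: le_ereal_inf_tmp => _ [K [bK rK] <-].
have := op_norm_ge0 (Gamma Phi \- K)%R.
case hs : (op_norm _ _) => [s| |]// s0; last exact: leey.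
rewrite lee_fin in s0.
(* For [s < t0] the kernel functions are strictly positive for the form, and one vector more than
   the rank of [K] produces the combination required by [few]. *)
have [st|ts] := ltP s (fac_t0 F).
  have [ka [hka fka]] := KerT_basis F.
  apply: (factor_transfer (lPhi := lPhi) s0 (ltW st) (or_intror st) hka fka) => u Du.
  have lt : (j + hdim (KerT (fac_u0 F)) < j.+1 + hdim (KerT (fac_u0 F)))%N by rewrite addSn.
  by apply: (@small_rank_kernel R p.+1 m2 q.+1 n2 Phi lPhi K _ _ s u lt bK rK _ Du); rewrite hs.
(* The whole of [Gamma_{Phi1}] is bounded by [t0]: the case of no kernel functions and rank [0]. *)
apply: (@le_trans _ _ (fac_t0 F)%:E); last by rewrite lee_fin.
apply: le_trans (snum_le_snum0 _ _) _.
apply: (factor_transfer (lPhi := lPhi) (k0 := 0) (ka := fun=> 0) (t0_ge0 F lPhi) (lexx _) (or_introl erefl)).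
- by case.
- by move=> c _ [].
- move=> u Du; apply: (@small_rank_kernel R p.+1 m2 q.+1 n2 Phi lPhi _ 0 _ _ u (ltn0Sn _) bounded_linear0 rank_le0 _ Du) => //.
  by rewrite (op_norm_Gamma F lPhi).
Qed.
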